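(* Let $\mathcal{A}$ be a unital simple separable C*-algebra with real rank zero, stable rank one, and strict comparison of projections, and assume that $T(\mathcal{A})$ has a finite number of extremal points. Then every element $a\in\mathcal{A}_+$ is a positive linear combination of projections in $\mathcal{A}$.
   Context: A positive linear combination of projections is a finite linear combination of projections with positive coefficients. For a unital C*-algebra $\mathcal{A}$, $T(\mathcal{A})$ denotes the set of tracial states of $\mathcal{A}$ (a weak*-compact convex set). For projections $p,q\in\mathcal{A}$, $p\prec q$ means that $[p]<[q]$ in the strict ordering induced by Murray-von Neumann equivalence, i.e., $p$ is Murray-von Neumann equivalent to a proper subprojection of $q$. $\mathcal{A}$ has strict comparison of projections if $T(\mathcal{A})\neq\emptyset$ and, for any projections $p,q\in\mathcal{A}$, the strict inequalities $\tau(p)<\tau(q)$ for all $\tau\in T(\mathcal{A})$ imply $p\prec q$. *)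

(* Defs.v *)
From HB Require Import structures.
From mathcomp Require Import all_boot all_order all_algebra.
From mathcomp Require Import all_classical all_reals topology normedtype.
From mathcomp Require Import complex.

Set Implicit Arguments.
Unset Strict Implicit.
Unset Printing Implicit Defensive.

Import Order.TTheory GRing.Theory Num.Theory.
Import numFieldNormedType.Exports.

Local Open Scope classical_set_scope.
Local Open Scope complex_scope.
Local Open Scope ring_scope.

(* A unital *-algebra over the complex field R[i] with a C*-norm, not assumed
   complete.  As for every normed module over R[i], the norm takes its values in
   R[i], whose order makes 0 <= z mean that z is a nonnegative real.
   The unitAlgType structure on the carrier adds no hypothesis: it only names
   the predicate GRing.unit of two-sided invertibility, which the ring
   determines.  It does include 1 != 0, i.e. the zero algebra is excluded.
   This is a record, and not a Hierarchy-Builder join of NormedModule and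
   UnitAlgebra, because HB rejects such a join (NumDomain, which inherits from
   the norm and the ring structures, has already been declared). *)
Record preCstarAlgType (R : realType) := PreCstarAlg {
  pre_alg : unitAlgType R[i] ;
  pre_norm : pre_alg -> R[i] ;
  pre_star : pre_alg -> pre_alg ;
  pre_normD : forall x y, pre_norm (x + y) <= pre_norm x + pre_norm y ;
  pre_normZ : forall (c : R[i]) x, pre_norm (c *: x) = `|c| * pre_norm x ;
  pre_norm0_eq0 : forall x, pre_norm x = 0 -> x = 0 ;
  pre_normM : forall x y, pre_norm (x * y) <= pre_norm x * pre_norm y ;
  pre_starK : involutive pre_star ;
  pre_starD : forall x y, pre_star (x + y) = pre_star x + pre_star y ;
  pre_starZ : forall (c : R[i]) x, pre_star (c *: x) = c^* *: pre_star x ;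
  pre_starM : forall x y, pre_star (x * y) = pre_star y * pre_star x ;
  pre_cstar : forall x, pre_norm (pre_star x * x) = pre_norm x ^+ 2
}.

Definition pre_sort (R : realType) (A : preCstarAlgType R) : Type := pre_alg A.

HB.instance Definition _ (R : realType) (A : preCstarAlgType R) :=
  GRing.UnitAlgebra.copy (pre_sort A) (pre_alg A).
HB.instance Definition _ (R : realType) (A : preCstarAlgType R) :=
  @Lmodule_isNormed.Build R[i] (pre_sort A) (@pre_norm R A)
    (@pre_normD R A) (@pre_normZ R A) (@pre_norm0_eq0 R A).

Record cstarAlgType (R : realType) := CstarAlg {
  cstar_pre : preCstarAlgType R ;
  cstar_complete : forall F : set_system (pre_sort cstar_pre),
    ProperFilter F -> cauchy F -> cvg F
}.

Definition cstar_sort (R : realType) (A : cstarAlgType R) : Type :=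
  pre_sort (cstar_pre A).
Coercion cstar_sort : cstarAlgType >-> Sortclass.

HB.instance Definition _ (R : realType) (A : cstarAlgType R) :=
  GRing.UnitAlgebra.copy (cstar_sort A) (pre_sort (cstar_pre A)).
HB.instance Definition _ (R : realType) (A : cstarAlgType R) :=
  NormedModule.copy (cstar_sort A) (pre_sort (cstar_pre A)).
HB.instance Definition _ (R : realType) (A : cstarAlgType R) :=
  Uniform_isComplete.Build (cstar_sort A) (@cstar_complete R A).

Definition star (R : realType) (A : cstarAlgType R) (x : A) : A :=
  @pre_star R (cstar_pre A) x.

Section CStarAxioms.
Context {R : realType} {A : cstarAlgType R}.
Implicit Types (c : R[i]) (x y : A).

Lemma starK : involutive (@star R A).
Proof. exact: pre_starK. Qed.

Lemma starD x y : star (x + y) = star x + star y.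
Proof. exact: pre_starD. Qed.

Lemma starZ c x : star (c *: x) = c^* *: star x.
Proof. exact: pre_starZ. Qed.

Lemma starM x y : star (x * y) = star y * star x.
Proof. exact: pre_starM. Qed.

Lemma ler_cstar_normM x y : `|x * y| <= `|x| * `|y|.
Proof. exact: pre_normM. Qed.

Lemma cstar_norm x : `|star x * x| = `|x| ^+ 2.
Proof. exact: pre_cstar. Qed.

End CStarAxioms.

Definition separable_space (T : topologicalType) :=
  exists2 D : set T, countable D & dense D.

(* The scalars t with 0 < t < 1 are real, also when K = R[i]. *)
Definition extreme_points (K : numDomainType) (E : lmodType K) (S : set E) :
    set E :=
  [set x | S x /\ forall (y z : E) (t : K), S y -> S z -> 0 < t < 1 ->
             x = t *: y + (1 - t) *: z -> y = x /\ z = x].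

Section CStarNotions.
Context {R : realType} {A : cstarAlgType R}.
Implicit Types (a p q v x y : A).

Definition selfadjoint : set A := [set x | star x = x].

Definition projection : set A := [set p | star p = p /\ p * p = p].

Definition spectrum x : set R[i] := [set z | z%:A - x \isn't a GRing.unit].

Definition positive_element : set A :=
  [set a | selfadjoint a /\ spectrum a `<=` [set z | 0 <= z]].

(* Closure under opposites and scalars follows from the product closure, since
   A is unital. *)
Definition two_sided_ideal (I : set A) :=
  [/\ I 0, forall x y, I x -> I y -> I (x + y),
      forall a x, I x -> I (a * x) & forall a x, I x -> I (x * a)].

(* Boundedness is automatic, and the norm of a positive functional is its value
   at 1. *)
Definition tracial_state : set (A -> R[i]) :=
  [set tau | [/\ scalar tau, forall a, positive_element a -> 0 <= tau a,
                 tau 1 = 1 & forall x y, tau (x * y) = tau (y * x)]].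

Definition mvn_equiv p q := exists v, star v * v = p /\ v * star v = q.

Definition subprojection p q := projection p /\ p * q = p.

(* Used only for p and q projections. *)
Definition mvn_lt p q :=
  exists r, [/\ mvn_equiv p r, subprojection r q & r <> q].

Definition positive_combination_of_projections a :=
  exists (n : nat) (c : 'I_n -> R) (p : 'I_n -> A),
    [/\ forall i, 0 < c i, forall i, projection (p i)
      & a = \sum_(i < n) (c i)%:C *: p i].

End CStarNotions.

Arguments selfadjoint {R} A.
Arguments projection {R} A.
Arguments positive_element {R} A.
Arguments tracial_state {R} A.

Section CStarAlgebraProperties.
Context {R : realType} (A : cstarAlgType R).

Definition simple_cstar :=
  forall I : set A, two_sided_ideal I -> closed I -> I = [set 0] \/ I = setT.

(* Brown-Pedersen: the invertible self-adjoint elements are dense in the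
   self-adjoint ones. *)
Definition real_rank_zero :=
  selfadjoint A `<=` closure (selfadjoint A `&` [set x | x \is a GRing.unit]).

(* Rieffel: the invertible elements are dense. *)
Definition stable_rank_one := dense [set x : A | x \is a GRing.unit].

(* In R[i], tau p < tau q says that tau q - tau p is a positive real. *)
Definition strict_comparison :=
  tracial_state A !=set0 /\
  forall p q : A, projection A p -> projection A q ->
    (forall tau, tracial_state A tau -> tau p < tau q) -> mvn_lt p q.

End CStarAlgebraProperties.

(* Main.v *)
(** Finitely many extreme traces decide the comparison of projections, because a
self-adjoint element attains its maximal trace at an extreme trace.

If the traces of the nonzero projections are bounded below, increasing sequences of
projections are eventually constant, and real rank zero then yields a nonzero projection
annihilated by [|a| - a], which is not invertible. Peeling off such eigenprojections
terminates, since each of them uses up a fixed amount of trace.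

Otherwise there are projections of arbitrarily small trace. If [q x = x], [x q = 0] and
[|x| <= 1], then [x^* x - x x^* + q] is half the sum of two projections. Following Fack, in a
corner [r A r] every self-adjoint element on which all traces vanish is a sum of boundedly
many self-commutators of elements that go back and forth between two orthogonal halves of
[r]; hence [b + V r] is a positive combination of projections for some [V] and all such [b]
of norm at most [1]. Projections whose trace vectors span those of the corner extend this
to all self-adjoint [b], so that every element of [r A r] bounded below by a positive multiple
of [r] is a positive combination of projections.

For a general positive [a], real rank zero gives increasing projections [u m] on which [a]
is bounded below and off which it is small. The traces of the [u k], [k > m], exceed that of
[u m] by little, so by comparison the tail [a^(1/2) (1 - u m) a^(1/2)] is [X^* X] with [X X^*]
under [u (m - 1)]. Exchanging [X^* X] for [X X^*] costs a small multiple of [u (m - 1)], and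
leaves an element that is bounded below in the corner of the range projection of
[a^(1/2) (u m) a^(1/2)]. *)

Require Import Defs.
From mathcomp Require Import all_boot all_order all_algebra.
From mathcomp Require Import all_classical all_reals topology normedtype derive.
From mathcomp Require Import complex.
From mathcomp Require Import ring lra.

Set Implicit Arguments.
Unset Strict Implicit.
Unset Printing Implicit Defensive.

Import Order.TTheory GRing.Theory Num.Theory.
Local Open Scope ring_scope.
Local Open Scope complex_scope.

(** * Normal forms in noncommutative algebras *)

(** Instead of continuous functional calculus, two sources serve everything spectral: the power
    series solving k = z + k^2, which gives square roots near 1 and projections with a prescribed
    off-diagonal corner, and invertibility, which detects positivity. Only a few functions are then
    needed: square root, positive part, truncation at 1. An infinite sum of positive combinations
    need not be a positive combination, and each exchange of x^* x for x x^* costs a multiple of a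
    projection. Limits are therefore taken inside the self-commutators: every stage uses the same
    number of them, their sizes decay geometrically and their supports are orthogonal, so that the
    terms with the same index add up to a single element. For this the two halves, the orthogonal
    copies and a sequence of orthogonal projections with slowly decreasing traces have to be
    prepared before the iteration starts. *)

Section NoncommutativeNormalForm.
Variables (K : comNzRingType) (A : algType K).

Inductive ncexpr :=
  | NcVar of nat | NcZero | NcOne | NcAdd of ncexpr & ncexpr
  | NcOpp of ncexpr | NcMul of ncexpr & ncexpr | NcScale of K & ncexpr.

Fixpoint nc_eval (env : seq A) (e : ncexpr) : A :=
  match e with
  | NcVar n => nth 0 env n
  | NcZero => 0
  | NcOne => 1
  | NcAdd e1 e2 => nc_eval env e1 + nc_eval env e2
  | NcOpp e1 => - nc_eval env e1
  | NcMul e1 e2 => nc_eval env e1 * nc_eval env e2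
  | NcScale c e1 => c *: nc_eval env e1
  end.

(* Own copies of the list operations: [nc_simp] must unfold them without unfolding
   anything inside the coefficients. *)
Fixpoint nc_cat (T : Type) (s t : list T) : list T :=
  match s with nil => t | cons x s' => cons x (nc_cat s' t) end.

Fixpoint nc_eqn (m n : nat) : bool :=
  match m, n with
  | O, O => true | S m', S n' => nc_eqn m' n' | _, _ => false
  end.

Fixpoint nc_eqmon (s t : list nat) : bool :=
  match s, t with
  | nil, nil => true
  | cons m s', cons n t' => if nc_eqn m n then nc_eqmon s' t' else false
  | _, _ => false
  end.

Fixpoint nc_scale (c : K) (m : list nat) (p : list (K * list nat)) :=
  match p with
  | nil => nil
  | cons cm p' => cons (c * cm.1, nc_cat m cm.2) (nc_scale c m p')
  end.

Fixpoint nc_mul (p q : list (K * list nat)) :=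
  match p with
  | nil => nil
  | cons cm p' => nc_cat (nc_scale cm.1 cm.2 q) (nc_mul p' q)
  end.

Fixpoint nc_nf (e : ncexpr) : list (K * list nat) :=
  match e with
  | NcVar n => cons (1, cons n nil) nil
  | NcZero => nil
  | NcOne => cons (1, nil) nil
  | NcAdd e1 e2 => nc_cat (nc_nf e1) (nc_nf e2)
  | NcOpp e1 => nc_scale (-1) nil (nc_nf e1)
  | NcMul e1 e2 => nc_mul (nc_nf e1) (nc_nf e2)
  | NcScale c e1 => nc_scale c nil (nc_nf e1)
  end.

Fixpoint nc_insert (c : K) (m : list nat) (p : list (K * list nat)) :=
  match p with
  | nil => cons (c, m) nil
  | cons cm p' =>
      if nc_eqmon m cm.2 then cons (c + cm.1, m) p'
      else cons cm (nc_insert c m p')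
  end.

Fixpoint nc_collect (p : list (K * list nat)) :=
  match p with
  | nil => nil
  | cons cm p' => nc_insert cm.1 cm.2 (nc_collect p')
  end.

Fixpoint nc_all0 (p : list (K * list nat)) : Prop :=
  match p with nil => True | cons cm p' => cm.1 = 0 /\ nc_all0 p' end.

Let mon env (m : list nat) : A := \prod_(i <- m) nth 0 env i.
Let val env (p : list (K * list nat)) : A := \sum_(cm <- p) cm.1 *: mon env cm.2.

Lemma nc_catE T (s t : list T) : nc_cat s t = s ++ t.
Proof. by elim: s => //= x s ->. Qed.

Lemma nc_eqmonP s t : nc_eqmon s t -> s = t.
Proof.
elim: s t => [|m s ih] [|n t] //=.
case e : (nc_eqn m n) => // /ih ->; congr cons.
by elim: m n e => [|m ihm] [|n] //= /ihm ->.
Qed.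

Lemma nc_scaleE env c m p : val env (nc_scale c m p) = c *: (mon env m * val env p).
Proof.
elim: p => [|cm p ih] /=; first by rewrite /val !big_nil mulr0 scaler0.
rewrite /val !big_cons -!/(val _ _) ih /= nc_catE /mon big_cat /=.
by rewrite mulrDr scalerDr -scalerAr scalerA.
Qed.

Lemma nc_nfE env e : nc_eval env e = val env (nc_nf e).
Proof.
have cat p q : val env (nc_cat p q) = val env p + val env q.
  by rewrite nc_catE /val big_cat.
elim: e => [n|||e1 ih1 e2 ih2|e ih|e1 ih1 e2 ih2|c e ih] /=;
  rewrite ?ih1 ?ih2 ?ih.
- by rewrite /val /mon !big_seq1 scale1r.
- by rewrite /val big_nil.
- by rewrite /val /mon big_seq1 big_nil scale1r.
- by rewrite cat.
- by rewrite nc_scaleE /mon big_nil mul1r scaleN1r.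
- elim: (nc_nf e1) => [|cm p ih] /=; first by rewrite /val big_nil mul0r.
  by rewrite cat nc_scaleE -ih {1}/val big_cons -/(val env p) mulrDl scalerAl.
- by rewrite nc_scaleE /mon big_nil mul1r.
Qed.

Lemma nc_insertE env c m p :
  val env (nc_insert c m p) = c *: mon env m + val env p.
Proof.
elim: p => [|cm p ih] /=; first by rewrite /val !(big_seq1, big_nil) addr0.
case e: (nc_eqmon m cm.2).
  by rewrite /val !big_cons /= -(nc_eqmonP e) scalerDl addrA.
by rewrite /val !big_cons -!/(val _ _) ih addrCA.
Qed.

Lemma nc_collectE env p : val env (nc_collect p) = val env p.
Proof.
elim: p => [|cm p ih] //=.
by rewrite nc_insertE ih [RHS]/val big_cons.
Qed.

(** Collecting equal monomials leaves one condition per monomial, in the commutative coefficient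
    ring, where [ring] and [field] apply. *)
Lemma nc_correct env e1 e2 :
  nc_all0 (nc_collect (nc_nf (NcAdd e1 (NcOpp e2)))) ->
  nc_eval env e1 = nc_eval env e2.
Proof.
move=> h; apply/eqP; rewrite -subr_eq0; apply/eqP.
rewrite -[LHS]/(nc_eval env (NcAdd e1 (NcOpp e2))) nc_nfE -nc_collectE.
elim: (nc_collect _) h => [|cm p ih] /=; first by rewrite /val big_nil.
by case=> h /ih {}ih; rewrite /val big_cons h scale0r add0r.
Qed.

End NoncommutativeNormalForm.

Ltac nc_find x l :=
  lazymatch l with
  | cons ?y ?l' => match constr:(Set) with
      | _ => let _ := match constr:(Set) with _ => constr_eq x y end in constr:(O)
      | _ => let n := nc_find x l' in constr:(S n)
      end
  end.
Ltac nc_mem x l :=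
  lazymatch l with
  | nil => constr:(false)
  | cons ?y ?l' => match constr:(Set) with
      | _ => let _ := match constr:(Set) with _ => constr_eq x y end in constr:(true)
      | _ => nc_mem x l'
      end
  end.
Ltac nc_atoms t l :=
  lazymatch t with
  | (?x + ?y)%R => let l' := nc_atoms x l in nc_atoms y l'
  | (- ?x)%R => nc_atoms x l
  | (?x * ?y)%R => let l' := nc_atoms x l in nc_atoms y l'
  | (?c *: ?x)%R => nc_atoms x l
  | (?x ^+ 2)%R => nc_atoms x l
  | 0%R => l
  | 1%R => l
  | _ => lazymatch nc_mem t l with true => l | false => constr:(cons t l) end
  end.
Ltac nc_reify K t l :=
  lazymatch t with
  | (?x + ?y)%R => let a := nc_reify K x l in let b := nc_reify K y l in constr:(@NcAdd K a b)
  | (- ?x)%R => let a := nc_reify K x l in constr:(@NcOpp K a)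
  | (?x * ?y)%R => let a := nc_reify K x l in let b := nc_reify K y l in constr:(@NcMul K a b)
  | (?c *: ?x)%R => let a := nc_reify K x l in constr:(@NcScale K c a)
  | (?x ^+ 2)%R => let a := nc_reify K x l in constr:(@NcMul K a a)
  | 0%R => constr:(@NcZero K)
  | 1%R => constr:(@NcOne K)
  | _ => let n := nc_find t l in constr:(@NcVar K n)
  end.

Ltac nc_simp :=
  cbv [nc_all0 nc_collect nc_nf nc_insert nc_mul nc_scale nc_cat nc_eqmon nc_eqn fst snd].

Ltac nc_ A :=
  lazymatch goal with |- @eq _ ?l ?r =>
   lazymatch type of A with cstarAlgType ?R =>
    let K := constr:((R[i] : comNzRingType)) in
    let T := constr:((A : algType R[i])) in
    let l1 := nc_atoms l (@nil A) in
    let env := nc_atoms r l1 in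
    let a := nc_reify K l env in
    let b := nc_reify K r env in
    change (@nc_eval K T env a = @nc_eval K T env b); apply: nc_correct; nc_simp;
    repeat split
   end end.
Ltac nc0 := match goal with A : cstarAlgType _ |- _ => nc_ A end.
Ltac nc := by nc0; first [ring | by rewrite ?fmorphV; field | by rewrite ?(rmorphD, rmorphB, rmorphN, rmorphM, fmorphV) /=; field].

Lemma eq_of_subr (V : zmodType) (l r u v : V) : u = v -> l - r = u - v -> l = r.
Proof. by move=> -> /eqP; rewrite subrr subr_eq0 => /eqP. Qed.
(* [ncl H] proves [l = r] from [H : u = v] when [l - r] and [u - v] have the same
   normal form. *)
Ltac ncl H := apply: (eq_of_subr H); nc.
Ltac ncl2 H H' := apply: (eq_of_subr H); ncl H'.
Ltac ncl3 H H' H'' := apply: (eq_of_subr H); ncl2 H' H''.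

(** * Norm and limits *)

Section RealNorm.
Context {R : realType} {A : cstarAlgType R}.
Implicit Types (x y z : A) (c : R).

(** The norm of a module over [R[i]] is [R[i]]-valued; its real version makes [lra] and [nra]
    applicable. *)
Definition nrm x : R := complex.Re `|x|.

Lemma nrmE x : `|x| = (nrm x)%:C.
Proof.
rewrite /nrm; have : 0 <= `|x| := normr_ge0 x; case: `|x| => a b.
by rewrite lecE /= => /andP[/eqP b0 _]; rewrite b0.
Qed.

Lemma nrm_ge0 x : 0 <= nrm x.
Proof. by have := normr_ge0 x; rewrite nrmE lecR. Qed.

Lemma nrm0 : nrm 0 = 0.
Proof. by rewrite /nrm normr0. Qed.

Lemma nrm_eq0 x : nrm x = 0 -> x = 0.
Proof. by move=> h; apply/eqP; rewrite -normr_eq0 nrmE h. Qed.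

Lemma nrmD x y : nrm (x + y) <= nrm x + nrm y.
Proof. by rewrite -lecR rmorphD /= -!nrmE ler_normD. Qed.

Lemma nrmN x : nrm (- x) = nrm x.
Proof. by rewrite /nrm normrN. Qed.

Lemma nrmB x y : nrm (x - y) <= nrm x + nrm y.
Proof. by rewrite -(nrmN y) nrmD. Qed.

Lemma nrmC x y : nrm (x - y) = nrm (y - x).
Proof. by rewrite -nrmN opprB. Qed.

Lemma nrmM x y : nrm (x * y) <= nrm x * nrm y.
Proof. by rewrite -lecR rmorphM /= -!nrmE; exact: ler_cstar_normM. Qed.

Lemma nrmZC (c : R[i]) x : nrm (c *: x) = complex.Re `|c| * nrm x.
Proof.
rewrite {1}/nrm normrZ nrmE.
have : 0 <= `|c| := normr_ge0 c; case: `|c| => a b /=.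
by rewrite lecE /= => /andP[/eqP b0 _]; rewrite b0 mul0r subr0.
Qed.

Lemma nrmZ c x : nrm (c%:C *: x) = `|c| * nrm x.
Proof. by rewrite nrmZC normc_def /= expr0n addr0 sqrtr_sqr. Qed.

Lemma nrmZV c d x : 0 < c -> nrm x <= c * d -> nrm ((c^-1)%:C *: x) <= d.
Proof.
by move=> c0 h; rewrite nrmZ gtr0_norm ?invr_gt0 // ler_pdivrMl.
Qed.

Lemma nrmZi x : nrm ('i%C *: x) = nrm x.
Proof. by rewrite nrmZC normc_def /= expr0n /= add0r expr1n sqrtr1 mul1r. Qed.

Lemma star_realZ c x : star (c%:C *: x) = c%:C *: star x.
Proof. by rewrite starZ; congr (_ *: _); apply/eqP; rewrite eq_complex /= oppr0 !eqxx. Qed.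

Lemma star0 : star (0 : A) = 0.
Proof. by apply: (@addrI _ (star 0)); rewrite -starD !addr0. Qed.

Lemma starN x : star (- x) = - star x.
Proof. by apply/eqP; rewrite -addr_eq0 -starD addNr star0. Qed.

Lemma starB x y : star (x - y) = star x - star y.
Proof. by rewrite starD starN. Qed.

Lemma star1 : star (1 : A) = 1.
Proof. by rewrite -[LHS]mulr1 -[X in _ * X](starK 1) -starM mulr1 starK. Qed.

Lemma star_sum (I : Type) (r : seq I) (P : pred I) (F : I -> A) :
  star (\sum_(i <- r | P i) F i) = \sum_(i <- r | P i) star (F i).
Proof. by apply: (big_morph _ starD star0). Qed.

Lemma nrm_cstar x : nrm (star x * x) = nrm x ^+ 2.
Proof.
apply/eqP; rewrite -(inj_eq (@complexI _)) rmorphXn /= -!nrmE; apply/eqP; exact: cstar_norm.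
Qed.

Lemma nrm_star x : nrm (star x) = nrm x.
Proof.
suff le y : nrm y <= nrm (star y) by apply/le_anti; rewrite le -{2}(starK x) le.
have [y0|y0] := eqVneq (nrm y) 0; first by rewrite y0 nrm_ge0.
have ygt0 : 0 < nrm y by rewrite lt_def y0 nrm_ge0.
by rewrite -(ler_pM2r ygt0) -expr2 -nrm_cstar nrmM.
Qed.

Lemma nrm_cstarr x : nrm (x * star x) = nrm x ^+ 2.
Proof. by rewrite -{1}(starK x) nrm_cstar nrm_star. Qed.

Lemma nrm1 : nrm (1 : A) = 1.
Proof.
have := nrm_cstar 1; rewrite star1 mulr1 => /eqP; rewrite expr2 -[X in X == _]mulr1.
have n0 : nrm (1 : A) != 0 by apply/eqP => /nrm_eq0 /eqP; rewrite oner_eq0.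
by move=> /eqP /(mulfI n0).
Qed.

Lemma nrm_sa x : star x = x -> nrm (x * x) = nrm x ^+ 2.
Proof. by move=> h; rewrite -{1}h nrm_cstar. Qed.

Lemma star_eq0 x : star x * x = 0 -> x = 0.
Proof.
by move=> h; apply: nrm_eq0; apply/eqP; rewrite -sqrf_eq0 -nrm_cstar h nrm0.
Qed.

Lemma nrm_sum (I : Type) (r : seq I) (P : pred I) (F : I -> A) :
  nrm (\sum_(i <- r | P i) F i) <= \sum_(i <- r | P i) nrm (F i).
Proof.
elim/big_ind2: _ => //; first by rewrite nrm0.
by move=> x u y v xu yv; apply: le_trans (nrmD _ _) (lerD xu yv).
Qed.

Lemma nrmX x n : nrm (x ^+ n) <= nrm x ^+ n.
Proof.
elim: n => [|n ih]; first by rewrite !expr0 nrm1.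
by rewrite !exprS; apply: le_trans (nrmM _ _) _; rewrite ler_wpM2l ?nrm_ge0.
Qed.

End RealNorm.

Section Limits.
Context {R : realType} {A : cstarAlgType R}.
Implicit Types (u v : nat -> A) (l m x y z : A).

Definition tends u l :=
  forall e : R, 0 < e -> exists N, forall n, (N <= n)%N -> nrm (u n - l) < e.

Lemma tends_cst x : tends (fun=> x) x.
Proof. by move=> e e0; exists 0%N => n _; rewrite subrr nrm0. Qed.

Lemma tends_bound u v l x : (forall n, nrm (u n - l) <= nrm (v n - x)) ->
  tends v x -> tends u l.
Proof.
move=> le h e /h[N hN]; exists N => n /hN; exact: le_lt_trans (le n).
Qed.

Lemma tends_eq u v l : u =1 v -> tends u l -> tends v l.
Proof. by move=> uv; apply: tends_bound => n; rewrite uv. Qed.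

Lemma tends_shift u l k : tends u l -> tends (fun n => u (n + k)%N) l.
Proof.
move=> h e /h[N hN]; exists N => n Nn; apply: hN.
by apply: leq_trans Nn (leq_addr _ _).
Qed.

Lemma tendsD u v l m : tends u l -> tends v m -> tends (fun n => u n + v n) (l + m).
Proof.
move=> hu hv e e0; have e2 : 0 < e / 2 by lra.
have [N hN] := hu _ e2; have [M hM] := hv _ e2.
exists (maxn N M) => n; rewrite geq_max => /andP[/hN h1 /hM h2].
rewrite (_ : _ - _ = (u n - l) + (v n - m)); last by nc.
by have := nrmD (u n - l) (v n - m); lra.
Qed.

Lemma tendsN u l : tends u l -> tends (fun n => - u n) (- l).
Proof. by apply: tends_bound => n; rewrite -opprD nrmN. Qed.

Lemma tendsB u v l m : tends u l -> tends v m -> tends (fun n => u n - v n) (l - m).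
Proof. by move=> hu /tendsN; exact: tendsD. Qed.

Lemma tends_star u l : tends u l -> tends (fun n => star (u n)) (star l).
Proof. by apply: tends_bound => n; rewrite -starB nrm_star. Qed.

Lemma tendsMl x u l : tends u l -> tends (fun n => x * u n) (x * l).
Proof.
move=> h e e0; have c0 : 0 < nrm x + 1 by have := nrm_ge0 x; lra.
have [N hN] := h _ (divr_gt0 e0 c0); exists N => n /hN.
rewrite ltr_pdivlMr // -mulrBr => hn; apply: le_lt_trans (nrmM _ _) _.
by apply: le_lt_trans hn; rewrite mulrC ler_wpM2l ?nrm_ge0 // lerDl.
Qed.

Lemma tendsMr x u l : tends u l -> tends (fun n => u n * x) (l * x).
Proof.
move=> /tends_star/(tendsMl (star x))/tends_star.
by rewrite starM !starK; apply: tends_eq => n; rewrite starM !starK.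
Qed.

Lemma tends_nrm_le u l c : (forall n, nrm (u n) <= c) -> tends u l -> nrm l <= c.
Proof.
move=> le h; apply/ler_addgt0Pr => e /h[N /(_ N (leqnn N))] hN.
have := le N; have := nrmB (u N) (u N - l).
rewrite (_ : u N - (u N - l) = l); last by nc.
by lra.
Qed.

Lemma tendsM u v l m : tends u l -> tends v m -> tends (fun n => u n * v n) (l * m).
Proof.
move=> hu hv.
have h0 : tends (fun n => (u n - l) * (v n - m)) 0.
  move=> e e0.
  have [N hN] := hu _ ltr01; have [M hM] := hv _ e0.
  exists (maxn N M) => n; rewrite geq_max => /andP[/hN h1 /hM h2]; rewrite subr0.
  apply: le_lt_trans (nrmM _ _) _.
  have := nrm_ge0 (u n - l); have := nrm_ge0 (v n - m); nra.
have := tendsD h0 (tendsD (tendsMr m hu) (tendsMl l hv)).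
move=> /tendsB /(_ (tends_cst (l * m))).
rewrite (_ : _ - _ = l * m); last by nc.
by apply: tends_eq => n; nc.
Qed.

Lemma tends_uniq u l m : tends u l -> tends u m -> l = m.
Proof.
move=> h1 h2; apply/eqP; rewrite -subr_eq0; apply/eqP/nrm_eq0/eqP.
rewrite eq_le nrm_ge0 andbT; apply: (@tends_nrm_le (fun n => u n - u n)).
  by move=> n; rewrite subrr nrm0.
by have := tendsB h2 h1 => /tendsN; rewrite opprB; apply: tends_eq => n; nc.
Qed.

Lemma tends_sa u l : (forall n, star (u n) = u n) -> tends u l -> star l = l.
Proof.
by move=> su h; apply: (tends_uniq _ h); apply: tends_eq (tends_star h).
Qed.

(** The point where completeness of [A] enters; the existence of every later limit of a sequence in
    [A] rests on it. *)
Lemma cauchy_tends u :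
  (forall e : R, 0 < e -> exists N, forall i j, (N <= i)%N -> (N <= j)%N ->
     nrm (u i - u j) < e) ->
  exists l, tends u l.
Proof.
move=> h; pose F : set_system A := (u n @[n --> \oo])%classic.
have FF : ProperFilter F by apply: fmap_proper_filter; exact: eventually_filter.
have cF : cauchy F.
  apply/cauchy_exP => e e0.
  have e0' : 0 < complex.Re e by move: e0; rewrite ltcE /= => /andP[].
  have ee : e = (complex.Re e)%:C.
    by case: (e) e0 => a b; rewrite ltcE /= => /andP[/eqP b0 _]; rewrite b0.
  have [N hN] := h _ e0'; exists (u N); exists N => // n Nn.
  by rewrite -ball_normE /= nrmE ee ltcR hN.
have /cvg_ex[l hl] := @cauchy_cvg A F FF cF.
exists l => e e0.
move/cvgrPdist_lt: hl => /(_ e%:C); rewrite ltcR => /(_ e0) [N _ hN].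
exists N => n Nn; have := hN n Nn; rewrite /= nrmE ltcR; by rewrite nrmC.
Qed.

End Limits.

(** * Square roots and positive elements *)

Section Catalan.
Context {R : realType} {A : cstarAlgType R}.
Implicit Types (x y z : A) (u : nat -> A) (v : nat -> R).

(** The increments of [u] are dominated by those of a bounded increasing real sequence, so that past
    [N] the sequence moves by at most [sup S - v N]. *)
Lemma tends_increments u v c : (forall n, nrm (u n.+1 - u n) <= v n.+1 - v n) ->
  (forall n, v n <= c) -> exists l, tends u l.
Proof.
move=> uv vc; apply: cauchy_tends => e e0.
pose S := range v.
have hS : has_sup S.
  by split; [exists (v 0%N); exists 0%N | exists c => _ [n _ <-]].
have [_ [N _ <-] hN] := sup_adherent e0 hS.
have le i d : nrm (u (i + d)%N - u i) <= v (i + d)%N - v i.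
  elim: d => [|d ih]; first by rewrite addn0 !subrr nrm0.
  rewrite addnS (_ : _ - _ = (u (i + d).+1 - u (i + d)%N) + (u (i + d)%N - u i)); last by nc.
  by have := nrmD (u (i + d).+1 - u (i + d)%N) (u (i + d)%N - u i); have := uv (i + d)%N; lra.
have vs n : v n <= sup S by apply: sup_upper_bound => //; exists n.
have vm i d : v i <= v (i + d)%N by rewrite -subr_ge0; apply: le_trans (le i d); rewrite nrm_ge0.
exists N => i j; wlog ij : i j / (i <= j)%N => [hw Ni Nj|Ni Nj].
  by have /orP[h|h] := leq_total i j; [|rewrite nrmC]; apply: hw.
rewrite nrmC -(subnKC ij); apply: le_lt_trans (le _ _) _.
have := vs (i + (j - i))%N; have := vm N (i - N)%N; rewrite subnKC //; lra.
Qed.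

(** Fixed-point iteration for k = z + k^2. Its limit is z times the generating function of the
    Catalan numbers, whose radius of convergence is 1/4. *)
Fixpoint catalan_seq z n : A :=
  if n is n'.+1 then z + catalan_seq z n' * catalan_seq z n' else 0.

(** The same iteration for the scalar 1/4. It majorizes the one for any [z] of norm at most 1/4, as
    the polynomials involved have nonnegative coefficients, and it stays below its fixed point
    1/2. *)
Fixpoint catalan_bound n : R :=
  if n is n'.+1 then 4^-1 + catalan_bound n' * catalan_bound n' else 0.

Lemma catalan_boundP n : 0 <= catalan_bound n <= 2^-1.
Proof. by elim: n => [|n /andP[]] /=; nra. Qed.

Lemma catalan_seq_nrm z n : nrm z <= 4^-1 -> nrm (catalan_seq z n) <= catalan_bound n.
Proof.
move=> hz; elim: n => [|n ih] /=; first by rewrite nrm0.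
apply: le_trans (nrmD _ _) (lerD hz (le_trans (nrmM _ _) _)).
by rewrite ler_pM ?nrm_ge0.
Qed.

Lemma catalan_seq_cvg z : nrm z <= 4^-1 -> exists l, tends (catalan_seq z) l.
Proof.
move=> hz; apply: (@tends_increments _ catalan_bound 2^-1) => n; last first.
  by have /andP[] := catalan_boundP n.
elim: n => [|n ih]; first by rewrite /= mulr0 addr0 subr0 mulr0 addr0 subr0.
rewrite -[catalan_seq z n.+2]/(z + catalan_seq z n.+1 * catalan_seq z n.+1).
rewrite -[X in _ - X]/(z + catalan_seq z n * catalan_seq z n).
rewrite -[catalan_bound n.+2]/(4^-1 + catalan_bound n.+1 * catalan_bound n.+1).
rewrite -[X in _ <= _ - X]/(4^-1 + catalan_bound n * catalan_bound n).
have := catalan_seq_nrm n.+1 hz; have := catalan_seq_nrm n hz.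
move: (catalan_seq z n.+1) (catalan_seq z n) (catalan_bound n.+1) (catalan_bound n) ih => a b s t ab at_ bs.
rewrite (_ : _ - _ = a * (a - b) + (a - b) * b); last by nc.
have := nrmD (a * (a - b)) ((a - b) * b).
have := nrmM a (a - b); have := nrmM (a - b) b.
have := nrm_ge0 a; have := nrm_ge0 b; have := nrm_ge0 (a - b); nra.
Qed.

(* The analytic solution of k = z + k ^ 2 that vanishes at 0. *)
Definition catalan z : A := xget 0 [set l | tends (catalan_seq z) l]%classic.

Lemma catalan_tends z : nrm z <= 4^-1 -> tends (catalan_seq z) (catalan z).
Proof. by move=> /catalan_seq_cvg; exact: (@xgetPex _ 0 [set l | tends (catalan_seq z) l]%classic). Qed.

Lemma catalanE z : nrm z <= 4^-1 -> catalan z = z + catalan z * catalan z.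
Proof.
move=> /catalan_tends h; apply: tends_uniq (tendsD (tends_cst z) (tendsM h h)).
by apply: tends_eq (tends_shift 1 h) => n; rewrite addn1.
Qed.

Lemma catalan_nrm z : nrm z <= 4^-1 -> nrm (catalan z) <= 2^-1.
Proof.
move=> hz; apply: tends_nrm_le (catalan_tends hz) => n.
by apply: le_trans (catalan_seq_nrm n hz) _; have /andP[] := catalan_boundP n.
Qed.

Lemma catalan_intertwine x y z : nrm y <= 4^-1 -> nrm z <= 4^-1 ->
  x * y = z * x -> x * catalan y = catalan z * x.
Proof.
move=> hy hz xy; apply: tends_uniq (tendsMl x (catalan_tends hy)) _.
apply: tends_eq (tendsMr x (catalan_tends hz)) => n.
elim: n => [|n ih] /=; first by rewrite mulr0 mul0r.
by rewrite mulrDl mulrDr xy -mulrA ih mulrA ih mulrA.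
Qed.

Lemma catalan_sa z : nrm z <= 4^-1 -> star z = z -> star (catalan z) = catalan z.
Proof.
move=> hz sz; apply: tends_sa (catalan_tends hz).
by elim=> [|n ih] /=; rewrite ?star0 // starD starM ih sz.
Qed.

(** Neumann series. *)
Lemma unit_1B x : nrm x < 1 -> 1 - x \is a GRing.unit.
Proof.
move=> x1; pose u n := \sum_(i < n) x ^+ i; pose q := nrm x.
have q0 : 0 <= q := nrm_ge0 x.
have [||l hl] := @tends_increments u (fun n => (1 - q ^+ n) / (1 - q)) (1 - q)^-1.
- move=> n; rewrite /u big_ord_recr /= addrAC subrr add0r.
  apply: le_trans (nrmX _ _) _; rewrite -mulrBl exprS -/q.
  rewrite (_ : _ - _ = q ^+ n * (1 - q)); last by ring.
  by rewrite mulfK // subr_eq0 eq_sym lt_eqF.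
- move=> n; rewrite ler_piMl ?invr_ge0 ?subr_ge0 ?(ltW x1) //.
  by rewrite gerBl exprn_ge0.
have h0 : tends (fun n => 1 - x ^+ n) 1.
  (* The powers converge because the partial sums do; their limit satisfies x m = m, so |m| <= |x|
     |m| forces m = 0. *)
  have [m hm] : exists m, tends (fun n => x ^+ n) m.
    exists (1 - (1 - x) * l); apply: tends_eq (tendsB (tends_cst 1) (tendsMl (1 - x) hl)) => n.
    by rewrite -[RHS](subrK 1) subrX1 -/(u n); nc.
  have xm : x * m = m.
    apply: tends_uniq (tendsMl x hm) _.
    by apply: tends_eq (tends_shift 1 hm) => n; rewrite addn1 exprS.
  suff m0 : m = 0 by have := tendsB (tends_cst 1) hm; rewrite m0 subr0.
  apply: nrm_eq0; have := nrmM x m; rewrite xm; have := nrm_ge0 m; nra.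
apply/unitrP; exists l; split.
  apply: tends_uniq (tendsMr (1 - x) hl) _; apply: tends_eq h0 => n.
  elim: n => [|n ih]; first by rewrite /u big_ord0 mul0r expr0 subrr.
  by rewrite /u big_ord_recr /= mulrDl -/(u n) -ih exprSr; nc.
apply: tends_uniq (tendsMl (1 - x) hl) _; apply: tends_eq h0 => n.
elim: n => [|n ih]; first by rewrite /u big_ord0 mulr0 expr0 subrr.
by rewrite /u big_ord_recr /= mulrDr -/(u n) -ih exprS; nc.
Qed.

End Catalan.

Section PositiveCone.
Context {R : realType} {A : cstarAlgType R}.
Implicit Types (h k x y z : A) (c e t : R).

Let i2 : 'i%C * 'i%C = -1 :> R[i].
Proof. by rewrite -expr2 sqr_i. Qed.

Lemma starZi x : star ('i%C *: x) = - ('i%C *: star x).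
Proof.
rewrite starZ -scaleNr; congr (_ *: _).
by apply/eqP; rewrite eq_complex /= oppr0 !eqxx.
Qed.

Lemma real_alg_sa c : star (c%:C%:A : A) = c%:C%:A.
Proof. by rewrite star_realZ star1. Qed.

Lemma nrm_real_alg c : nrm (c%:C%:A : A) = `|c|.
Proof. by rewrite nrmZ nrm1 mulr1. Qed.

(* [y + i w] is unitary and [y] is its real part. *)
Lemma nrm_sphere y w : star y = y -> star w = w -> y * w = w * y ->
  y * y + w * w = 1 -> nrm y <= 1.
Proof.
move=> sy sw yw h; pose u := y + 'i%C *: w.
have su : star u = y - 'i%C *: w by rewrite starD starZi sy sw.
have u1 : nrm u = 1.
  have : nrm (star u * u) = 1.
    rewrite su (_ : _ * u = 1) ?nrm1 // -h /u.
    transitivity (y * y + w * w + 'i%C *: (y * w - w * y)); last by rewrite yw subrr scaler0 addr0.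
    by nc0; ring: i2.
  by rewrite nrm_cstar => /eqP; rewrite sqrp_eq1 ?nrm_ge0 // => /eqP.
rewrite (_ : y = (2^-1)%:C *: (u + star u)).
  rewrite nrmZ ger0_norm ?invr_ge0 //; have := nrmD u (star u).
  by rewrite nrm_star u1; lra.
by rewrite su /u; nc0; rewrite fmorphV rmorphD /=; field.
Qed.

(** With w = (1 - x)/4 and k = w + k^2 one has (1 - 2k)^2 = 1 - 4(k - k^2) = 1 - 4w = x. *)
Lemma sqrt_near1 x : star x = x -> nrm (1 - x) <= 1 ->
  exists h, [/\ star h = h, h * h = x, nrm (1 - h) <= 1
     & forall z, z * x = x * z -> z * h = h * z].
Proof.
move=> sx x1; pose w := (4^-1)%:C *: (1 - x).
have hw : nrm w <= 4^-1 by rewrite nrmZ ger0_norm ?invr_ge0 //; lra.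
have sw : star w = w by rewrite star_realZ starB star1 sx.
pose k := catalan w; have k2 := nrmZ 2 k; have ke := catalanE hw; have kn := catalan_nrm hw.
exists (1 - 2%:C *: k); split.
- by rewrite starB star1 star_realZ catalan_sa.
- transitivity (1 - 4%:C *: (k - k * k)).
    by nc.
  by rewrite -/k in ke; rewrite {1}ke addrK /w; nc.
- by rewrite opprB addrC subrK k2 ger0_norm //; rewrite -/k in kn; lra.
- move=> z zx; have := @catalan_intertwine _ _ z w w hw hw.
  have zw : z * w = w * z by rewrite /w -scalerAr -scalerAl mulrBr mulrBl zx mul1r mulr1.
  by move=> /(_ zw) zk; rewrite mulrBr mulrBl mulr1 mul1r -scalerAr -scalerAl zk.
Qed.

(* Squares make the cone accessible before any spectral theory; [positive_elementE]
   identifies it with positivity of the spectrum. *)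
Definition pos x := exists h, star h = h /\ x = h * h.

Lemma pos_sa x : pos x -> star x = x.
Proof. by move=> [h [sh ->]]; rewrite starM sh. Qed.

Lemma pos0 : pos 0.
Proof. by exists 0; rewrite star0 mulr0. Qed.

Lemma pos_sq h : star h = h -> pos (h * h).
Proof. by exists h. Qed.

Lemma posZ c x : 0 <= c -> pos x -> pos (c%:C *: x).
Proof.
move=> c0 [h [sh ->]]; exists ((Num.sqrt c)%:C *: h); rewrite star_realZ sh; split=> //.
by rewrite -[X in X%:C](sqr_sqrtr c0); nc.
Qed.

Lemma pos_near1 x : star x = x -> nrm (1 - x) <= 1 -> pos x.
Proof. by move=> sx /(sqrt_near1 sx)[h [sh <- _ _]]; exists h. Qed.

(** If x = h^2 and 1 - h^2 = w^2 with w commuting with h, then w is the real part of the unitary w +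
    i h, so that |w| <= 1. *)
Lemma pos_nrm1B x : pos x -> nrm x <= 1 -> nrm (1 - x) <= 1.
Proof.
move=> [h [sh ->]]; rewrite nrm_sa // => h1.
have [//||w [sw ww w1 wc]] := @sqrt_near1 (1 - h * h).
- by rewrite starB star1 starM sh.
- by rewrite opprB addrC subrK nrm_sa.
rewrite -ww; apply: le_trans (nrmM _ _) _.
suff : nrm w <= 1 by have := nrm_ge0 w; nra.
apply: (@nrm_sphere w h) => //.
- by rewrite -wc // mulrBr mulrBl mulr1 mul1r mulrA.
- by rewrite ww subrK.
Qed.

Lemma posZV c x : 0 < c -> pos (c%:C *: x) -> pos x.
Proof.
move=> c0 /(@posZ c^-1); rewrite scalerA -rmorphM /= mulVf ?gt_eqF // scale1r.
by apply; rewrite invr_ge0 ltW.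
Qed.

(** Together with [nrmB_pos] this describes the cone by the closed convex condition |c - x| <= c for
    large c, from which closure under sums and limits follows. *)
Lemma pos_nrmB x c : 0 < c -> star x = x -> nrm (c%:C%:A - x) <= c -> pos x.
Proof.
move=> c0 sx h; apply: (@posZV c^-1); first by rewrite invr_gt0.
apply: pos_near1; first by rewrite star_realZ sx.
rewrite (_ : _ - _ = (c^-1)%:C *: (c%:C%:A - x)).
  by apply: nrmZV; rewrite ?mulr1.
by rewrite scalerBr scalerA -rmorphM /= mulVf ?gt_eqF // scale1r.
Qed.

Lemma nrmB_pos x c : nrm x <= c -> pos x -> nrm (c%:C%:A - x) <= c.
Proof.
move=> xc px; have [c0|c0] := ltrP 0 c; last first.
  have x0 : nrm x = 0 by apply/eqP; rewrite eq_le nrm_ge0 andbT (le_trans xc).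
  have -> : c = 0 by apply/eqP; rewrite eq_le c0 -x0 xc.
  by rewrite (nrm_eq0 x0) scale0r subr0 nrm0.
rewrite (_ : _ - _ = c%:C *: (1 - (c^-1)%:C *: x)).
  rewrite nrmZ gtr0_norm // ger_pMr // pos_nrm1B //.
    by apply: posZ => //; rewrite invr_ge0 ltW.
  by apply: nrmZV; rewrite ?mulr1.
by rewrite scalerBr scalerA -rmorphM /= mulfV ?gt_eqF // scale1r.
Qed.

Lemma posD x y : pos x -> pos y -> pos (x + y).
Proof.
move=> px py; pose c := nrm x + nrm y + 1.
have x0 := nrm_ge0 x; have y0 := nrm_ge0 y.
apply: (@pos_nrmB _ (2 * c)); first by rewrite /c; lra.
  by rewrite starD !pos_sa.
rewrite (_ : _ - _ = (c%:C%:A - x) + (c%:C%:A - y)); last by nc.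
apply: le_trans (nrmD _ _) _.
have := @nrmB_pos x c ltac:(rewrite /c; lra) px.
have := @nrmB_pos y c ltac:(rewrite /c; lra) py; lra.
Qed.

Lemma pos_sum (I : Type) (r : seq I) (P : pred I) (F : I -> A) :
  (forall i, P i -> pos (F i)) -> pos (\sum_(i <- r | P i) F i).
Proof. by move=> h; elim/big_ind: _ => //; [exact: pos0 | exact: posD]. Qed.

Lemma pos1 : pos 1.
Proof. by exists 1; rewrite star1 mulr1. Qed.

Lemma pos_real c : 0 <= c -> pos c%:C%:A.
Proof. by move=> /posZ; apply; exact: pos1. Qed.

Lemma pos_closed x : (forall e, 0 < e -> pos (x + e%:C%:A)) -> pos x.
Proof.
move=> h; pose c := nrm x + 1; have x0 := nrm_ge0 x.
have sx : star x = x.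
  by have := pos_sa (h 1 ltr01); rewrite starD real_alg_sa => /addIr.
apply: (@pos_nrmB _ c) => //; first by rewrite /c; lra.
apply/ler_addgt0Pr => e e0.
pose d := Num.min (e / 2) 1.
have d0 : 0 < d by rewrite lt_min; lra.
have [d1 d2] : d <= e / 2 /\ d <= 1 by split; rewrite ge_min lexx ?orbT.
have := @nrmB_pos (x + d%:C%:A) c.
have := nrmD x d%:C%:A; rewrite nrm_real_alg gtr0_norm // => hd /(_ ltac:(rewrite /c; lra) (h _ d0)).
have := nrmD (c%:C%:A - (x + d%:C%:A)) d%:C%:A; rewrite nrm_real_alg gtr0_norm //.
rewrite opprD addrA subrK.
by lra.
Qed.

Lemma nrm_sub_pos x : star x = x -> pos ((nrm x)%:C%:A - x).
Proof.
move=> sx; apply: pos_closed => e e0; have x0 := nrm_ge0 x.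
apply: (@pos_nrmB _ (nrm x + e)); first by lra.
  by rewrite !starD starN !real_alg_sa sx.
rewrite (_ : _ - _ = x); first by lra.
by nc.
Qed.

Lemma ge_nrm_sub_pos x c : star x = x -> nrm x <= c -> pos (c%:C%:A - x).
Proof.
move=> sx xc; have c0 : 0 <= c - nrm x by rewrite subr_ge0.
by have := posD (nrm_sub_pos sx) (pos_real c0); congr pos; nc.
Qed.

Lemma ge_nrm_add_pos x c : star x = x -> nrm x <= c -> pos (c%:C%:A + x).
Proof.
by move=> sx xc; rewrite -[x]opprK; apply: ge_nrm_sub_pos; rewrite ?starN ?sx ?nrmN.
Qed.

Lemma sqrt_ex x : pos x -> exists h,
  [/\ pos h, h * h = x & forall z, z * x = x * z -> z * h = h * z].
Proof.
move=> px; pose c := nrm x + 1; have x0 := nrm_ge0 x; have c0 : 0 < c by rewrite /c; lra.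
have [//||h [sh hh h1 hc]] := @sqrt_near1 ((c^-1)%:C *: x).
- by rewrite star_realZ pos_sa.
- apply: pos_nrm1B; first by apply: posZ => //; rewrite invr_ge0 ltW.
  by apply: nrmZV; rewrite // mulr1 /c; lra.
exists ((Num.sqrt c)%:C *: h); split.
- by apply: posZ; [exact: sqrtr_ge0 | exact: pos_near1].
- rewrite -scalerAl -scalerAr scalerA -rmorphM -expr2 sqr_sqrtr ?ltW // hh.
  by rewrite scalerA -rmorphM /= mulfV ?gt_eqF // scale1r.
- by move=> z zx; rewrite -scalerAl -scalerAr hc // -scalerAl -scalerAr zx.
Qed.

(** Chosen by [xget]; commuting with everything that commutes with [x] takes the place of
    uniqueness. *)
Definition sqa x : A := xget 0
  [set h | [/\ pos h, h * h = x & forall z, z * x = x * z -> z * h = h * z]]%classic.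

Lemma sqaP x : pos x -> [/\ pos (sqa x), sqa x * sqa x = x
  & forall z, z * x = x * z -> z * sqa x = sqa x * z].
Proof. by move=> /sqrt_ex; exact: (@xgetPex _ 0 [set h | [/\ _, _ & _]]%classic). Qed.

Lemma sqa_pos x : pos x -> pos (sqa x). Proof. by case/sqaP. Qed.
Lemma sqa_sq x : pos x -> sqa x * sqa x = x. Proof. by case/sqaP. Qed.
Lemma sqa_comm x z : pos x -> z * x = x * z -> z * sqa x = sqa x * z.
Proof. by move=> /sqaP[_ _]; apply. Qed.
Lemma sqa_sa x : pos x -> star (sqa x) = sqa x.
Proof. by move=> /sqa_pos/pos_sa. Qed.

Lemma sqa_comm_self x : pos x -> x * sqa x = sqa x * x.
Proof. by move=> px; apply: sqa_comm. Qed.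

Lemma posM_comm x y : pos x -> pos y -> x * y = y * x -> exists w,
  [/\ star w = w, w * w = x * y & forall z, z * x = x * z -> z * y = y * z -> z * w = w * z].
Proof.
move=> px py xy; pose a := sqa x; pose b := sqa y.
have ay : a * y = y * a by rewrite -(sqa_comm px).
have ab : a * b = b * a by apply: sqa_comm.
exists (a * b); split.
- by rewrite starM !sqa_sa.
- by rewrite mulrA -(mulrA a b a) -ab mulrA sqa_sq // -mulrA sqa_sq.
- move=> z zx zy; rewrite mulrA (sqa_comm px zx) -mulrA (sqa_comm py zy) //.
  by rewrite !mulrA.
Qed.

Lemma posM x y : pos x -> pos y -> x * y = y * x -> pos (x * y).
Proof. by move=> px py xy; have [w [sw <- _]] := posM_comm px py xy; exact: pos_sq. Qed.

(** The product (c - y)(c + y) has a self-adjoint root w commuting with y, so y/c and w/c satisfy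
    the equation of [nrm_sphere]. *)
Lemma nrm_le_pos y c : pos (c%:C%:A - y) -> pos (c%:C%:A + y) -> nrm y <= c.
Proof.
wlog c0 : c / 0 < c => [hw pm pp|pm pp].
  apply/ler_addgt0Pr => e e0.
  (* A negative c would make -1 positive, against |1 - (-1)| = 2 > 1. *)
  have c0 : 0 <= c.
    have := posD pm pp; rewrite addrACA addNr addr0 -scalerDl -rmorphD /= => pc.
    rewrite leNgt; apply/negP => cn.
    have p1 : pos (- 1 : A).
      apply: (@posZV (- (c + c))); first by lra.
      by rewrite scalerN -scaleNr -rmorphN /= opprK.
    have := pos_nrm1B p1; rewrite nrmN nrm1 opprK => /(_ (lexx _)).
    rewrite (_ : 1 + 1 = 2%:C%:A :> A) ?nrm_real_alg ?ger0_norm //; first by lra.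
    by nc.
  have pe := @pos_real e (ltW e0).
  apply: hw; first by lra.
    by have := posD pm pe; congr pos; nc.
  by have := posD pp pe; congr pos; nc.
have sy : star y = y by have := pos_sa pp; rewrite starD real_alg_sa => /addrI.
have comm : (c%:C%:A - y) * (c%:C%:A + y) = (c%:C%:A + y) * (c%:C%:A - y) by nc.
have [w [sw ww wc]] := posM_comm pm pp comm.
have yw : y * w = w * y by apply: wc; nc.
suff : nrm ((c^-1)%:C *: y) <= 1.
  by rewrite nrmZ gtr0_norm ?invr_gt0 // ler_pdivrMl // mulr1.
apply: (@nrm_sphere _ ((c^-1)%:C *: w)); rewrite ?star_realZ ?sy ?sw //.
  by rewrite -!scalerAl -!scalerAr yw.
have cn : c%:C != 0 :> R[i] by rewrite (fmorph_eq0 (real_complex R)) gt_eqF.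
by rewrite -!scalerAl -!scalerAr ww; nc0; rewrite fmorphV; field.
Qed.
End PositiveCone.

(** * Invertibility and the spectral description of positivity *)

Section Units.
Context {R : realType} {A : cstarAlgType R}.
Implicit Types (a b h k x y z : A) (c e t : R).

Let i2 : 'i%C * 'i%C = -1 :> R[i].
Proof. by rewrite -expr2 sqr_i. Qed.

Lemma unitZ (c : R[i]) x : c != 0 -> x \is a GRing.unit -> c *: x \is a GRing.unit.
Proof.
move=> c0 ux; apply/unitrP; exists (c^-1 *: x^-1).
by rewrite -!scalerAl -!scalerAr !scalerA mulVf // mulfV // mulVr // mulrV // scale1r.
Qed.

(** With m = |h|^2 / t, write h + i t = i (t + m) + (h - i m). Then |h - i m|^2 <= |h|^2 + m^2 = m t
    + m^2 < (t + m)^2, and the Neumann series applies. *)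
Lemma unit_sa_imag h t : star h = h -> t != 0 ->
  h + ('i%C * t%:C) *: 1 \is a GRing.unit.
Proof.
move=> sh; wlog t0 : h t sh / 0 < t => [hw tn0|_].
  have [|t0] := ltrP 0 t; first by move=> t0; apply: hw.
  rewrite -unitrN (_ : - _ = - h + ('i%C * (- t)%:C) *: 1); last by nc.
  by apply: hw; rewrite ?starN ?sh ?oppr_eq0 // oppr_gt0 lt_def eq_sym tn0.
pose m := nrm h ^+ 2 / t; have n0 := nrm_ge0 h.
have m0 : 0 <= m by apply: divr_ge0; [exact: sqr_ge0 | exact: ltW].
have mt : m * t = nrm h ^+ 2 by rewrite mulfVK ?gt_eqF.
have tm : 0 < t + m by lra.
have tmn : (t + m)%:C != 0 :> R[i] by rewrite (fmorph_eq0 (real_complex R)) gt_eqF.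
pose w := h - ('i%C * m%:C) *: 1.
have sw : star w = h + ('i%C * m%:C) *: 1.
  by rewrite /w starB sh -scalerA starZi real_alg_sa; nc.
have wlt : nrm w < t + m.
  rewrite -(@ltr_pXn2r _ 2) ?nnegrE ?nrm_ge0 ?(ltW tm) // -nrm_cstar sw.
  rewrite (_ : _ * w = h * h + (m * m)%:C%:A); last first.
    by rewrite /w; nc0; ring: i2.
  apply: le_lt_trans (nrmD _ _) _; rewrite nrm_sa // nrm_real_alg (ger0_norm (mulr_ge0 m0 m0)).
  by nra.
pose z := - ('i%C *: (((t + m)^-1)%:C *: w)) : A.
rewrite (_ : _ + _ = ('i%C * (t + m)%:C) *: (1 + z)).
  apply: unitZ; first by rewrite mulf_neq0 // neq0Ci.
  rewrite -[z]opprK; apply: unit_1B; rewrite nrmN nrmN nrmZi nrmZ gtr0_norm ?invr_gt0 //.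
  by rewrite mulrC ltr_pdivrMr ?mul1r.
rewrite /z scalerDr scalerN !scalerA.
rewrite (_ : 'i%C * (t + m)%:C * ('i%C * _) = -1).
  by rewrite /w; nc.
by rewrite mulrACA i2 -rmorphM /= mulfV ?gt_eqF // mulr1.
Qed.

(** From the factorization h^2 + t = (h + i sqrt t)(h - i sqrt t). *)
Lemma pos_unit x t : 0 < t -> pos x -> x + t%:C%:A \is a GRing.unit.
Proof.
move=> t0 [h [sh ->]]; have s0 : 0 < Num.sqrt t by rewrite sqrtr_gt0.
have st := sqr_sqrtr (ltW t0).
rewrite (_ : _ + _ = (h + ('i%C * (Num.sqrt t)%:C) *: 1) * (h + ('i%C * (- Num.sqrt t)%:C) *: 1)).
  by rewrite unitrMr; apply: unit_sa_imag => //; rewrite ?oppr_eq0 gt_eqF.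
by rewrite -{1}st; nc0; ring: i2.
Qed.

Lemma pos_ge_unit x t : 0 < t -> pos (x - t%:C%:A) -> x \is a GRing.unit.
Proof. by move=> t0 /(pos_unit t0); rewrite subrK. Qed.

Lemma unit_comm_l x y : x * y = y * x -> x * y \is a GRing.unit -> x \is a GRing.unit.
Proof. by move=> xy; rewrite unitrM_comm // => /andP[]. Qed.

(** Jacobson's lemma: the inverse is 1 - b (1 + a b)^-1 a. *)
Lemma unit_1D_swap a b : 1 + a * b \is a GRing.unit -> 1 + b * a \is a GRing.unit.
Proof.
move=> u; pose v := (1 + a * b)^-1.
have v1 : v * (1 + a * b) = 1 by rewrite mulVr.
have v2 : (1 + a * b) * v = 1 by rewrite mulrV.
apply/unitrP; exists (1 - b * v * a); split.
  transitivity (1 + b * a - b * (v * (1 + a * b)) * a); first by nc.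
  by rewrite v1 mulr1 addrK.
transitivity (1 + b * a - b * ((1 + a * b) * v) * a); first by nc.
by rewrite v2 mulr1 addrK.
Qed.

Lemma star_inv x : x \is a GRing.unit -> star x = x -> star x^-1 = x^-1.
Proof.
move=> ux sx; apply: (mulrI ux); rewrite mulrV // -{1}sx -starM mulVr //.
exact: star1.
Qed.

Lemma inv_comm x z : x \is a GRing.unit -> z * x = x * z -> z * x^-1 = x^-1 * z.
Proof.
by move=> ux zx; rewrite -{1}[z](mulKr ux) -zx -!mulrA mulrV // mulr1.
Qed.

(* The infimum of the [t >= 0] with [a + t] positive is [0], since a positive unit
   stays positive when it is decreased a little. *)
Lemma pos_path a : star a = a ->
  (forall t, 0 < t -> a + t%:C%:A \is a GRing.unit) -> pos a.
Proof.
move=> sa ua; pose S := [set t : R | 0 <= t /\ pos (a + t%:C%:A)]%classic.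
have n0 := nrm_ge0 a.
have S0 : S (nrm a) by split=> //; rewrite addrC; apply: ge_nrm_add_pos.
have Sb : lbound S 0 by move=> t [].
have hS : has_inf S by split; [exists (nrm a) | exists 0].
pose m := inf S; have m0 : 0 <= m by apply: lb_le_inf => //; exists (nrm a).
have pm : pos (a + m%:C%:A).
  apply: pos_closed => e e0; have [t [t0 pt] te] := inf_adherent e0 hS.
  have te' : 0 <= m + e - t by rewrite subr_ge0 ltW.
  by have := posD pt (pos_real te'); congr pos; nc.
have [mp|mn] := ltrP 0 m; last first.
  suff m00 : m = 0 by move: pm; rewrite m00 scale0r addr0.
  by apply/eqP; rewrite eq_le mn m0.
exfalso; pose x := a + m%:C%:A; have ux : x \is a GRing.unit := ua m mp.
have sx : star x = x := pos_sa pm.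
have [ph hh hc] := sqaP pm; set h := sqa _ in ph hh hc; rewrite -/x in hh hc.
have sh : star h = h := pos_sa ph.
pose g := x^-1; have gh : h * g = g * h.
  by apply: inv_comm => //; rewrite -hh mulrA.
have g0 := nrm_ge0 g.
pose s := Num.min (m / 2) (nrm g + 1)^-1.
have sp : 0 < s by rewrite lt_min; apply/andP; split; [lra | rewrite invr_gt0; lra].
have [s1 s2] : s <= m / 2 /\ s <= (nrm g + 1)^-1 by split; rewrite ge_min lexx ?orbT.
have p1 : pos (1 - s%:C *: g).
  apply: pos_near1; first by rewrite starB star1 star_realZ star_inv.
  rewrite opprB addrC subrK nrmZ gtr0_norm //.
  have : s * (nrm g + 1) <= 1 by rewrite -ler_pdivlMr ?mul1r //; lra.
  by nra.
have gx : g * x = 1 by rewrite /g mulVr.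
have := posM p1 pm; rewrite -/x mulrBl mul1r -scalerAl gx mulrBr mulr1 -scalerAr mulrV //.
move=> /(_ erefl) ps.
have : S (m - s).
  split; first by lra.
  by move: ps; congr pos; rewrite /x; nc.
by move=> /(ge_inf (proj2 hS)); rewrite -/m; lra.
Qed.

(** From left to right this is [pos_path]. Conversely let w^2 = z: if w is real then z >= 0, and
    otherwise h^2 - z = (h + w)(h - w) is a product of units by [unit_sa_imag]. *)
Lemma positive_elementE a : positive_element A a <-> pos a.
Proof.
split=> [[sa sp]|pa].
  apply: pos_path => // t t0; apply/negPn/negP => nu.
  have /= := sp (- t%:C).
  rewrite /spectrum /= -unitrN opprB scaleNr opprK => /(_ nu).
  by rewrite oppr_ge0 lecR leNgt t0.
split; first exact: pos_sa.
move=> z; rewrite /spectrum /=; case: pa => h [sh ->] nu.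
pose w := sqrtC z; have ww : w * w = z by rewrite -expr2 sqrtCK.
have wE : w = (complex.Re w)%:C + 'i%C * (complex.Im w)%:C.
  by case: (w) => p q; apply/eqP; rewrite eq_complex /=; apply/andP; split; apply/eqP; ring.
have [q0|q0] := eqVneq (complex.Im w) 0.
  rewrite -ww wE q0 mulr0 addr0 -rmorphM /= lecR.
  by rewrite -expr2 sqr_ge0.
exfalso; move/negP: nu; apply.
have sp c : star (h + c%:C%:A) = h + c%:C%:A by rewrite starD sh real_alg_sa.
rewrite (_ : _ - _ = - ((h + (complex.Re w)%:C%:A + ('i%C * (complex.Im w)%:C) *: 1)
  * (h + (- complex.Re w)%:C%:A + ('i%C * (- complex.Im w)%:C) *: 1))).
  by rewrite unitrN unitrMr; apply: unit_sa_imag => //; rewrite oppr_eq0.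
have -> : z = ((complex.Re w)%:C + 'i%C * (complex.Im w)%:C) * ((complex.Re w)%:C + 'i%C * (complex.Im w)%:C).
  by rewrite -wE ww.
by move: (complex.Re w) (complex.Im w) => p q; nc.
Qed.

End Units.

(** * Positive and negative parts, and the order on self-adjoint elements *)

Section OrderProperties.
Context {R : realType} {A : cstarAlgType R}.
Implicit Types (a b h k n p x y z : A) (c e t : R).

Let i2 : 'i%C * 'i%C = -1 :> R[i].
Proof. by rewrite -expr2 sqr_i. Qed.

Lemma pos_anti x : pos x -> pos (- x) -> x = 0.
Proof.
move=> px pn; apply: nrm_eq0; apply/eqP; rewrite eq_le nrm_ge0 andbT.
by apply: nrm_le_pos; rewrite scale0r ?add0r.
Qed.

Lemma pos_add_eq0 x y : pos x -> pos y -> x + y = 0 -> x = 0.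
Proof.
by move=> px py /eqP; rewrite addr_eq0 => /eqP xy; apply: pos_anti; rewrite // xy opprK.
Qed.

(* With [p = |h| + h] and [n = |h| - h], [p n = 0], hence
   [(p + t) (n + t) = t (2 |h| + t)] is invertible. *)
Lemma pos_abs_add h : star h = h -> pos (sqa (h * h) + h).
Proof.
move=> sh; have p2 := pos_sq sh.
have [pa aa ac] := sqaP p2; set a := sqa _ in pa aa ac *.
have ha : h * a = a * h by apply: ac; rewrite mulrA.
apply: pos_path; first by rewrite starD sh pos_sa.
move=> t t0; apply: (@unit_comm_l _ _ _ (a - h + t%:C%:A)); first by ncl (congr1 (fun z => 2%:C *: z) ha).
rewrite (_ : _ * _ = (2 * t)%:C *: (a + (t / 2)%:C%:A)); last first.
  transitivity (a * a - h * h - (a * h - h * a) + (2 * t)%:C *: (a + (t / 2)%:C%:A)).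
    by nc.
  by rewrite aa ha !subrr ?subr0 add0r.
apply: unitZ; last by apply: pos_unit => //; lra.
by rewrite (fmorph_eq0 (real_complex R)) mulf_neq0 // gt_eqF.
Qed.

Definition pospart h : A := (2^-1)%:C *: (sqa (h * h) + h).
Definition negpart h : A := (2^-1)%:C *: (sqa (h * h) - h).

Lemma pospart_pos h : star h = h -> pos (pospart h).
Proof. by move=> sh; apply: posZ; rewrite ?invr_ge0 //; exact: pos_abs_add. Qed.

Lemma negpartN h : negpart h = pospart (- h).
Proof. by rewrite /negpart /pospart mulrNN. Qed.

Lemma negpart_pos h : star h = h -> pos (negpart h).
Proof. by move=> sh; rewrite negpartN; apply: pospart_pos; rewrite starN sh. Qed.

Lemma pospartB h : pospart h - negpart h = h.
Proof. by rewrite /pospart /negpart; nc. Qed.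

Lemma pospart_comm h z : star h = h -> z * h = h * z -> z * pospart h = pospart h * z.
Proof.
move=> sh zh; rewrite /pospart -scalerAr -scalerAl mulrDr mulrDl zh (sqa_comm (pos_sq sh)) //.
by rewrite mulrA zh -mulrA zh mulrA.
Qed.

Lemma negpart_comm h z : star h = h -> z * h = h * z -> z * negpart h = negpart h * z.
Proof.
by move=> sh zh; rewrite negpartN; apply: pospart_comm; rewrite ?starN ?sh // mulrN mulNr zh.
Qed.

Lemma pospartM h : star h = h -> pospart h * negpart h = 0.
Proof.
move=> sh; have [pa aa ac] := sqaP (pos_sq sh).
rewrite /pospart /negpart; set a := sqa _ in pa aa ac *.
have ha : h * a = a * h by apply: ac; rewrite mulrA.
transitivity ((4^-1)%:C *: (a * a - h * h + (h * a - a * h))); first by nc.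
by rewrite aa ha !subrr addr0 scaler0.
Qed.

Lemma negpartM h : star h = h -> negpart h * pospart h = 0.
Proof.
by move=> sh; rewrite (pospart_comm sh) ?pospartM // (negpart_comm sh).
Qed.

Lemma negpart_mul h : star h = h -> h * negpart h = - (negpart h * negpart h).
Proof. by move=> sh; rewrite -{1}(pospartB h) mulrBl pospartM // sub0r. Qed.

Lemma pospart_mul h : star h = h -> h * pospart h = pospart h * pospart h.
Proof. by move=> sh; rewrite -{1}(pospartB h) mulrBl negpartM // subr0. Qed.

Lemma cartesian y : exists h k, [/\ star h = h, star k = k & y = h + 'i%C *: k].
Proof.
exists ((2^-1)%:C *: (y + star y)), ('i%C *: ((2^-1)%:C *: (star y - y))); split.
- by rewrite star_realZ starD starK addrC.
- by rewrite starZi star_realZ starB starK; nc.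
- transitivity (y + ((1 + 'i%C * 'i%C) * (2^-1)%:C) *: (star y - y)); last by nc.
  by rewrite i2 addrN mul0r scale0r addr0.
Qed.

(* For [y = x (x^* x)_-^(1/2)] the element [y^* y = - (x^* x)_-^2] is negative, and
   so is [y y^*] up to the point 0 of the spectrum, while their sum is positive. *)
Lemma pos_star x : pos (star x * x).
Proof.
pose b := star x * x; have sb : star b = b by rewrite starM starK.
pose n := negpart b; have pn : pos n := negpart_pos sb.
suff n0 : n = 0 by rewrite -/b -(pospartB b) -/n n0 subr0; exact: pospart_pos.
pose s := sqa n; have ss : s * s = n := sqa_sq pn.
have sns : star s = s := sqa_sa pn.
have nb : n * b = b * n by rewrite /n (negpart_comm sb).
have bs : b * s = s * b by apply: sqa_comm.
pose y := x * s.
have yy : star y * y = - (n * n).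
  rewrite -(negpart_mul sb) -/n starM sns /y -ss.
  by rewrite [RHS]mulrA bs /b !mulrA.
have [h [k [sh sk yE]]] := cartesian y.
have sy : star y = h - 'i%C *: k by rewrite yE starD starZi sh sk.
(* Here y y^* = 2 h^2 + 2 k^2 - y^* y, and - y^* y = n^2. *)
have pyy : pos (y * star y).
  have := posD (posD (posZ (ler0n R 2) (pos_sq sh)) (posZ (ler0n R 2) (pos_sq sk))) (pos_sq (pos_sa pn)).
  congr pos; rewrite -[n * n]opprK -yy sy yE.
  by nc0; rewrite ?rmorph_nat; ring: i2.
(* [unit_1D_swap] transfers the invertibility of y y^* + t to y^* y + t = t - n^2. *)
have pN : pos (- (n * n)).
  rewrite -yy; apply: pos_path; first by rewrite starM starK.
  move=> t t0; have tn : t%:C != 0 :> R[i] by rewrite (fmorph_eq0 (real_complex R)) gt_eqF.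
  have sc (u v : A) : t%:C *: (1 + ((t^-1)%:C *: u) * v) = u * v + t%:C%:A.
    by nc.
  rewrite -sc; apply: unitZ => //; rewrite -scalerAl scalerAr; apply: unit_1D_swap.
  rewrite -scalerAl scalerAr -[X in X \is a _]scale1r -(mulVf tn) -scalerA.
  by apply: unitZ; rewrite ?invr_eq0 // -scalerAr scalerAl sc; apply: pos_unit.
have n2 : n * n = 0 by apply: pos_anti => //; apply: pos_sq; exact: pos_sa.
by apply: star_eq0; rewrite pos_sa.
Qed.

Lemma pos_starr x : pos (x * star x).
Proof. by rewrite -{1}(starK x); exact: pos_star. Qed.

Lemma pos_conj z x : pos x -> pos (star z * x * z).
Proof.
move=> px; have := pos_star (sqa x * z).
by rewrite starM sqa_sa // -!mulrA (mulrA (sqa x)) sqa_sq.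
Qed.

Lemma pos_conjr z x : pos x -> pos (z * x * star z).
Proof. by move=> px; rewrite -{1}(starK z); exact: pos_conj. Qed.

Lemma pos_conj_eq0 z x : pos x -> star z * x * z = 0 -> x * z = 0.
Proof.
move=> px h; rewrite -(sqa_sq px) -mulrA; suff -> : sqa x * z = 0 by rewrite mulr0.
by apply: star_eq0; rewrite starM sqa_sa // -!mulrA (mulrA (sqa x)) sqa_sq // mulrA.
Qed.

Lemma pos_mono x y : pos x -> pos (y - x) -> nrm x <= nrm y.
Proof.
move=> px pyx; have py := posD px pyx; rewrite addrC subrK in py.
have c := nrm_sub_pos (pos_sa py).
apply: nrm_le_pos; first by have := posD c pyx; congr pos; nc.
by apply: posD => //; apply: pos_real; exact: nrm_ge0.
Qed.

Lemma pos_le_nrm x c : pos x -> pos (c%:C%:A - x) -> nrm x <= c.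
Proof.
move=> px pc; apply: nrm_le_pos => //.
by have := posD pc (posD px px); congr pos; nc.
Qed.

Lemma pos_inv x : x \is a GRing.unit -> pos x -> pos x^-1.
Proof.
move=> ux px; have sx := star_inv ux (pos_sa px).
by have := pos_conj x^-1 px; rewrite sx mulVr // mul1r.
Qed.

Lemma pos_inv_nrm x t : 0 < t -> pos (x - t%:C%:A) -> nrm x^-1 <= t^-1.
Proof.
move=> t0 h; have ux := pos_ge_unit t0 h.
have px : pos x by rewrite -[x](subrK t%:C%:A); apply: posD => //; apply: pos_real; exact: ltW.
have pi := pos_inv ux px.
apply: pos_le_nrm => //; apply: (@posZV _ _ t) => //.
have := posM pi h; rewrite mulrBr mulrBl mulrV // mulVr // -scalerAr -scalerAl mulr1 mul1r.
move=> /(_ erefl); congr pos; rewrite scalerBr scalerA -rmorphM mulfV ?gt_eqF //.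
by rewrite scale1r.
Qed.

(* If [h >= - c] then [h_- <= c], because
   [(t + c - h_-) (t + c + h_+) = (t + c) (t + c + h)]. *)
Lemma negpart_le h c : star h = h -> 0 <= c -> pos (h + c%:C%:A) -> pos (c%:C%:A - negpart h).
Proof.
move=> sh c0 hc; have pn := negpart_pos sh; have pp := pospart_pos sh.
have np : negpart h * pospart h = pospart h * negpart h by rewrite negpartM ?pospartM.
apply: pos_path; first by rewrite starB real_alg_sa pos_sa.
move=> t t0; apply: (@unit_comm_l _ _ _ (pospart h + c%:C%:A + t%:C%:A)); first by ncl (esym np).
rewrite (_ : _ * _ = (t + c)%:C *: (h + c%:C%:A + t%:C%:A)).
  apply: unitZ; last exact: pos_unit.
  by rewrite (fmorph_eq0 (real_complex R)) gt_eqF // ltr_wpDr.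
transitivity ((t + c)%:C *: (pospart h - negpart h + c%:C%:A + t%:C%:A) - negpart h * pospart h).
  by nc.
by rewrite negpartM // subr0 pospartB.
Qed.

Lemma pospart_le h c : star h = h -> 0 <= c -> pos (c%:C%:A - h) -> pos (c%:C%:A - pospart h).
Proof.
move=> sh c0 hc; rewrite -[h]opprK -negpartN; apply: negpart_le => //.
  by rewrite starN sh.
by rewrite addrC.
Qed.

End OrderProperties.

(** * Projections in real rank zero *)

Section Projections.
Context {R : realType} {A : cstarAlgType R}.
Implicit Types (a b e f g h k p q r s u v w x y z : A) (c t : R).

Notation proj := (projection A).

Lemma proj_sa p : proj p -> star p = p. Proof. by case. Qed.
Lemma proj_idem p : proj p -> p * p = p. Proof. by case. Qed.

Lemma proj_pos p : proj p -> pos p.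
Proof. by move=> [sp pp]; rewrite -pp; exact: pos_sq. Qed.

Lemma proj0 : proj 0. Proof. by split; rewrite ?star0 ?mulr0. Qed.
Lemma proj1 : proj 1. Proof. by split; rewrite ?star1 ?mulr1. Qed.

Lemma proj_le_comm p q : proj p -> proj q -> q * p = p -> p * q = p.
Proof. by move=> [sp _] [sq _] h; rewrite -{1}sp -{1}sq -starM h. Qed.

Lemma projB p q : proj p -> proj q -> q * p = p -> proj (q - p).
Proof.
move=> pp pq qp; have pq' := proj_le_comm pp pq qp; split.
  by rewrite starB !proj_sa.
by rewrite mulrBl !mulrBr !proj_idem // qp pq' subrr subr0.
Qed.

Lemma projC p : proj p -> proj (1 - p).
Proof. by move=> pp; apply: projB; rewrite ?mul1r //; exact: proj1. Qed.

Lemma projD p q : proj p -> proj q -> p * q = 0 -> proj (p + q).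
Proof.
move=> pp pq h; have h' : q * p = 0 by rewrite -(proj_sa pp) -(proj_sa pq) -starM h star0.
split; first by rewrite starD !proj_sa.
by rewrite mulrDl !mulrDr !proj_idem // h h' addr0 add0r.
Qed.

Lemma proj_compl_pos p : proj p -> pos (1 - p).
Proof. by move=> /projC/proj_pos. Qed.

Lemma proj_le_pos p q : proj p -> proj q -> q * p = p -> pos (q - p).
Proof. by move=> pp pq h; apply/proj_pos/projB. Qed.

Lemma proj_nrm p : proj p -> nrm p <= 1.
Proof.
move=> pp; apply: pos_le_nrm; first exact: proj_pos.
by rewrite scale1r; exact: proj_compl_pos.
Qed.

Lemma compl_fix p x : (1 - p) * x = 0 -> p * x = x.
Proof. by move=> /eqP; rewrite mulrBl mul1r subr_eq0 => /eqP. Qed.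

Lemma fix_compl p x : p * x = x -> (1 - p) * x = 0.
Proof. by rewrite mulrBl mul1r => ->; rewrite subrr. Qed.

Lemma proj_conj p x : proj p -> pos x -> pos (p * x * p).
Proof. by move=> pp; have := @pos_conj _ _ p x; rewrite proj_sa. Qed.

Lemma sa_fix_comm e x : proj e -> star x = x -> e * x = x -> x * e = x.
Proof. by move=> [se _] sx h; rewrite -{1}sx -{1}se -starM h. Qed.

(** The element z y z^* is squeezed between 0 and c z x z^* = 0. In particular a projection below a
    multiple of [x] lies under every projection that fixes [x]. *)
Lemma dominated_null z x y c : pos y -> pos (c%:C *: x - y) -> z * x = 0 -> z * y = 0.
Proof.
move=> py pxy zx; have : pos (- (z * y * star z)).
  have := pos_conjr z pxy; congr pos.
  by rewrite mulrBr mulrBl -scalerAr -scalerAl zx mul0r scaler0 sub0r.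
move=> /(pos_anti (pos_conjr z py)) h.
have := @pos_conj_eq0 _ _ (star z) y py; rewrite starK h => /(_ erefl) /(congr1 (@star _ _)).
by rewrite starM starK star0 pos_sa.
Qed.

Lemma pos_null_sqrt z x : pos x -> z * x = 0 -> z * sqa x = 0.
Proof.
move=> px zx; rewrite -(starK (z * _)); apply/eqP; rewrite -(inj_eq (can_inj starK)) starK star0.
apply/eqP/star_eq0; rewrite starK starM sqa_sa // -mulrA (mulrA (sqa x)) sqa_sq //.
by rewrite mulrA zx mul0r.
Qed.

Lemma pos_null_sqrtr z x : pos x -> x * z = 0 -> sqa x * z = 0.
Proof.
move=> px xz; apply: star_eq0; rewrite starM sqa_sa // -mulrA (mulrA (sqa x)) sqa_sq //.
by rewrite xz mulr0.
Qed.

Lemma sqa_fix e x : pos x -> e * x = x -> e * sqa x = sqa x.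
Proof.
by move=> px ex; apply: compl_fix; apply: pos_null_sqrt => //; exact: fix_compl.
Qed.

Lemma sqa_fixr e x : pos x -> x * e = x -> sqa x * e = sqa x.
Proof.
move=> px ex; apply/eqP; rewrite -subr_eq0 -{2}(mulr1 (sqa x)) -mulrBr; apply/eqP.
by apply: pos_null_sqrtr => //; rewrite mulrBr mulr1 ex subrr.
Qed.

Lemma nrm_sqa x : pos x -> nrm (sqa x) ^+ 2 = nrm x.
Proof. by move=> px; rewrite -nrm_sa ?sqa_sq ?sqa_sa. Qed.

Lemma nrm_conj_sqa p x : pos x -> proj p -> nrm (sqa x * p) ^+ 2 = nrm (p * x * p).
Proof.
move=> px pp; rewrite -nrm_cstar starM sqa_sa // proj_sa // -mulrA (mulrA (sqa x)) sqa_sq //.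
by rewrite mulrA.
Qed.

(* [d] inverts [p x p] in the corner of [p], so [r] is the range projection of
   [x^(1/2) p x^(1/2)]. *)
Lemma range_proj p x c : proj p -> pos x -> 0 < c <= 1 -> pos (p * x * p - c%:C *: p) ->
  exists d, let r := sqa x * p * d * p * sqa x in
  [/\ proj r, r * sqa x * p = sqa x * p, pos d /\ nrm d <= c^-1,
      p * x * p * d = p /\ d * (p * x * p) = p
    & (p * x * p + (1 - p)) * d = 1].
Proof.
move=> pp px /andP[c0 c1] pge; pose b := p * x * p + (1 - p).
have pb : pos (b - c%:C%:A).
  have h1 : pos ((1 - c)%:C *: (1 - p)) by apply: posZ; [lra | exact: proj_compl_pos].
  by have := posD pge h1; congr pos; rewrite /b; nc.
have ub : b \is a GRing.unit := pos_ge_unit c0 pb.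
have pob : pos b by rewrite /b; apply: posD; [exact: proj_conj | exact: proj_compl_pos].
pose d := b^-1; exists d; pose s := sqa x.
have pi := proj_idem pp.
have pbE : p * b = p * x * p by rewrite /b mulrDr mulrBr mulr1 pi subrr addr0 !mulrA pi.
have bpE : b * p = p * x * p by rewrite /b mulrDl mulrBl mul1r pi subrr addr0 -!mulrA pi.
have bd : b * d = 1 by rewrite /d mulrV.
have pdE : p * x * p * d = p by rewrite -pbE -mulrA bd mulr1.
have ss : s * s = x := sqa_sq px.
have dsa : star d = d := pos_sa (pos_inv ub pob).
have key : p * s * s * p * d = p by rewrite -(mulrA p) ss.
move=> /=; split=> //; last 2 first.
- by split; [exact: pos_inv | exact: pos_inv_nrm].
- by split=> //; rewrite -bpE mulrA /d mulVr // mul1r.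
  split; first by rewrite !starM dsa sqa_sa // proj_sa // !mulrA.
  transitivity (s * p * d * (p * s * s * p * d) * p * s); first by rewrite /s !mulrA.
  by rewrite key -!mulrA (mulrA p p) pi.
transitivity (s * p * d * (p * s * s * p)); first by rewrite /s !mulrA.
have key2 : d * (p * s * s * p) = p.
  by rewrite -(mulrA p) ss -bpE mulrA /d mulVr // mul1r.
by rewrite -mulrA key2 -mulrA pi.
Qed.

Definition rr0 := forall x c, star x = x -> 0 < c ->
  exists y, [/\ star y = y, y \is a GRing.unit & nrm (x - y) < c].

Lemma real_rank_zeroE : real_rank_zero A -> rr0.
Proof.
move=> h x c sx c0; have c0' : 0 < c%:C :> R[i] by rewrite ltcR.
have [y [[sy uy] xy]] := h x sx _ (nbhsx_ballx x c%:C c0').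
exists y; split=> //; move: xy; rewrite -ball_normE /= nrmE ltcR //.
Qed.

(** Since y is invertible, v = y |y|^-1 is a self-adjoint unitary and p = (1 + v)/2 is a projection;
    y p and y p - y are the positive and negative parts of y. *)
Lemma spectral_proj y : star y = y -> y \is a GRing.unit -> exists p,
  [/\ proj p, p * y = y * p, pos (y * p) & pos (y * p - y)].
Proof.
move=> sy uy; have py := pos_sq sy; have [pa aa ac] := sqaP py.
set a := sqa _ in pa aa ac.
have ua : a \is a GRing.unit by apply: (@unit_comm_l _ _ _ a) => //; rewrite aa unitrMr.
have ya : y * a = a * y by apply: ac; rewrite mulrA.
have yi : y * a^-1 = a^-1 * y by apply: inv_comm.
pose v := y * a^-1.
have vv : v * v = 1.
  by rewrite /v {1}yi -mulrA (mulrA y) -aa mulrA mulKr // mulrV.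
have yv : y * v = a by rewrite /v mulrA -aa mulrK.
have sv : star v = v by rewrite /v starM (star_inv ua (pos_sa pa)) sy yi.
exists ((2^-1)%:C *: (1 + v)); split.
- split; first by rewrite star_realZ starD star1 sv.
  by ncl (congr1 (fun z => (4^-1)%:C *: z) vv).
- have vy : v * y = y * v by rewrite /v -mulrA -yi.
  by ncl (congr1 (fun z => (2^-1)%:C *: z) vy).
- have := pospart_pos sy; congr pos; rewrite /pospart -/a.
  by rewrite -scalerAr mulrDr mulr1 yv addrC.
- have := negpart_pos sy; congr pos; rewrite /negpart -/a.
  by rewrite -scalerAr mulrDr mulr1 yv; nc.
Qed.

(** Let p be the positive spectral projection of an invertible y near x - d. Then x is at least d/2
    on p and at most 3d/2 off p. As p need not lie below a multiple of x, it is replaced by the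
    range projection of x^(1/2) p x^(1/2). *)
Lemma hereditary_proj x c : rr0 -> pos x -> 0 < c -> exists r t,
  [/\ proj r, 0 <= t, pos (t%:C *: x - r) & nrm ((1 - r) * x * (1 - r)) <= c].
Proof.
move=> rr px c0; pose d := Num.min (c / 2) 1.
have d0 : 0 < d by rewrite lt_min; lra.
have [d1 d2] : d <= c / 2 /\ d <= 1 by split; rewrite ge_min lexx ?orbT.
have sx := pos_sa px.
have [|y [sy uy xy]] := rr (x - d%:C%:A) (d / 2) _ ltac:(lra).
  by rewrite starB real_alg_sa sx.
have [p [pp py pyp pyn]] := spectral_proj sy uy.
have serr : star (x - d%:C%:A - y) = x - d%:C%:A - y by rewrite !starB real_alg_sa sx sy.
have e1 := ge_nrm_sub_pos serr (ltW xy); have e2 := ge_nrm_add_pos serr (ltW xy).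
have pi := proj_idem pp.
have pge : pos (p * x * p - (d / 2)%:C *: p).
  have := posD pyp (proj_conj pp e2); congr pos.
  have yp : y * p = p * y * p by rewrite py -mulrA pi.
  rewrite {1}yp; ncl (congr1 (fun z => (- (d/2)%:C) *: z) pi).
have [d' [pr rs [pd nd] _ _]] := range_proj pp px (c := d / 2) ltac:(lra) pge.
set r := _ * sqa x in pr rs; exists r, (nrm d'); split=> //; first exact: nrm_ge0.
  have ss := sqa_sa px.
  have : pos (sqa x * ((nrm d')%:C%:A - p * d' * p) * sqa x).
    rewrite -{1}ss; apply: pos_conj; apply: ge_nrm_sub_pos.
      by rewrite !starM (pos_sa pd) proj_sa // mulrA.
    apply: le_trans (nrmM _ _) _; have := proj_nrm pp; have := nrmM p d'.
    have := nrm_ge0 p; have := nrm_ge0 d'; have := nrm_ge0 (p * d'); nra.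
  congr pos; rewrite mulrBr mulrBl -scalerAr mulr1 -scalerAl sqa_sq //.
  by rewrite /r !mulrA.
have sx1 : (1 - r) * sqa x = (1 - r) * (sqa x * (1 - p)).
  by ncl (esym rs).
have rp := projC pr.
have -> : nrm ((1 - r) * x * (1 - r)) = nrm ((1 - r) * sqa x) ^+ 2.
  by rewrite -nrm_cstarr starM sqa_sa // proj_sa // -!mulrA (mulrA (sqa x)) sqa_sq.
have le1 : nrm ((1 - r) * sqa x) <= nrm (sqa x * (1 - p)).
  rewrite sx1; apply: le_trans (nrmM _ _) _.
  by have := proj_nrm rp; have := nrm_ge0 (sqa x * (1 - p)); nra.
have : nrm (sqa x * (1 - p)) ^+ 2 <= c.
  have pp' := projC pp; rewrite nrm_conj_sqa //; apply: pos_le_nrm; first exact: proj_conj.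
  have yn : y * p - y = - ((1 - p) * y * (1 - p)).
    by ncl2 (congr1 (fun z => - (p * z)) py) (congr1 (fun z => z * y) pi).
  have e0 : 0 <= c - d - d / 2 by lra.
  have := posD (posD pyn (proj_conj pp' e1)) (posD (posZ e0 (proj_pos pp')) (posZ (ltW c0) (proj_pos pp))).
  congr pos; rewrite yn.
  by ncl (congr1 (fun z => (3 * d / 2)%:C *: z) pi).
by have := nrm_ge0 ((1 - r) * sqa x); nra.
Qed.

Lemma projI_fix r x : proj r -> pos x -> pos (1 - x) -> x * r = r -> pos (x - r).
Proof.
move=> pr px px1 xr; have rx : r * x = r.
  by have := congr1 (@star _ _) xr; rewrite starM proj_sa // pos_sa.
have := proj_conj (projC pr) px; congr pos.
by rewrite mulrBl mul1r rx mulrBr mulr1 mulrBl xr proj_idem // subrr subr0.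
Qed.

(** Brown's interpolation. On the complement q of a projection r0 below a multiple of g, the element
    1 - g is at least 1/2. Let s be the range projection of (1 - g)^(1/2) q (1 - g)^(1/2): it kills
    k because 1 - g does, and 1 - u lies under it because 1 - u kills g and r0. So 1 - s
    interpolates. *)
Lemma proj_interp g k u : rr0 -> pos g -> pos (1 - g) -> g * k = k -> u * g = g ->
  exists r, [/\ proj r, r * k = k & u * r = r].
Proof.
move=> rr pg pw gk ug.
have i2 : 0 < (2^-1 : R) by rewrite invr_gt0.
have [r0 [t [pr0 t0 r0g r0n]]] := hereditary_proj rr pg i2.
have pq := projC pr0; set q := 1 - r0 in pq r0n.
have [w wE] : exists w, w = 1 - g by exists (1 - g).
rewrite -wE in pw.
have qi := proj_idem pq.
have pge : pos (q * w * q - (2^-1)%:C *: q).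
  have sg : star (q * g * q) = q * g * q := pos_sa (proj_conj pq pg).
  have := proj_conj pq (ge_nrm_sub_pos sg r0n); congr pos; rewrite wE.
  have qgq : q * (q * g * q) * q = q * g * q.
    by rewrite !mulrA qi -mulrA qi.
  ncl2 (congr1 (fun z => (- 2^-1)%:C *: z) qi) (esym qgq).
have [d [pr rs _ _ cd]] := range_proj pq pw (c := 2^-1) ltac:(lra) pge.
set s := _ * sqa w in pr rs; exists (1 - s); split; first exact: projC.
  rewrite mulrBl mul1r /s -(mulrA _ (sqa w) k) (_ : sqa w * k = 0) ?mulr0 ?subr0 //.
  by apply: pos_null_sqrtr; rewrite // wE mulrBl mul1r gk subrr.
pose v := 1 - u; have vg : v * g = 0 by rewrite mulrBl mul1r ug subrr.
have vr : v * r0 = 0 := dominated_null (proj_pos pr0) r0g vg.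
have vq : v * q = v by rewrite mulrBr mulr1 vr subr0.
have vw : v * w = v by rewrite wE mulrBr mulr1 vg subr0.
(* With h = (1 - g)^(1/2), v (1 - h)(1 + h) = v g = 0 and 1 + h is invertible. *)
have vh : v * sqa w = v.
  have uh : 1 + sqa w \is a GRing.unit.
    by rewrite addrC; have := pos_unit ltr01 (sqa_pos pw); rewrite scale1r.
  apply/eqP; rewrite eq_sym -subr_eq0 -{1}(mulr1 v) -mulrBr; apply/eqP/(mulIr uh).
  rewrite mul0r -mulrA (_ : _ * (1 + _) = g) //.
  by ncl2 (esym (sqa_sq pw)) (esym wE).
have vd : v * d = v.
  have h : v * (q * w * q + (1 - q)) = v.
    by rewrite mulrDr !mulrA vq vw vq mulrBr mulr1 vq subrr addr0.
  by rewrite -{1}h -mulrA cd mulr1.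
have vs : v * s = v by rewrite /s !mulrA vh vq vd vq vh.
by apply: compl_fix; rewrite mulrBr mulr1 vs subrr.
Qed.

End Projections.

(** * Truncations, approximation by projections, and spectral levels *)

Section Truncation.
Context {R : realType} {A : cstarAlgType R}.
Implicit Types (a b e f g h p q r s u v w x y z : A) (c t : R).
Notation proj := (projection A).

(** In functional calculus [exc] is max(x - 1, 0) and [trunc] is min(x, 1). *)
Definition exc x : A := pospart (x - 1).
Definition trunc x : A := x - exc x.

Let sa1 x : pos x -> star (x - 1) = x - 1.
Proof. by move=> px; rewrite starB star1 pos_sa. Qed.

Lemma truncE x : trunc x = 1 - negpart (x - 1).
Proof. by rewrite /trunc /exc; have := pospartB (x - 1) => h; ncl (esym h). Qed.

Lemma exc_pos x : pos x -> pos (exc x).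
Proof. by move=> px; apply/pospart_pos/sa1. Qed.

Lemma trunc_pos x : pos x -> pos (trunc x).
Proof.
move=> px; have h := @negpart_le _ _ (x - 1) 1 (sa1 px) ler01.
by rewrite truncE; move: h; rewrite scale1r subrK; apply.
Qed.

Lemma trunc_le1 x : pos x -> pos (1 - trunc x).
Proof. by move=> px; rewrite truncE opprB addrC subrK; apply/negpart_pos/sa1. Qed.

Lemma trunc_exc x : pos x -> trunc x * exc x = exc x.
Proof. by move=> px; rewrite truncE mulrBl mul1r negpartM ?subr0 //; exact: sa1. Qed.

Lemma exc_le x c : 0 <= c -> pos x -> pos ((c + 1)%:C%:A - x) -> pos (c%:C%:A - exc x).
Proof.
move=> c0 px h; apply: pospart_le; rewrite ?sa1 //.
by move: h; congr pos; nc.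
Qed.

(** For e = [exc x] one has x e = e (e + 1), hence z e (e + 1) = 0 with e + 1 invertible. *)
Lemma exc_null z x : pos x -> z * x = 0 -> z * exc x = 0.
Proof.
move=> px zx; have h := pospart_mul (sa1 px).
have ue : exc x + 1 \is a GRing.unit.
  by have := pos_unit ltr01 (exc_pos px); rewrite scale1r.
apply: (mulIr ue); rewrite mul0r -mulrA.
rewrite (_ : exc x * (exc x + 1) = x * exc x); first by rewrite mulrA zx mul0r.
by rewrite mulrDr -h /exc; nc.
Qed.

Lemma trunc_null z x : pos x -> z * x = 0 -> z * trunc x = 0.
Proof. by move=> px zx; rewrite mulrBr exc_null // zx subr0. Qed.

Lemma exc_comm z x : pos x -> z * x = x * z -> z * exc x = exc x * z.
Proof.
by move=> px zx; apply: pospart_comm; rewrite ?sa1 // mulrBr mulrBl mulr1 mul1r zx.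
Qed.

Lemma trunc_comm z x : pos x -> z * x = x * z -> z * trunc x = trunc x * z.
Proof. by move=> px zx; rewrite mulrBr mulrBl exc_comm // zx. Qed.

Lemma trunc_le x : pos x -> pos (x - trunc x).
Proof. by move=> px; rewrite opprB addrC subrK; exact: exc_pos. Qed.

Lemma pos_fix_le r x : proj r -> pos x -> pos (1 - x) -> r * x = x -> pos (r - x).
Proof.
move=> pr px px1 rx; have xr := sa_fix_comm pr (pos_sa px) rx.
have := proj_conj pr px1; congr pos.
by rewrite mulrBr mulr1 rx mulrBl xr proj_idem.
Qed.

(* [x] is the mean of the truncations [m j] at [1] of [(n x - j)_+], and [chi j] lies
   between [m j.+2] and [m j]. *)
Lemma proj_approx (n : nat) x : rr0 (A := A) -> (0 < n)%N -> pos x -> pos (1 - x) ->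
  exists chi : nat -> A,
  [/\ forall j, proj (chi j), forall e, e * x = x -> forall j, e * chi j = chi j,
      pos (x - (n%:R^-1)%:C *: \sum_(j < n) chi j)
    & pos ((2 / n%:R)%:C%:A - (x - (n%:R^-1)%:C *: \sum_(j < n) chi j))].
Proof.
move=> rr n0 px px1.
(* This is (n x - j)_+, which vanishes from j = n on; the truncations of the [z j] telescope. *)
pose z j := iter j exc (n%:R%:C *: x).
have zS j : z j.+1 = exc (z j) by [].
have pz j : pos (z j).
  by elim: j => [|j ih]; [apply: posZ; rewrite ?ler0n | rewrite zS; exact: exc_pos].
have zle j : (j <= n)%N -> pos ((n%:R - j%:R)%:C%:A - z j).
  elim: j => [|j ih] jn.
    by rewrite subr0; have := posZ (ler0n R n) px1; congr pos; rewrite scalerBr.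
  rewrite zS; apply: exc_le => //; first by rewrite subr_ge0 ler_nat.
  have -> : n%:R - j.+1%:R + 1 = n%:R - j%:R :> R by rewrite -natr1; ring.
  exact: ih (ltnW jn).
have zn0 j : z (n + j)%N = 0.
  elim: j => [|j ih].
    rewrite addn0; have := zle n (leqnn n); rewrite subrr scale0r sub0r.
    by move=> /(pos_anti (pz n)).
  by rewrite addnS zS -[exc _]mul1r; apply: exc_null => //; rewrite ih mulr0.
pose m j := trunc (z j).
have pm j : pos (m j) := trunc_pos (pz j).
have pm1 j : pos (1 - m j) := trunc_le1 (pz j).
have mm j : m j * m j.+1 = m j.+1.
  by apply/compl_fix/trunc_null => //; rewrite zS; apply: fix_compl; rewrite trunc_exc.
have hint j : exists r, [/\ proj r, r * m j.+2 = m j.+2 & m j * r = r].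
  by apply: (@proj_interp _ _ (m j.+1) (m j.+2)).
have [chi hchi] := choice hint; exists chi.
have tel k N : \sum_(j < N) m (j + k)%N = z k - z (N + k)%N.
  elim: N => [|N ih]; first by rewrite big_ord0 subrr.
  by rewrite big_ord_recr /= ih /m /trunc -zS ?addSn; nc.
have sm : \sum_(j < n) m j = n%:R%:C *: x.
  transitivity (\sum_(j < n) m (j + 0)%N); first by apply: eq_bigr => j _; rewrite addn0.
  by rewrite tel zn0 subr0.
have sm2 : \sum_(j < n) m j.+2 = n%:R%:C *: x - m 0%N - m 1%N.
  transitivity (\sum_(j < n) m (j + 2)%N); first by apply: eq_bigr => j _; rewrite addn2.
  by rewrite tel zn0 subr0 /m /trunc -!zS -[n%:R%:C *: x]/(z 0%N); nc.
split.
- by move=> j; case: (hchi j).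
- move=> e ex j; have [_ _ <-] := hchi j; rewrite mulrA; congr (_ * _).
  have ez i : (1 - e) * z i = 0.
    elim: i => [|i ih]; last by rewrite zS exc_null.
    by rewrite /z /= -scalerAr mulrBl mul1r ex subrr scaler0.
  exact/compl_fix/trunc_null.
- have : pos (\sum_(j < n) m j - \sum_(j < n) chi j).
    rewrite -sumrB; apply: pos_sum => j _; have [pr _ mr] := hchi j.
    exact: projI_fix.
  have ni : 0 <= n%:R^-1 :> R by rewrite invr_ge0 ler0n.
  move=> /(posZ ni); rewrite sm scalerBr scalerA -rmorphM /= mulVf ?scale1r //.
  by rewrite pnatr_eq0 -lt0n.
(* The shift by two loses only [m 0] and [m 1], each at most 1; this is the origin of 2/n. *)
have : pos (\sum_(j < n) chi j - \sum_(j < n) m j.+2).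
  rewrite -sumrB; apply: pos_sum => j _; have [pr rm _] := hchi j.
  exact: pos_fix_le.
have ni : 0 <= n%:R^-1 :> R by rewrite invr_ge0 ler0n.
rewrite sm2 => /posD/(_ (pm1 0%N))/posD/(_ (pm1 1%N))/(posZ ni); congr pos.
have nn : n%:R != 0 :> R by rewrite pnatr_eq0 -lt0n.
move: (\sum_(j < n) chi j) (m _) (m _) (n%:R : R) nn => X y y' d d0.
have d0' : d%:C != 0 :> R[i] by rewrite (fmorph_eq0 (real_complex R)).
nc.
Qed.

Lemma bicomm_comm a x y : (forall z, z * a = a * z -> z * x = x * z) ->
  (forall z, z * a = a * z -> z * y = y * z) -> x * y = y * x.
Proof. by move=> hx hy; apply: hy; rewrite -hx. Qed.

Section Levels.
Variables (a : A) (pa : pos a).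
(** In functional calculus [cut k] is 0 where a <= 2^-k and 1 where a >= 2 * 2^-k. *)
Let level k := exc ((2 ^+ k)%:C *: a).
Let cut k := trunc (level k).

Let plev0 k : pos ((2 ^+ k)%:C *: a).
Proof. by apply: posZ; rewrite // exprn_ge0. Qed.
Let plev k : pos (level k). Proof. exact: exc_pos. Qed.
Let pcut k : pos (cut k). Proof. exact: trunc_pos. Qed.
Let pcut1 k : pos (1 - cut k). Proof. exact: trunc_le1. Qed.

Let comm0 k z : z * a = a * z -> z * ((2 ^+ k)%:C *: a) = (2 ^+ k)%:C *: a * z.
Proof. by move=> za; rewrite -scalerAr -scalerAl za. Qed.
Let commlev k z : z * a = a * z -> z * level k = level k * z.
Proof. by move=> za; apply: exc_comm => //; exact: comm0. Qed.
Let commcut k z : z * a = a * z -> z * cut k = cut k * z.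
Proof. by move=> za; apply: trunc_comm => //; exact: commlev. Qed.

(* Where [2 ^ k a > 1] one has [2 ^ (k + 1) a - 1 > 1]. *)
Let cut_level k : cut k.+1 * level k = level k.
Proof.
pose b := (2 ^+ k)%:C *: a; pose p := level k; pose c := level k.+1.
pose q := negpart ((2 ^+ k.+1)%:C *: a - 1); pose n := negpart (c - 1).
have sb : star (b - 1) = b - 1 by rewrite starB star1 (pos_sa (plev0 k)).
have b2 : (2 ^+ k.+1)%:C *: a = 2%:C *: b by rewrite /b scalerA -rmorphM /= exprS.
have s2 : star ((2 ^+ k.+1)%:C *: a - 1) = (2 ^+ k.+1)%:C *: a - 1.
  by rewrite starB star1 (pos_sa (plev0 k.+1)).
have sc : star (c - 1) = c - 1 by rewrite starB star1 (pos_sa (plev k.+1)).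
have pp : pos p := plev k; have pq : pos q := negpart_pos s2; have pn : pos n := negpart_pos sc.
have cp := @commlev k.
have cq z : z * a = a * z -> z * q = q * z.
  by move=> za; apply: negpart_comm; rewrite // mulrBr mulrBl mulr1 mul1r comm0.
have cn z : z * a = a * z -> z * n = n * z.
  by move=> za; apply: negpart_comm; rewrite // mulrBr mulrBl mulr1 mul1r commlev.
have ppq := bicomm_comm cp cq; have pnp := bicomm_comm cp cn.
have pb : b * p = p * p + p.
  by have := pospart_mul sb; rewrite -/(exc b) -/(level k) -/p => h; ncl h.
have bp : p * b = p * p + p.
  by rewrite -pb; apply: esym; apply: cp; rewrite /b -scalerAr -scalerAl.
have qb := negpart_mul s2; rewrite -/q b2 in qb.
(* Multiplying (2 b - 1) q = - q^2 by p gives 2 p^2 q + p q + p q^2 = 0, a sum of commuting positive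
   elements. The argument for p^2 n is the same. *)
have pq0 : p * q = 0.
  have p1 := posM (posM pp pq ppq) pq; have p2 := posM pp (posM pp pq ppq).
  have c1 : p * q * q = q * (p * q) by rewrite mulrA -ppq.
  have c2 : p * (p * q) = p * q * p by rewrite -mulrA -ppq.
  apply: (pos_add_eq0 (posM pp pq ppq) (posD (p1 c1) (posZ (ler0n _ 2) (p2 c2)))).
  ncl2 (congr1 (fun z => p * z) qb) (congr1 (fun z => - (2%:C *: (z * q))) bp).
have pc : p * c = 2%:C *: (p * p) + p.
  have := pospartB ((2 ^+ k.+1)%:C *: a - 1); rewrite -/(exc _) -/(level k.+1) -/c -/q b2 => h.
  ncl3 (congr1 (fun z => p * z) h) pq0 (congr1 (fun z => 2%:C *: z) bp).
have nc' := negpart_mul sc; rewrite -/n in nc'.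
have pnc : p * n * p = p * p * n by rewrite -mulrA -pnp mulrA.
have p2n : p * p * n = 0.
  have c1 : p * n * n = n * (p * n) by rewrite mulrA -pnp.
  have c2 : p * (p * n) = p * n * p by rewrite -mulrA -pnp.
  have p1 := posM pp (posM pp pn pnp) c2.
  have p3 := posM (posM pp pn pnp) pn c1.
  rewrite -mulrA; apply: (pos_add_eq0 p1 (posD p1 p3)).
  ncl2 (congr1 (fun z => p * z) nc') (congr1 (fun z => - (z * n)) pc).
have pn0 : p * n = 0.
  apply: star_eq0; rewrite starM !pos_sa // -pnp mulrA pnc p2n //.
  by rewrite mul0r.
rewrite /cut truncE -/c -/n -/p mulrBl mul1r -pnp pn0 subr0 //.
Qed.

Let cut_cut k : cut k.+1 * cut k = cut k.
Proof.
by apply/compl_fix/trunc_null; [exact: plev | exact/fix_compl/cut_level].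
Qed.

Let cut_le k : pos ((2 ^+ k)%:C *: a - cut k).
Proof.
have := posD (trunc_le (plev k)) (trunc_pos (plev0 k)); congr pos.
by rewrite {2}/trunc -/(level k) /cut; nc.
Qed.

(** The projection [r k] is interpolated between [level k] and [cut k.+2]. It need not commute with
    [a], but the cuts do; [cut k.+2] and [cut k.+3] are placed between [r k] and [r k.+3], whence
    the step of 3. *)
Lemma level_proj : rr0 (A := A) -> exists r : nat -> A,
  [/\ forall k, proj (r k), forall k, r k.+3 * r k = r k,
      forall k, nrm ((1 - r k) * a * (1 - r k)) <= (2 ^+ k)^-1,
      forall k, (1 - r k.+3) * sqa a * r k = 0
    & forall k, pos (sqa a * r k.+3 * sqa a - ((2 ^+ k.+2)^-1)%:C *: r k) /\
       pos (r k * a * r k - ((2 ^+ k.+2)^-1)%:C *: r k)].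
Proof.
move=> rr.
have hint k : exists r, [/\ proj r, r * level k = level k & cut k.+2 * r = r].
  by apply: (@proj_interp _ _ (cut k.+1)).
have [r hr] := choice hint.
have pr k : proj (r k) by case: (hr k).
have rl k : (1 - r k) * level k = 0 by apply: fix_compl; case: (hr k).
have cr k : cut k.+2 * r k = r k by case: (hr k).
have rc k : (1 - r k) * cut k = 0 by apply: trunc_null.
have rc3 k : (1 - r k.+3) * cut k.+2 = 0 by rewrite -cut_cut mulrA rc mul0r.
have rr3 k : r k.+3 * r k = r k.
  by apply: compl_fix; rewrite -(cr k) mulrA rc3 mul0r.
have ss := sqa_sa pa; have s2 := sqa_sq pa.
have sc k : sqa a * cut k = cut k * sqa a.
  by apply: commcut; rewrite sqa_comm_self.
have e2 k : (2 : R) ^+ k != 0 by rewrite expf_neq0 // pnatr_eq0.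
pose c k : R := (2 ^+ k)^-1; have c0 k : 0 <= c k by rewrite invr_ge0 exprn_ge0.
have cle k : pos (a - (c k)%:C *: cut k).
  have := posZ (c0 k) (cut_le k); congr pos.
  by rewrite scalerBr scalerA -rmorphM /= mulVf ?scale1r.
exists r; split=> // k.
- pose t := trunc ((2 ^+ k)%:C *: a); have pt : pos t := trunc_pos (plev0 k).
  have prk := projC (pr k).
  (* As 1 - [r k] kills (2^k a - 1)_+, only the truncation of 2^k a survives, which has norm at most
     1. *)
  have aE : (1 - r k) * a = (c k)%:C *: ((1 - r k) * t).
    apply: (@scalerI _ _ (2 ^+ k)%:C).
      by rewrite (fmorph_eq0 (real_complex R)).
    rewrite scalerA -rmorphM /= mulfV // scale1r scalerAr.
    have := rl k; rewrite /level => rl'.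
    by rewrite /t /trunc [RHS]mulrBr rl' subr0.
  have tn : nrm t <= 1 by apply: pos_le_nrm => //; rewrite scale1r; exact: trunc_le1.
  rewrite aE -scalerAl nrmZ ger0_norm // -[X in _ <= X]mulr1 ler_wpM2l //.
  apply: le_trans (nrmM _ _) _; have := nrmM (1 - r k) t.
  have := proj_nrm prk; have := nrm_ge0 (1 - r k); have := nrm_ge0 t.
  by have := nrm_ge0 ((1 - r k) * t); nra.
- by rewrite -[X in _ * X = _](cr k) mulrA -(mulrA _ (sqa a)) sc mulrA rc3 !mul0r.
- have c32 : cut k.+3 * cut k.+2 = cut k.+2 := cut_cut _.
  have bc j : cut j * cut k.+3 = cut k.+3 * cut j by apply: bicomm_comm (@commcut j) (@commcut _).
  have ac : a * cut k.+3 = cut k.+3 * a by apply: commcut.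
  have rc3' : r k.+3 * cut k.+3 = cut k.+3.
    exact: compl_fix.
  (* The chain is a^(1/2) r_(k+3) a^(1/2) >= a cut_(k+3) >= c cut_(k+2) cut_(k+3) = c cut_(k+2) >= c
     r_k, where c = 2^-(k+2). *)
  have p1 := pos_conj (sqa a) (pos_fix_le (pr k.+3) (pcut _) (pcut1 _) rc3').
  have p2 : pos ((a - (c k.+2)%:C *: cut k.+2) * cut k.+3).
    by apply: posM => //; ncl2 ac (congr1 (fun z => (- c k.+2)%:C *: z) (bc k.+2)).
  have p3 := posZ (c0 k.+2) (projI_fix (pr k) (pcut _) (pcut1 _) (cr k)).
  split.
    have := posD (posD p1 p2) p3; congr pos; rewrite ss -/(c k.+2).
    have e1 : sqa a * cut k.+3 * sqa a = a * cut k.+3.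
      by rewrite -mulrA -sc mulrA s2.
    ncl3 (esym e1) (congr1 (fun z => (- c k.+2)%:C *: z) (bc k.+2)) (congr1 (fun z => (- c k.+2)%:C *: z) c32).
  have := proj_conj (pr k) (cle k.+2); congr pos.
  rewrite mulrBr mulrBl -scalerAr -scalerAl -(mulrA (r k) (cut _)) cr proj_idem //.
Qed.
End Levels.

End Truncation.

(** * Positive combinations of projections *)

Section PositiveCombinations.
Context {R : realType} {A : cstarAlgType R}.
Implicit Types (a b d e f p q r u v w x y z C D Y : A) (c t : R).
Notation proj := (projection A).

Local Notation pcp := (@positive_combination_of_projections R A).

Lemma pcp0 : pcp 0.
Proof. by exists 0%N, (fun=> 1), (fun=> 0); split; rewrite ?big_ord0 // => -[]. Qed.

Lemma pcpD a b : pcp a -> pcp b -> pcp (a + b).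
Proof.
move=> [m [c [p [c0 pp ->]]]] [n [d [q [d0 pq ->]]]].
exists (m + n)%N, (fun i => match fintype.split i with inl j => c j | inr k => d k end),
  (fun i => match fintype.split i with inl j => p j | inr k => q k end); split.
- by move=> i; case: (fintype.split i).
- by move=> i; case: (fintype.split i).
- rewrite big_split_ord /=; congr (_ + _); apply: eq_bigr => i _.
    by rewrite (_ : fintype.split _ = inl i) //; exact: (unsplitK (inl i)).
  by rewrite (_ : fintype.split _ = inr i) //; exact: (unsplitK (inr i)).
Qed.

Lemma pcpZ c a : 0 <= c -> pcp a -> pcp (c%:C *: a).
Proof.
rewrite le_eqVlt => /predU1P[<- _|c0]; first by rewrite scale0r; exact: pcp0.
move=> [n [d [p [d0 pp ->]]]]; exists n, (fun i => c * d i), p; split=> //.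
  by move=> i; rewrite mulr_gt0.
by rewrite scaler_sumr; apply: eq_bigr => i _; rewrite scalerA -rmorphM.
Qed.

Lemma pcp_proj p : proj p -> pcp p.
Proof.
move=> pp; exists 1%N, (fun=> 1), (fun=> p); split=> //.
by rewrite big_ord1 scale1r.
Qed.

Lemma pcp_sum (I : Type) (r : seq I) (P : pred I) (F : I -> A) :
  (forall i, P i -> pcp (F i)) -> pcp (\sum_(i <- r | P i) F i).
Proof. by move=> h; elim/big_ind: _ => //; [exact: pcp0 | exact: pcpD]. Qed.

Lemma pcpZV c a : 0 < c -> pcp (c%:C *: a) -> pcp a.
Proof.
move=> c0 /(@pcpZ c^-1); rewrite scalerA -rmorphM /= mulVf ?gt_eqF // scale1r.
by apply; rewrite invr_ge0 ltW.
Qed.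

(** In block form with respect to q and 1 - q, the last three hypotheses are entries of the equation
    P^2 = P; the remaining entry is an adjoint. *)
Lemma block_proj q C D Y : proj q -> star C = C -> star D = D ->
  q * C = C -> q * D = 0 -> q * Y = Y -> Y * q = 0 ->
  C * C + Y * star Y = C -> D * D + star Y * Y = D -> C * Y + Y * D = Y ->
  proj (C + D + (Y + star Y)).
Proof.
move=> pq sC sD qC qD qY Yq e1 e2 e3.
have sq := proj_sa pq.
have Cq : C * q = C by rewrite -{1}sC -{1}sq -starM qC.
have Dq : D * q = 0 by rewrite -{1}sD -{1}sq -starM qD star0.
have Ysq : star Y * q = star Y by rewrite -{1}sq -starM qY.
have qYs : q * star Y = 0 by rewrite -{1}sq -starM Yq star0.
have e4 : star Y * C + D * star Y = star Y.
  by rewrite -[RHS](congr1 (@star _ _) e3) starD !starM sC sD.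
have z1 : C * D = 0 by rewrite -Cq -mulrA qD mulr0.
have z2 : D * C = 0 by rewrite -qC mulrA Dq mul0r.
have z3 : C * star Y = 0 by rewrite -Cq -mulrA qYs mulr0.
have z4 : Y * C = 0 by rewrite -qC mulrA Yq mul0r.
have z5 : Y * Y = 0 by rewrite -{2}qY mulrA Yq mul0r.
have z6 : D * Y = 0 by rewrite -qY mulrA Dq mul0r.
have z7 : star Y * D = 0 by rewrite -Ysq -mulrA qD mulr0.
have z8 : star Y * star Y = 0 by rewrite -{1}Ysq -mulrA qYs mulr0.
split; first by rewrite !starD starK sC sD [star Y + Y]addrC.
rewrite !(mulrDl, mulrDr) z1 z2 z3 z4 z5 z6 z7 z8 !(addr0, add0r).
apply: (eq_of_subr e1); apply: (eq_of_subr e2); ncl2 e3 e4.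
Qed.

(* The average of the two Halmos dilations of [x], with corners [q - m] and [x^* x] and
   off-diagonal corner [(q - m)^(1/2) x] up to sign, where [m = x x^*]. *)
Lemma pcp_move q x : proj q -> q * x = x -> x * q = 0 -> nrm x <= 1 ->
  pcp (star x * x - x * star x + q).
Proof.
move=> pq qx xq x1; have sq := proj_sa pq; have qi := proj_idem pq.
have xsq : star x * q = star x by rewrite -{1}sq -starM qx.
have qxs : q * star x = 0 by rewrite -{1}sq -starM xq star0.
pose m := x * star x; have sm : star m = m by rewrite starM starK.
have qm : q * m = m by rewrite mulrA qx.
have mq : m * q = m by rewrite -mulrA xsq.
have pC : pos (q - m).
  have m1 : nrm m <= 1.
    by rewrite nrm_cstarr; have := nrm_ge0 x; nra.
  have := proj_conj pq (ge_nrm_sub_pos sm m1); congr pos.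
  by rewrite scale1r mulrBr mulr1 qm mulrBl qi mq.
pose s := sqa (q - m); have ss : s * s = q - m := sqa_sq pC.
have sas : star s = s := sqa_sa pC.
have ms : m * s = s * m.
  by apply: sqa_comm => //; rewrite mulrBr mulrBl mq qm.
have qs : q * s = s by apply: sqa_fix => //; rewrite mulrBr qi qm.
have sq' : s * q = s by apply: sqa_fixr => //; rewrite mulrBl qi mq.
pose Y := s * x; have sY : star Y = star x * s by rewrite starM sas.
have key : forall c : R, c * c = 1 -> proj (q - m + star x * x + ((c%:C *: Y) + star (c%:C *: Y))).
  move=> c cc; have ccC : c%:C * c%:C = 1 by rewrite -rmorphM cc.
  apply: (@block_proj q) => //.
  - by rewrite starB sq sm.
  - by rewrite starM starK.
  - by rewrite mulrBr qi qm.
  - by rewrite mulrA qxs mul0r.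
  - by rewrite -scalerAr /Y mulrA qs.
  - by rewrite -scalerAl /Y -mulrA xq mulr0 scaler0.
  - rewrite star_realZ sY -scalerAl -scalerAr scalerA ccC scale1r /Y -ss.
    have -> : s * x * (star x * s) = m * (s * s) by rewrite mulrA -(mulrA s) -/m -ms mulrA.
    by rewrite -mulrDl ss subrK mulrBr qi qm.
  - rewrite star_realZ sY -scalerAl -scalerAr scalerA ccC scale1r /Y.
    have -> : star x * s * (s * x) = star x * (q - m) * x by rewrite -ss !mulrA.
    rewrite mulrBr mulrBl xsq /m !mulrA; nc.
  - rewrite -scalerAr -scalerAl -scalerDr; congr (_ *: _); rewrite /Y -ss.
    have -> : s * x * (star x * x) = s * m * x by rewrite /m !mulrA.
    have -> : s * s * (s * x) = s * (s * s) * x by rewrite !mulrA.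
    by rewrite ss -mulrDl mulrBr subrK sq'.
have p1 := pcp_proj (key 1 (mulr1 1)).
have p2 := pcp_proj (key (-1) ltac:(by rewrite mulrNN mulr1)).
apply: (@pcpZV 2) => //; have := pcpD p1 p2; congr pcp.
by rewrite !star_realZ /m; nc.
Qed.

Lemma catalan0 : catalan (0 : A) = 0.
Proof.
have h0 : nrm (0 : A) <= 4^-1 by rewrite nrm0 invr_ge0.
have h := catalanE h0; have k := catalan_nrm h0; rewrite add0r in h.
apply: nrm_eq0; have := nrmM (catalan (0 : A)) (catalan 0); rewrite -h.
by have := nrm_ge0 (catalan (0 : A)); nra.
Qed.

Lemma catalan_null z x : nrm x <= 4^-1 -> z * x = 0 -> z * catalan x = 0.
Proof.
move=> hx zx; have := @catalan_intertwine _ _ z x 0 hx.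
by rewrite nrm0 invr_ge0 ler0n zx mul0r catalan0 mul0r; apply.
Qed.

(* The projections with off-diagonal corner [y] and [- y] differ by twice [y + star y]. *)
Lemma pcp_offdiag r q y : proj r -> proj q -> r * q = q -> q * y = y -> y * q = 0 ->
  y * r = y -> nrm y <= 2^-1 -> pcp (r + 2%:C *: (y + star y)).
Proof.
move=> pr pq rq qy yq yr y2; have sq := proj_sa pq; have qi := proj_idem pq.
have sr := proj_sa pr.
have qys : q * star y = 0 by rewrite -{1}sq -starM yq star0.
have rys : r * star y = star y by rewrite -{1}sr -starM yr.
have n1 : nrm (y * star y) <= 4^-1 by rewrite nrm_cstarr; have := nrm_ge0 y; nra.
have n2 : nrm (star y * y) <= 4^-1 by rewrite nrm_cstar; have := nrm_ge0 y; nra.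
pose k := catalan (y * star y); pose l := catalan (star y * y).
have kE : k = y * star y + k * k := catalanE n1.
have lE : l = star y * y + l * l := catalanE n2.
have yl : y * l = k * y by apply: catalan_intertwine => //; rewrite mulrA.
have sk : star k = k by apply: catalan_sa => //; rewrite starM starK.
have sl : star l = l by apply: catalan_sa => //; rewrite starM starK.
have qk : q * k = k.
  by apply/compl_fix/catalan_null => //; rewrite mulrA fix_compl ?mul0r.
have kq : k * q = k by apply: sa_fix_comm.
have ql : q * l = 0 by apply: catalan_null => //; rewrite mulrA qys mul0r.
have rl : r * l = l.
  by apply/compl_fix/catalan_null => //; rewrite mulrA fix_compl ?mul0r.
have key : forall c : R, c * c = 1 -> proj (q - k + l + ((c%:C *: y) + star (c%:C *: y))).
  move=> c cc; have ccC : c%:C * c%:C = 1 by rewrite -rmorphM cc.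
  apply: (@block_proj q) => //.
  - by rewrite starB sq sk.
  - by rewrite mulrBr qi qk.
  - by rewrite -scalerAr qy.
  - by rewrite -scalerAl yq scaler0.
  - rewrite star_realZ -scalerAl -scalerAr scalerA ccC scale1r.
    rewrite mulrBr !mulrBl qi qk kq; ncl (esym kE).
  - by rewrite star_realZ -scalerAl -scalerAr scalerA ccC scale1r addrC -lE.
  - by rewrite -scalerAr -scalerAl -scalerDr yl mulrBl qy subrK.
have p1 := pcp_proj (key 1 (mulr1 1)).
have p2 := key (-1) ltac:(by rewrite mulrNN mulr1).
have ry : r * y = y by rewrite -qy mulrA rq.
have p3 : proj (r - (q - k + l + (((-1)%:C *: y) + star ((-1)%:C *: y)))).
  apply: projB => //; rewrite star_realZ.
  have rk : r * k = k by rewrite -qk mulrA rq.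
  by rewrite !mulrDr mulrN rq rk rl -!scalerAr ry rys.
have := pcpD p1 (pcp_proj p3); congr pcp.
by rewrite !star_realZ; nc.
Qed.

(* Self-commutators of both signs are allowed, so that the class is closed under
   opposites. *)
Definition csum (N : nat) c e f d := exists x y : nat -> A,
  [/\ forall j, [/\ f * x j = x j, x j * e = x j & nrm (x j) <= c],
      forall j, [/\ f * y j = y j, y j * e = y j & nrm (y j) <= c]
    & d = \sum_(j < N) (star (x j) * x j - x j * star (x j)
            - (star (y j) * y j - y j * star (y j)))].

(** After division by c each self-commutator has the form treated in [pcp_move]. The [x j] cost c^2
    f; the [y j] enter with the opposite sign, so their adjoints are used, at the cost of c^2 e. *)
Lemma csum_pcp N c e f d : 0 < c -> proj e -> proj f -> e * f = 0 -> csum N c e f d ->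
  pcp (d + (N%:R * c ^+ 2)%:C *: (e + f)).
Proof.
move=> c0 pe pf ef [x [y [hx hy ->]]].
have fe : f * e = 0 by rewrite -(proj_sa pe) -(proj_sa pf) -starM ef star0.
rewrite (_ : _ + _ = \sum_(j < N) (star (x j) * x j - x j * star (x j) + (c ^+ 2)%:C *: f
  + (y j * star (y j) - star (y j) * y j + (c ^+ 2)%:C *: e))); last first.
  have -> : (N%:R * c ^+ 2)%:C *: (e + f) = \sum_(j < N) ((c ^+ 2)%:C *: (e + f)).
    by rewrite sumr_const card_ord rmorphM rmorph_nat -scalerA scaler_nat.
  by rewrite -big_split /=; apply: eq_bigr => j _; nc.
have ci : 0 < c^-1 by rewrite invr_gt0.
have gen q z : proj q -> q * z = z -> z * q = 0 -> nrm z <= c ->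
    pcp (star z * z - z * star z + (c ^+ 2)%:C *: q).
  move=> pq qz zq zc; apply: (@pcpZV (c^-1 ^+ 2)); first by rewrite exprn_gt0.
  have := @pcp_move q ((c^-1)%:C *: z) pq; rewrite -scalerAr qz -scalerAl zq scaler0.
  move=> /(_ erefl erefl); rewrite nrmZV ?mulr1 // => /(_ isT); congr pcp.
  have cn : c%:C != 0 :> R[i] by rewrite (fmorph_eq0 (real_complex R)) gt_eqF.
  by rewrite star_realZ; nc.
apply: pcp_sum => j _; apply: pcpD.
  have [h1 h2 h3] := hx j; apply: gen => //.
  by rewrite -h2 -mulrA ef mulr0.
have [h1 h2 h3] := hy j.
have := gen e (star (y j)) pe; rewrite starK nrm_star; apply=> //.
  by rewrite -{1}(proj_sa pe) -starM h2.
by rewrite -{1}(proj_sa pe) -starM -h1 mulrA ef mul0r star0.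
Qed.

Lemma csum0 c e f : 0 <= c -> csum 0 c e f 0.
Proof.
move=> c0; exists (fun=> 0), (fun=> 0); split; last by rewrite big_ord0.
  by move=> j; rewrite mulr0 mul0r nrm0.
by move=> j; rewrite mulr0 mul0r nrm0.
Qed.

Lemma csumD M N c e f d d' : csum M c e f d -> csum N c e f d' -> csum (M + N) c e f (d + d').
Proof.
move=> [x [y [hx hy ->]]] [x' [y' [hx' hy' ->]]].
exists (fun j => if (j < M)%N then x j else x' (j - M)%N),
  (fun j => if (j < M)%N then y j else y' (j - M)%N); split.
- by move=> j; case: ifP.
- by move=> j; case: ifP.
rewrite big_split_ord /=; congr (_ + _); apply: eq_bigr => j _; first by rewrite ltn_ord.
by rewrite ltnNge leq_addr /= addKn.
Qed.

Lemma csumN N c e f d : csum N c e f d -> csum N c e f (- d).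
Proof.
move=> [x [y [hx hy ->]]]; exists y, x; split=> //.
by rewrite -sumrN; apply: eq_bigr => j _; rewrite opprB.
Qed.

Lemma csumB M N c e f d d' : csum M c e f d -> csum N c e f d' -> csum (M + N) c e f (d - d').
Proof. by move=> h /csumN; exact: csumD. Qed.

Lemma csum1 c e f x : f * x = x -> x * e = x -> nrm x <= c ->
  csum 1 c e f (star x * x - x * star x).
Proof.
move=> fx xe xc; exists (fun=> x), (fun=> 0); split=> //.
  by move=> _; rewrite mulr0 mul0r nrm0; split=> //; apply: le_trans (nrm_ge0 x) xc.
by rewrite big_ord1 star0 mulr0 !subr0.
Qed.

Lemma csum_sum N c e f (d : 'I_N -> A) M : (forall i, csum M c e f (d i)) -> 0 <= c ->
  csum (N * M) c e f (\sum_(i < N) d i).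
Proof.
move=> h c0; elim: N d h => [|N ih] d h; first by rewrite big_ord0; exact: csum0.
by rewrite big_ord_recl mulSn; apply: csumD => //; apply: ih.
Qed.

Lemma csum_sub N c c' e e' f f' d : c <= c' -> proj e -> e' * e = e -> proj e' -> f' * f = f ->
  csum N c e f d -> csum N c' e' f' d.
Proof.
move=> cc pe ee pe' ff [x [y [hx hy ->]]]; have ee' := proj_le_comm pe pe' ee.
have gen z : [/\ f * z = z, z * e = z & nrm z <= c] -> [/\ f' * z = z, z * e' = z & nrm z <= c'].
  move=> [fz ze zc]; split; last exact: le_trans zc cc.
    by rewrite -fz mulrA ff.
  by rewrite -ze -mulrA ee'.
by exists x, y; split=> // j; apply: gen.
Qed.

Lemma csumZ N c e f d t : 0 <= t -> csum N c e f d -> csum N (t * c) e f ((t ^+ 2)%:C *: d).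
Proof.
move=> t0 [x [y [hx hy ->]]]; exists (fun j => t%:C *: x j), (fun j => t%:C *: y j).
have gen z : [/\ f * z = z, z * e = z & nrm z <= c] ->
    [/\ f * (t%:C *: z) = t%:C *: z, t%:C *: z * e = t%:C *: z & nrm (t%:C *: z) <= t * c].
  move=> [fz ze zc]; split; first by rewrite -scalerAr fz.
    by rewrite -scalerAl ze.
  by rewrite nrmZ ger0_norm // ler_wpM2l.
split; [by move=> j; apply: gen | by move=> j; apply: gen |].
by rewrite scaler_sumr; apply: eq_bigr => j _; rewrite !star_realZ; nc.
Qed.

End PositiveCombinations.

(** * Series of self-commutators with orthogonal supports *)

Section Series.
Context {R : realType} {A : cstarAlgType R}.
Implicit Types (a b d e f p q r v w x y z : A) (c t : R) (u : nat -> A).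
Notation proj := (projection A).

Lemma geometric_cvg u c : 0 <= c -> (forall k, nrm (u k) <= c * 2^-1 ^+ k) ->
  exists X, tends (fun n => \sum_(k < n) u k) X /\ nrm X <= 2 * c.
Proof.
move=> c0 uc.
pose v n : R := 2 * c * (1 - 2^-1 ^+ n).
have v2 n : v n <= 2 * c.
  have h : 0 <= (2^-1 : R) ^+ n by apply: exprn_ge0; rewrite invr_ge0.
  by have := mulr_ge0 c0 h; rewrite /v; lra.
have inc n : nrm (\sum_(k < n.+1) u k - \sum_(k < n) u k) <= v n.+1 - v n.
  rewrite big_ord_recr /= [X in X - _]addrC addrK; apply: le_trans (uc n) _.
  by rewrite /v exprS; lra.
have [X hX] := tends_increments inc v2; exists X; split=> //.
apply: (tends_nrm_le _ hX) => n; apply: le_trans (v2 n).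
elim: n => [|n ih]; first by rewrite big_ord0 nrm0 /v expr0 subrr mulr0.
have := nrmD (\sum_(k < n.+1) u k - \sum_(k < n) u k) (\sum_(k < n) u k).
by rewrite subrK; have := inc n; lra.
Qed.

Lemma tends_orth_square u X : (forall k l, k != l -> star (u k) * u l = 0) ->
  tends (fun n => \sum_(k < n) u k) X ->
  tends (fun n => \sum_(k < n) (star (u k) * u k)) (star X * X).
Proof.
move=> orth hX; apply: tends_eq (tendsM (tends_star hX) hX) => n /=.
rewrite star_sum mulr_suml; apply: eq_bigr => k _; rewrite mulr_sumr (bigD1 k) //= big1 ?addr0 //.
by move=> l lk; apply: orth; rewrite eq_sym -(inj_eq val_inj) in lk.
Qed.

Lemma tends_fixl f u X : (forall n, f * u n = u n) -> tends u X -> f * X = X.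
Proof. by move=> fu hX; apply: (tends_uniq _ hX); apply: tends_eq (tendsMl f hX). Qed.

Lemma tends_fixr e u X : (forall n, u n * e = u n) -> tends u X -> X * e = X.
Proof. by move=> ue hX; apply: (tends_uniq _ hX); apply: tends_eq (tendsMr e hX). Qed.

Lemma tends_sum N (u : nat -> nat -> A) (X : nat -> A) : (forall j, tends (u j) (X j)) ->
  tends (fun n => \sum_(j < N) u j n) (\sum_(j < N) X j).
Proof.
move=> h; elim: N => [|N ih].
  by rewrite big_ord0; apply: tends_eq (tends_cst 0) => n; rewrite big_ord0.
by rewrite big_ord_recr; apply: tends_eq (tendsD ih (h N)) => n; rewrite big_ord_recr.
Qed.

(** For fixed j the pieces with different k have orthogonal left and right supports, so they add up
    to one element whose self-commutator is the sum of theirs. Hence [N] does not grow with the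
    length of the series. *)
Lemma csum_series N c e f (es fs D : nat -> A) : 0 <= c ->
  (forall k, proj (es k) /\ proj (fs k)) ->
  (forall k l, k != l -> es k * es l = 0 /\ fs k * fs l = 0) ->
  (forall k, e * es k = es k /\ f * fs k = fs k) -> proj e ->
  (forall k, csum N (c * 2^-1 ^+ k) (es k) (fs k) (D k)) ->
  exists s, csum N (2 * c) e f s /\ tends (fun n => \sum_(k < n) D k) s.
Proof.
move=> c0 pef orth sub pe hD.
have [x hx] := choice hD; have [y hy] := choice hx.
have gen (z : nat -> nat -> A) : (forall k j, [/\ fs k * z k j = z k j, z k j * es k = z k j
      & nrm (z k j) <= c * 2^-1 ^+ k]) ->
    exists Z : nat -> A, (forall j, [/\ f * Z j = Z j, Z j * e = Z j & nrm (Z j) <= 2 * c]) /\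
      forall j, tends (fun n => \sum_(k < n) (star (z k j) * z k j - z k j * star (z k j)))
        (star (Z j) * Z j - Z j * star (Z j)).
  move=> hz.
  have hj j : exists X, tends (fun n => \sum_(k < n) z k j) X /\ nrm X <= 2 * c.
    by apply: (@geometric_cvg (fun k => z k j)) => // k; case: (hz k j).
  have [Z hZ] := choice hj; exists Z; split=> j; have [h1 h2] := hZ j.
    split=> //.
      apply: (tends_fixl _ h1) => n; rewrite mulr_sumr; apply: eq_bigr => k _.
      by have [<- _ _] := hz k j; rewrite mulrA (sub k).2.
    apply: (tends_fixr _ h1) => n; rewrite mulr_suml; apply: eq_bigr => k _.
    have [_ <- _] := hz k j; rewrite -mulrA; congr (_ * _).
    by apply: proj_le_comm => //; [exact: (pef k).1 | exact: (sub k).1].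
  have t1 : tends (fun n => \sum_(k < n) (star (z k j) * z k j)) (star (Z j) * Z j).
    apply: (@tends_orth_square (fun k => z k j) _ _ h1) => k l kl.
    have [<- _ _] := hz k j; have [<- _ _] := hz l j.
    by rewrite starM (proj_sa (pef k).2) -mulrA (mulrA (fs k)) (orth k l kl).2 mul0r mulr0.
  have h1' : tends (fun n => \sum_(k < n) star (z k j)) (star (Z j)).
    by apply: tends_eq (tends_star h1) => n; rewrite star_sum.
  have t2 : tends (fun n => \sum_(k < n) (z k j * star (z k j))) (Z j * star (Z j)).
    have := @tends_orth_square (fun k => star (z k j)) (star (Z j)) _ h1'.
    rewrite starK => t; apply: tends_eq (t _) => [n|k l kl].
      by apply: eq_bigr => k _; rewrite starK.
    rewrite starK; have [_ <- _] := hz k j; have [_ <- _] := hz l j.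
    by rewrite starM (proj_sa (pef l).1) -mulrA (mulrA (es k)) (orth k l kl).1 mul0r mulr0.
  by apply: tends_eq (tendsB t1 t2) => n; rewrite -sumrB.
have [X [hX tX]] := gen x (fun k j => let: And3 h _ _ := hy k in h j).
have [Y [hY tY]] := gen y (fun k j => let: And3 _ h _ := hy k in h j).
exists (\sum_(j < N) (star (X j) * X j - X j * star (X j) - (star (Y j) * Y j - Y j * star (Y j)))).
split; first by exists X, Y.
have t := @tends_sum N _ _ (fun j => tendsB (tX j) (tY j)).
apply: tends_eq t => n /=.
under [in RHS]eq_bigr => k _ do have [_ _ ->] := hy k.
by rewrite [RHS]exchange_big /=; apply: eq_bigr => j _; rewrite -sumrB.
Qed.

End Series.

(** * Traces and comparison of projections *)

Section Traces.
Context {R : realType} {A : cstarAlgType R}.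
Implicit Types (a b d e f p q r v w x y z : A) (c : R).
Notation proj := (projection A).

(* The real part of a tracial state. *)
Record rtrace (t : A -> R) : Prop := Rtrace {
  rtD : forall x y, t (x + y) = t x + t y;
  rtZ : forall c x, t (c%:C *: x) = c * t x;
  rtC : forall x y, t (x * y) = t (y * x);
  rt_ge0 : forall x, pos x -> 0 <= t x;
  rt1 : t 1 = 1;
  rt_star : forall x, t (star x) = t x }.

Variables (t : A -> R) (ht : rtrace t).

Lemma rt0 : t 0 = 0.
Proof. by have := rtZ ht 0 0; rewrite scale0r mul0r. Qed.

Lemma rtN x : t (- x) = - t x.
Proof. by apply/eqP; rewrite -addr_eq0 -(rtD ht) addNr rt0. Qed.

Lemma rtB x y : t (x - y) = t x - t y.
Proof. by rewrite (rtD ht) rtN. Qed.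

Lemma rt_sum (I : Type) (r : seq I) (P : pred I) (F : I -> A) :
  t (\sum_(i <- r | P i) F i) = \sum_(i <- r | P i) t (F i).
Proof. by apply: (big_morph _ (rtD ht) rt0). Qed.

Lemma rt_le x y : pos (y - x) -> t x <= t y.
Proof. by move=> /(rt_ge0 ht); rewrite rtB subr_ge0. Qed.

Lemma rt_real c : t c%:C%:A = c.
Proof. by rewrite (rtZ ht) (rt1 ht) mulr1. Qed.

Lemma rt_norm x : star x = x -> `|t x| <= nrm x.
Proof.
move=> sx; rewrite ler_norml; apply/andP; split.
  by have := rt_ge0 ht (ge_nrm_add_pos sx (lexx _)); rewrite (rtD ht) rt_real; lra.
by have := rt_ge0 ht (ge_nrm_sub_pos sx (lexx _)); rewrite rtB rt_real; lra.
Qed.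

Lemma rt_comm x y : t (x * y - y * x) = 0.
Proof. by rewrite rtB (rtC ht) subrr. Qed.

Lemma rt_csum N c e f d : csum N c e f d -> t d = 0.
Proof.
move=> [x [y [_ _ ->]]]; rewrite rt_sum big1 // => j _.
by rewrite rtB !rt_comm subrr.
Qed.

Lemma rt_proj_ge0 p : proj p -> 0 <= t p.
Proof. by move=> /proj_pos/(rt_ge0 ht). Qed.

Lemma rt_corner p x : proj p -> star x = x -> p * x = x -> `|t x| <= nrm x * t p.
Proof.
move=> pp sx px; have xp := sa_fix_comm pp sx px; have pi := proj_idem pp.
have h1 := rt_ge0 ht (proj_conj pp (ge_nrm_add_pos sx (lexx _))).
have h2 := rt_ge0 ht (proj_conj pp (ge_nrm_sub_pos sx (lexx _))).
have e1 : p * ((nrm x)%:C%:A + x) * p = (nrm x)%:C *: p + x.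
  by rewrite mulrDr px mulrDl xp -scalerAr mulr1 -scalerAl pi.
have e2 : p * ((nrm x)%:C%:A - x) * p = (nrm x)%:C *: p - x.
  by rewrite mulrBr px mulrBl xp -scalerAr mulr1 -scalerAl pi.
move: h1 h2; rewrite e1 e2 (rtD ht) rtB (rtZ ht) => h1 h2.
by rewrite ler_norml; apply/andP; split; lra.
Qed.

End Traces.

(** * Subequivalence and partitions into small projections *)

Section Subequivalence.
Context {R : realType} {A : cstarAlgType R}.
Implicit Types (a b d e f g p q r v w x y z : A) (c : R).
Notation proj := (projection A).

Definition subeq p q := exists v, star v * v = p /\ q * v = v.

Lemma isom_fix v p : proj p -> star v * v = p -> v * p = v.
Proof.
move=> pp vv; apply/eqP; rewrite eq_sym -subr_eq0; apply/eqP/star_eq0.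
rewrite starB starM (proj_sa pp); have pi := proj_idem pp.
have -> : (star v - p * star v) * (v - v * p) = star v * v - p * (star v * v) - (star v * v) * p + p * (star v * v) * p by nc.
by rewrite vv !pi subrr sub0r addNr.
Qed.

Lemma isom_range v p : proj p -> star v * v = p -> proj (v * star v).
Proof.
move=> pp vv; split; first by rewrite starM starK.
by rewrite -mulrA (mulrA (star v)) vv mulrA (isom_fix pp vv).
Qed.

Lemma isom_nrm v p : proj p -> star v * v = p -> nrm v <= 1.
Proof.
move=> pp vv; have := proj_nrm pp; rewrite -vv nrm_cstar.
by have := nrm_ge0 v; nra.
Qed.

Lemma mvn_lt_subeq p q : proj p -> proj q -> mvn_lt p q -> subeq p q.
Proof.
move=> pp pq [r [[v [vv vr]] [pr rq] _]]; exists v; split=> //.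
have rv : r * v = v by rewrite -vr -mulrA vv (isom_fix pp vv).
have qr : q * r = r by rewrite -(proj_sa pr) -(proj_sa pq) -starM rq.
by rewrite -rv mulrA qr.
Qed.

(** If d inverts r a a^* r in the corner of r, then v = a^* r d^(1/2) satisfies v^* v = r. *)
Lemma subeq_dominated g a r c : proj r -> 0 <= c -> pos (c%:C *: (a * star a) - r) ->
  a * g = a -> proj g -> subeq r g.
Proof.
move=> pr c0 pd ag pg; pose x := a * star a; have px : pos x := pos_starr a.
(* Dividing by c + 1 covers c = 0 and keeps t <= 1, as [range_proj] demands. *)
pose t := (c + 1)^-1; have t0 : 0 < t by rewrite invr_gt0; lra.
have t1 : t <= 1 by rewrite invf_le1; lra.
have pge : pos (r * x * r - t%:C *: r).
  have h1 := posD (proj_conj pr pd) (proj_conj pr px).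
  have := posZ (ltW t0) h1; congr pos.
  have tc : t%:C * (c + 1)%:C = 1 :> R[i] by rewrite -rmorphM mulVf //; lra.
  rewrite mulrBr mulrBl -scalerAr -scalerAl !proj_idem // -/x.
  transitivity ((t%:C * (c + 1)%:C) *: (r * x * r) - t%:C *: r); first by nc.
  by rewrite tc scale1r.
have [d [_ _ [pd' _] [e1 e2] _]] := range_proj pr px (c := t) ltac:(lra) pge.
have sd := sqa_sa pd'.
have cs : r * x * r * sqa d = sqa d * (r * x * r) by apply: sqa_comm; rewrite // e1 e2.
exists (star a * r * sqa d); split.
  rewrite !starM starK sd (proj_sa pr).
  have -> : sqa d * (r * a) * (star a * r * sqa d) = sqa d * (r * x * r) * sqa d.
    by rewrite /x !mulrA.
  by rewrite -cs -mulrA sqa_sq.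
by rewrite !mulrA; congr (_ * _ * _); rewrite -{1}(proj_sa pg) -starM ag.
Qed.

Inductive ssum g : A -> Prop :=
  | ssum0 : ssum g 0
  | ssumS p r of ssum g p & proj p & proj r & r * p = 0 & subeq r g : ssum g (p + r).

(* Removing from [p] a projection that supports [a_m] up to a small error leaves
   a projection that is generated by the remaining [a_j]. *)
Lemma ssum_generated g m p (a b : nat -> A) : rr0 (A := A) -> proj g -> proj p ->
  (forall j, p * a j = a j /\ a j * g = a j) -> p = \sum_(j < m) a j * b j -> ssum g p.
Proof.
move=> rr pg; elim: m p a b => [|m ih] p a b pp ha pE.
  by rewrite pE big_ord0; exact: ssum0.
pose x := a m * star (a m); have px : pos x := pos_starr _.
pose s := (2 * (nrm (b m) + 1))^-1; have b0 := nrm_ge0 (b m).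
have s0 : 0 < s by rewrite invr_gt0; lra.
have h6 : s * (2 * (nrm (b m) + 1)) = 1.
  by apply: mulVf; apply: lt0r_neq0; lra.
have [r [t [pr t0 rx rn]]] := hereditary_proj rr px (mulr_gt0 s0 s0).
have px0 : (1 - p) * x = 0 by rewrite /x mulrA fix_compl ?mul0r //; exact: (ha m).1.
have pr' : p * r = r := compl_fix (dominated_null (proj_pos pr) rx px0).
pose p1 := p - r; have pp1 : proj p1 := projB pr pp pr'.
have rp := proj_le_comm pr pp pr'.
have rp1 : r * p1 = 0 by rewrite mulrBr rp proj_idem // subrr.
have pp1p : p1 * p = p1 by rewrite mulrBl rp proj_idem.
have p1i := proj_idem pp1.
have pa : p1 * a m = (1 - r) * a m by rewrite !mulrBl mul1r (ha m).1.
have an : nrm (p1 * a m) <= s.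
  have : nrm (p1 * a m) ^+ 2 <= s * s.
    by rewrite pa -nrm_cstarr starM (proj_sa (projC pr)) mulrA -(mulrA (1 - r)).
  have := nrm_ge0 (p1 * a m); nra.
(* Under [p1] the last term has become small, so 1 - z is invertible and [p1] is expressed by the
   other terms. *)
pose z := p1 * a m * b m * p1.
have zn : nrm z < 1.
  have h1 := nrmM (p1 * a m * b m) p1; have h2 := nrmM (p1 * a m) (b m).
  have h3 := proj_nrm pp1; have h4 := nrm_ge0 p1; have h5 := nrm_ge0 (p1 * a m).
  have h7 := nrm_ge0 (p1 * a m * b m).
  have h8 : nrm (p1 * a m) * nrm (b m) <= s * nrm (b m) by rewrite ler_wpM2r.
  have h9 : nrm (p1 * a m * b m) * nrm p1 <= nrm (p1 * a m * b m) by rewrite ler_piMr.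
  by rewrite /z; lra.
have uz := unit_1B zn; pose w := (1 - z)^-1.
have p1E : p1 = \sum_(j < m) (p1 * a j) * (b j * p1 * w).
  have p1z : p1 * (1 - z) = \sum_(j < m) p1 * (a j * b j) * p1.
    have : p1 * p * p1 = \sum_(j < m.+1) p1 * (a j * b j) * p1.
      by rewrite [X in p1 * X]pE mulr_sumr mulr_suml.
    rewrite pp1p p1i big_ord_recr /= !mulrA -/z => h.
    have zz : p1 * z = z by rewrite /z !mulrA p1i.
    rewrite mulrBr mulr1 zz {1}h addrK; apply: eq_bigr => j _; by rewrite !mulrA.
  transitivity (p1 * (1 - z) * w); first by rewrite mulrK.
  by rewrite p1z mulr_suml; apply: eq_bigr => j _; rewrite !mulrA.
rewrite -(subrK r p) -/p1; apply: ssumS => //; last first.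
  by apply: subeq_dominated rx _ pg => //; exact: (ha m).2.
apply: (ih p1 (fun j => p1 * a j) (fun j => b j * p1 * w)) => // j.
by rewrite mulrA p1i -mulrA (ha j).2.
Qed.

Lemma ex_lower_bound n (f : 'I_n -> R) : (forall i, 0 < f i) ->
  exists2 e : R, 0 < e & forall i, e < f i.
Proof.
elim: n f => [|n ih] f f0; first by exists 1 => // -[].
have [e e0 he] := ih (fun i => f (lift ord0 i)) (fun i => f0 _).
exists (Num.min (e / 2) (f ord0 / 2)).
  by rewrite lt_min !divr_gt0.
move=> i; have := f0 ord0; case: (unliftP ord0 i) => [j ->|->] h; rewrite gt_min.
  by apply/orP; left; have := he j; lra.
by apply/orP; right; lra.
Qed.

End Subequivalence.

(** * Consequences of comparison: halving, compression, packing *)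

Section Comparison.
Context {R : realType} {A : cstarAlgType R}.
Implicit Types (a b d e f g p q r v w x y z : A) (c : R).
Notation proj := (projection A).
Variables (n : nat) (tr : 'I_n -> A -> R).
Hypothesis htr : forall i, rtrace (tr i).
Hypothesis rr : rr0 (A := A).
Hypothesis cmp : forall p q, proj p -> proj q -> (forall i, tr i p < tr i q) -> subeq p q.
Hypothesis gen1 : forall g, proj g -> g <> 0 ->
  exists (m : nat) (x y : nat -> A), 1 = \sum_(j < m) x j * g * y j.

Lemma tr_sub p q i : proj p -> proj q -> q * p = p -> tr i p <= tr i q.
Proof. by move=> pp pq h; apply/(rt_le (htr i))/proj_le_pos. Qed.

Lemma tr_subeq p q i : proj p -> proj q -> subeq p q -> tr i p <= tr i q.
Proof.
move=> pp pq [v [vv qv]]; rewrite -vv (rtC (htr i)); apply: tr_sub => //.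
  exact: isom_range vv.
by rewrite mulrA qv.
Qed.

Lemma tr_range v p i : star v * v = p -> tr i (v * star v) = tr i p.
Proof. by move=> <-; rewrite (rtC (htr i)). Qed.

(** A trace vanishing at p vanishes on the corner of p, hence on all x p y by cyclicity, hence at
    the unit by [gen1]. *)
Lemma tr_gt0 p i : proj p -> p <> 0 -> 0 < tr i p.
Proof.
move=> pp p0; rewrite lt_def (rt_proj_ge0 (htr i)) // andbT; apply/eqP => tp.
have [m [x [y e1]]] := gen1 pp p0.
have := rt1 (htr i); rewrite e1 (rt_sum (htr i)) big1.
  by move=> /eqP; rewrite eq_sym oner_eq0.
move=> j _; have pi := proj_idem pp.
have -> : tr i (x j * p * y j) = tr i (p * (y j * x j) * p).
  by rewrite -mulrA (rtC (htr i)) -mulrA [RHS](rtC (htr i)) [in RHS]mulrA pi.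
pose w := y j * x j; pose z := p * w * p.
have hz : tr i z = 2^-1 * tr i (z + star z).
  by rewrite (rtD (htr i)) (rt_star (htr i)); field.
rewrite -/w -/z hz; suff -> : tr i (z + star z) = 0 by rewrite mulr0.
have := @rt_corner _ _ _ (htr i) p (z + star z) pp.
rewrite tp mulr0 starD starK addrC => h; apply/eqP; rewrite -normr_le0; apply: h => //.
by rewrite mulrDr /z !starM (proj_sa pp) !mulrA pi.
Qed.

Lemma ssum_proj g p : proj g -> g <> 0 -> proj p -> ssum g p.
Proof.
move=> pg g0 pp; have [m [x [y e1]]] := gen1 pg g0.
apply: (@ssum_generated _ _ g m p (fun j => p * x j * g) (fun j => g * y j * p)) => //.
  by move=> j; split; [rewrite !mulrA (proj_idem pp) | rewrite -mulrA (proj_idem pg)].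
rewrite -[LHS](proj_idem pp) -{1}(mulr1 p) e1 mulr_sumr mulr_suml.
by apply: eq_bigr => j _; rewrite !mulrA -[in RHS](mulrA (p * x j)) (proj_idem pg).
Qed.

(* Put each new summand [r] in the half that makes the cross term of the square
   nonpositive. *)
Lemma ssum_halving g c p : proj g -> (forall i, tr i g <= c) -> ssum g p ->
  exists p', [/\ proj p', p * p' = p' &
    \sum_i (tr i p' - tr i (p - p')) ^+ 2 <= c * \sum_i tr i p].
Proof.
move=> pg gc; elim=> [|q r sq [q' [pq' qq' le]] pq pr rq rg].
  exists 0; split; [exact: proj0 | by rewrite mulr0 |].
  rewrite [X in X <= _]big1 ?[X in _ * X]big1 ?mulr0 // => i _.
    exact: rt0 (htr i).
  by rewrite subr0 (rt0 (htr i)) subrr expr0n.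
have qr : q * r = 0 by rewrite -(proj_sa pq) -(proj_sa pr) -starM rq star0.
have rq' : r * q' = 0 by rewrite -qq' mulrA rq mul0r.
have q'r : q' * r = 0 by rewrite -(proj_sa pq') -(proj_sa pr) -starM rq' star0.
pose D i := tr i q' - tr i (q - q'); pose rho i := tr i r.
have rho0 i : 0 <= rho i by exact: rt_proj_ge0.
have rc i : rho i <= c by apply: le_trans (gc i); apply: tr_subeq.
have sumE : c * \sum_i tr i (q + r) = c * \sum_i tr i q + \sum_i c * rho i.
  rewrite -mulr_sumr -mulrDr -big_split; congr (_ * _); apply: eq_bigr => i _.
  exact: (rtD (htr i)).
have rho2 : \sum_i rho i ^+ 2 <= \sum_i c * rho i.
  by apply: ler_sum => i _; rewrite expr2 ler_wpM2r.
have [S0|S0] := lerP (\sum_i D i * rho i) 0.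
  exists (q' + r); split; first exact: projD.
    by rewrite mulrDl !mulrDr qq' qr rq' proj_idem // addr0 add0r.
  rewrite sumE; apply: le_trans (lerD le rho2).
  rewrite (eq_bigr (fun i => D i ^+ 2 + 2 * (D i * rho i) + rho i ^+ 2)); last first.
    by move=> i _; rewrite /D /rho !(rtB (htr i)) !(rtD (htr i)); ring.
  by rewrite !big_split /= -mulr_sumr lerD2r gerDl; lra.
exists q'; split=> //.
  by rewrite mulrDl qq' rq' addr0.
rewrite sumE; apply: le_trans (lerD le rho2).
rewrite (eq_bigr (fun i => D i ^+ 2 - 2 * (D i * rho i) + rho i ^+ 2)); last first.
  by move=> i _; rewrite /D /rho !(rtB (htr i)) !(rtD (htr i)); ring.
by rewrite !big_split /= sumrN -mulr_sumr lerD2r gerDl; lra.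
Qed.

Hypothesis small : forall c, 0 < c -> exists g, [/\ proj g, g <> 0 & forall i, tr i g <= c].

Lemma halving p c : proj p -> 0 < c -> exists p', [/\ proj p', p * p' = p' &
  forall i, `|tr i p' - tr i (p - p')| < c].
Proof.
(* The sum of the squared imbalances is at most e times the sum of the [tr i p], hence at most e n <
   c^2. *)
move=> pp c0; pose e := c ^+ 2 / (n%:R + 1); have n0 : 0 <= n%:R :> R by rewrite ler0n.
have c2 : 0 < c ^+ 2 by rewrite exprn_gt0.
have e0 : 0 < e by apply: divr_gt0 => //; lra.
have [g [pg g0 ge]] := small e0.
have [p' [pp' h1 h2]] := ssum_halving pg ge (ssum_proj pg g0 pp).
exists p'; split=> // i.
have : (tr i p' - tr i (p - p')) ^+ 2 < c ^+ 2.
  apply: (@le_lt_trans _ _ (\sum_i (tr i p' - tr i (p - p')) ^+ 2)).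
    by rewrite (bigD1 i) //= lerDl sumr_ge0 // => j _; rewrite sqr_ge0.
  apply: le_lt_trans h2 _; apply: (@le_lt_trans _ _ (e * n%:R)).
    rewrite ler_wpM2l ?(ltW e0) // -[n in n%:R]card_ord -sumr_const; apply: ler_sum => j _.
    by rewrite -(rt1 (htr j)); apply: tr_sub; rewrite ?mul1r //; exact: proj1.
  by rewrite /e mulrAC ltr_pdivrMr; [nra | lra].
rewrite -[X in X < _ -> _]real_normK ?num_real // ltr_pXn2r ?nnegrE ?normr_ge0 //.
exact: ltW.
Qed.

(** Repeated halving cuts p into 2^k pieces, each of smaller trace than f and so subequivalent to f.
    The ranges of the pieces inside f may overlap. *)
Lemma compress k p f : proj p -> proj f -> (forall i, tr i p < 2 ^+ k * tr i f) ->
  exists v : nat -> A, (forall j, f * v j = v j) /\ p = \sum_(j < 2 ^ k) star (v j) * v j.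
Proof.
move=> pp pf; elim: k p pp => [|k ih] p pp h.
  have [v [vv fv]] := cmp pp pf (fun i => ltac:(by have := h i; rewrite expr0 mul1r)).
  by exists (fun=> v); split=> //; rewrite expn0 big_ord1.
have h' i : 0 < 2 ^+ k.+1 * tr i f - tr i p by rewrite subr_gt0.
have [e e0 he] := ex_lower_bound h'.
have [p' [pp' pp'p hp]] := halving pp e0.
have bound i : tr i p' < 2 ^+ k * tr i f /\ tr i (p - p') < 2 ^+ k * tr i f.
  have := hp i; have := he i; rewrite (rtB (htr i)) exprS ltr_norml => h1 /andP[h2 h3].
  by split; lra.
have [v [fv vE]] := ih p' pp' (fun i => (bound i).1).
have [w [fw wE]] := ih (p - p') (projB pp' pp pp'p) (fun i => (bound i).2).
exists (fun j => if (j < 2 ^ k)%N then v j else w (j - 2 ^ k)%N); split.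
  by move=> j; case: ifP.
rewrite expnS mul2n -addnn big_split_ord /=; transitivity (p' + (p - p')); first by nc.
rewrite {1}vE wE.
congr (_ + _); apply: eq_bigr => j _; first by rewrite ltn_ord.
by rewrite ltnNge leq_addr /= addKn.
Qed.

(** With y_j = v_j z^(1/2), the elements y_j^* y_j add up to z, and z' is the sum of the y_j y_j^*.
    Overlapping ranges account for the factor 2^k in the norm. *)
Lemma compress_csum k p f z c : proj p -> proj f -> (forall i, tr i p < 2 ^+ k * tr i f) ->
  pos z -> p * z = z -> 0 <= c -> nrm z <= c ^+ 2 ->
  exists z', [/\ pos z', f * z' = z', nrm z' <= (2 ^ k)%:R * nrm z & csum (2 ^ k) c p f (z - z')].
Proof.
move=> pp pf h pz pz' c0 zc; have [v [fv pE]] := compress pp pf h.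
have sz := sqa_sa pz; have zz := sqa_sq pz.
have vn (j : 'I_(2 ^ k)) : nrm (v j) <= 1.
  have : nrm (star (v j) * v j) <= nrm p.
    apply: pos_mono; first exact: pos_star.
    rewrite pE (bigD1 j) //= addrC addrK; apply: pos_sum => i _; exact: pos_star.
  by rewrite nrm_cstar; have := proj_nrm pp; have := nrm_ge0 (v j); nra.
pose y j := v j * sqa z.
have zp : z * p = z by apply: sa_fix_comm => //; exact: pos_sa.
exists (\sum_(j < 2 ^ k) v j * z * star (v j)); split.
- by apply: pos_sum => j _; exact: pos_conjr.
- by rewrite mulr_sumr; apply: eq_bigr => j _; rewrite !mulrA fv.
- rewrite (_ : (2 ^ k)%:R * nrm z = \sum_(j < 2 ^ k) nrm z); last first.
    by rewrite sumr_const card_ord mulr_natl.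
  apply: le_trans (nrm_sum _ _ _) _.
  apply: ler_sum => j _; apply: le_trans (nrmM _ _) _; rewrite nrm_star.
  have := nrmM (v j) z; have := vn j; have := nrm_ge0 (v j); have := nrm_ge0 z.
  have := nrm_ge0 (v j * z); nra.
have -> : z - \sum_(j < 2 ^ k) v j * z * star (v j)
    = \sum_(j < 2 ^ k) (star (y j) * y j - y j * star (y j)).
  rewrite sumrB; congr (_ - _).
    rewrite -{1}zz -{1}(sqa_fixr pz zp) pE mulr_sumr mulr_suml; apply: eq_bigr => j _.
    by rewrite /y starM sz !mulrA.
  by apply: eq_bigr => j _; rewrite /y starM sz -{1}zz !mulrA.
rewrite -[X in csum X]muln1; apply: csum_sum => // j; apply: csum1.
- by rewrite /y mulrA fv.
- by rewrite /y -mulrA sqa_fixr.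
have sn : nrm (sqa z) <= c.
  by have := nrm_sqa pz; have := nrm_ge0 (sqa z); nra.
apply: le_trans (nrmM _ _) _; have := vn j; have := nrm_ge0 (v j).
by have := nrm_ge0 (sqa z); nra.
Qed.

(** Greedy choice: [s k] is the part of q already used, and the trace condition leaves enough room
    for [p k] in q - [s k]. *)
Lemma packing (p : nat -> A) q : (forall k, proj (p k)) -> proj q ->
  (forall k i, \sum_(j < k.+1) tr i (p j) < tr i q) ->
  exists v : nat -> A, [/\ forall k, star (v k) * v k = p k, forall k, q * v k = v k
    & forall k l, k != l -> star (v k) * v l = 0].
Proof.
move=> pp pq h.
(* Choosing by [xget] allows the recursion to be written before existence at each stage is
   proved. *)
pose V p q : A := xget 0 [set v | star v * v = p /\ q * v = v]%classic.
have VP p1 q1 : subeq p1 q1 -> star (V p1 q1) * V p1 q1 = p1 /\ q1 * V p1 q1 = V p1 q1.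
  exact: (@xgetPex _ 0 [set v | star v * v = p1 /\ q1 * v = v]%classic).
pose s := fix s k := if k is k'.+1 then s k' + V (p k') (q - s k') * star (V (p k') (q - s k')) else 0.
pose v k := V (p k) (q - s k).
have sS k : s k.+1 = s k + v k * star (v k) by [].
have inv k : [/\ proj (s k), q * s k = s k, forall i, tr i (s k) = \sum_(j < k) tr i (p j) &
    forall j, (j < k)%N -> s k * v j = v j] /\
    (star (v k) * v k = p k /\ (q - s k) * v k = v k).
  elim: k => [|k [[ps qs ts sv] [vv qv]]].
    split; last first.
      apply: VP; apply: cmp => //.
        by rewrite /= subr0.
      by move=> i; have := h 0%N i; rewrite big_ord1 /= subr0.
    split=> //; [exact: proj0 | by rewrite mulr0 | by move=> i; rewrite big_ord0 (rt0 (htr i))].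
  have pr := isom_range (pp k) vv.
  have sv0 : s k * v k = 0.
    by rewrite -qv mulrA mulrBr (proj_idem ps) (proj_le_comm ps pq qs) subrr mul0r.
  have qvk : q * v k = v k.
    by have := qv; rewrite mulrBl sv0 subr0.
  have ps' : proj (s k.+1) by rewrite sS; apply: projD; rewrite // mulrA sv0 mul0r.
  have qs' : q * s k.+1 = s k.+1 by rewrite sS mulrDr qs mulrA qvk.
  have ts' i : tr i (s k.+1) = \sum_(j < k.+1) tr i (p j).
    by rewrite sS (rtD (htr i)) ts (tr_range _ vv) big_ord_recr.
  split.
    split=> // j; rewrite ltnS leq_eqVlt => /predU1P[->|jk].
      by rewrite sS mulrDl sv0 add0r -mulrA vv isom_fix.
    have vs : star (v k) * s k = 0 by rewrite -(proj_sa ps) -starM sv0 star0.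
    by rewrite sS mulrDl sv // -(sv j jk) -mulrA (mulrA (star _)) vs mul0r mulr0 addr0.
  apply: VP; apply: cmp => //; first exact: projB.
  move=> i; rewrite (rtB (htr i)) ts'; have := h k.+1 i; rewrite big_ord_recr /=; lra.
exists v; split.
- by move=> k; case: (inv k) => _ [].
- move=> k; have [[ps qs _ _] [_ <-]] := inv k; rewrite mulrA mulrBr qs proj_idem //.
have lt k l : (k < l)%N -> star (v k) * v l = 0.
  move=> kl; have [[ps qs _ sv] [_ <-]] := inv l.
  rewrite -(sv k kl) starM (proj_sa ps) -mulrA (mulrA (s l)) mulrBr (proj_le_comm ps pq qs).
  by rewrite (proj_idem ps) subrr mul0r mulr0.
move=> k l; rewrite neq_ltn => /orP[/lt //|/lt].
by move=> /(congr1 (@star _ _)); rewrite starM starK star0.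
Qed.

End Comparison.

(** * Sums of self-commutators *)

Section Fack.
Context {R : realType} {A : cstarAlgType R}.
Implicit Types (a b d e f g p q r v w x y z : A) (c : R).
Notation proj := (projection A).
Variables (n : nat) (tr : 'I_n -> A -> R).
Hypothesis htr : forall i, rtrace (tr i).
Hypothesis rr : rr0 (A := A).
Hypothesis cmp : forall p q, proj p -> proj q -> (forall i, tr i p < tr i q) -> subeq p q.
Hypothesis gen1 : forall g, proj g -> g <> 0 ->
  exists (m : nat) (x y : nat -> A), 1 = \sum_(j < m) x j * g * y j.
Hypothesis small : forall c, 0 < c -> exists g, [/\ proj g, g <> 0 & forall i, tr i g <= c].

Lemma isom_sum K (p v : nat -> A) : (forall j, (j < K)%N -> proj (p j) /\ star (v j) * v j = p j) ->
  (forall j k, (j < K)%N -> (k < K)%N -> j != k -> star (v j) * v k = 0) ->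
  let e := \sum_(j < K) v j * star (v j) in
  [/\ proj e, forall j, (j < K)%N -> e * v j = v j,
      forall i, tr i e = \sum_(j < K) tr i (p j)
    & forall q, (forall j, (j < K)%N -> q * v j = v j) -> q * e = e].
Proof.
move=> hv orth e.
have ev j : (j < K)%N -> e * v j = v j.
  move=> jK; rewrite /e mulr_suml (bigD1 (Ordinal jK)) //= big1 ?addr0.
    by rewrite -mulrA (hv j jK).2 (isom_fix (hv j jK).1 (hv j jK).2).
  move=> k; rewrite -(inj_eq val_inj) /= => kj.
  by rewrite -mulrA orth // mulr0.
have qe q : (forall j, (j < K)%N -> q * v j = v j) -> q * e = e.
  by move=> h; rewrite /e mulr_sumr; apply: eq_bigr => j _; rewrite mulrA h.
split=> //; last by move=> i; rewrite (rt_sum (htr i)); apply: eq_bigr => j _; exact: tr_range (hv j _).2.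
split; last exact: qe.
by rewrite /e star_sum; apply: eq_bigr => j _; rewrite starM starK.
Qed.

(** The difference is the self-commutator of v z^(1/2). *)
Lemma isom_push v f z : proj f -> star v * v = f -> pos z -> f * z = z -> nrm z <= 1 ->
  [/\ pos (v * z * star v), nrm (v * z * star v) <= nrm z &
   forall e, e * v = v -> csum 1 1 f e (z - v * z * star v)].
Proof.
move=> pf vv pz fz z1; have vn := isom_nrm pf vv; have z0 := nrm_ge0 z.
split; first exact: pos_conjr.
  have := nrmM (v * z) (star v); have := nrmM v z; rewrite nrm_star => h1 h2.
  have := nrm_ge0 v; have := nrm_ge0 (v * z); nra.
move=> e ev; have sz := sqa_sa pz; have zz := sqa_sq pz.
have zf : z * f = z by apply: sa_fix_comm => //; exact: pos_sa.
have vf := isom_fix pf vv.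
have -> : z - v * z * star v = star (v * sqa z) * (v * sqa z) - (v * sqa z) * star (v * sqa z).
  rewrite starM sz; congr (_ - _); last by rewrite -{1}zz !mulrA.
  by rewrite -mulrA (mulrA (star v)) vv (sqa_fix pz fz).
apply: csum1.
- by rewrite mulrA ev.
- by rewrite -mulrA sqa_fixr.
apply: le_trans (nrmM _ _) _; have := nrm_sqa pz; have := nrm_ge0 (sqa z); have := nrm_ge0 v.
by nra.
Qed.

(** Numbers of self-commutators in one step: 2 L for the [chi j], L for the copies of f and one for
    the error; on the way down, three compressions with 2^4 terms each. *)
Definition fack_up (L : nat) := (2 * L + L + 1)%N.
Definition fack_down := (2 ^ 4 + 2 ^ 4 + 2 ^ 4)%N.

(* Up to an error of norm [1 / L] one has [d = 2 x - f] with [x] the mean of [2 L]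
   subprojections [chi j] of [f]. The [chi j] are packed into [L + 1] orthogonal copies of
   [f] and [f] itself is moved to [L] of these copies; since [d] is traceless, what is left
   has norm at most [2 / L] and the trace of at most [3] copies of [f], so that it can be
   compressed by comparison into [f'], its norm growing at most by the factor [16].
   The constant [400] ensures [3 * 16 * (2 / L) <= 1 / 4]. *)
Lemma fack_step L f f' (V : nat -> A) d : (400 <= L)%N ->
  proj f -> f <> 0 -> proj f' ->
  (forall j, (j < L.+2)%N -> star (V j) * V j = f) ->
  (forall j k, (j < L.+2)%N -> (k < L.+2)%N -> j != k -> star (V j) * V k = 0) ->
  (forall i, tr i f < 4 * tr i f') ->
  star d = d -> f * d = d -> (forall i, tr i d = 0) -> nrm d <= 1 ->
  let E := \sum_(j < L.+2) V j * star (V j) in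
  exists u d', [/\ csum (fack_up L) 1 f E (d - u), csum fack_down 1 E f' (u - d'),
    star d' = d', f' * d' = d' & nrm d' <= 4^-1].
Proof.
move=> hL pf f0 pf' VV Vo hf sd fd td dn E.
have fi := proj_idem pf; have df := sa_fix_comm pf sd fd.
have Lr : 400 <= L%:R :> R by rewrite (ler_nat R 400 L).
have L0 : 0 < L%:R :> R by lra.
have Ln : L%:R != 0 :> R by rewrite gt_eqF.
have LnC : L%:R%:C != 0 :> R[i] by rewrite (fmorph_eq0 (real_complex R)).
pose x := (2^-1)%:C *: (d + f).
have px : pos x.
  apply: posZ; first by rewrite invr_ge0.
  have := proj_conj pf (ge_nrm_add_pos sd dn); congr pos.
  by rewrite scale1r mulrDr mulr1 fd mulrDl fi df addrC.
have px1 : pos (1 - x).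
  have i2 : 0 <= 2^-1 :> R by rewrite invr_ge0.
  have h1 := posZ i2 (proj_conj pf (ge_nrm_sub_pos sd dn)).
  have := posD (proj_compl_pos pf) h1; congr pos.
  by rewrite scale1r mulrBr mulr1 fd mulrBl fi df /x; nc.
have fx : f * x = x by rewrite -scalerAr mulrDr fd fi.
have L2 : (0 < 2 * L)%N by rewrite muln_gt0 /=; apply: leq_trans hL.
have [chi [pchi fchi pe pe']] := proj_approx rr L2 px px1.
set err := x - _ in pe pe'.
have fchi' := fchi f fx.
have ferr : f * err = err.
  rewrite mulrBr fx -scalerAr mulr_sumr; congr (_ - _ *: _); apply: eq_bigr => j _; exact: fchi'.
have nerr : nrm err <= L%:R^-1.
  apply: le_trans (pos_le_nrm pe pe') _; rewrite natrM.
  by rewrite (_ : 2 / _ = L%:R^-1) //; field.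
have VVp j : (j < L.+2)%N -> proj f /\ star (V j) * V j = f by move=> jL; split; [| exact: VV].
pose Z := \sum_(j < L.+1) V j * star (V j).
have [pZ ZV tZ qZ] := @isom_sum L.+1 (fun=> f) V (fun j jL => VVp j (ltnW jL))
  (fun j k jL kL => Vo j k (ltnW jL) (ltnW kL)).
have [pE EV tE qE] := @isom_sum L.+2 (fun=> f) V VVp Vo.
rewrite -/Z in pZ ZV tZ qZ; rewrite -/E in pE EV tE qE.
have EZ : E * Z = Z by apply: qZ => j jL; apply: EV; exact: ltnW.
(* [packing] takes an infinite sequence, so the finite one is padded with 0. *)
pose p j := if (j < 2 * L)%N then chi j else 0.
have pp j : proj (p j) by rewrite /p; case: ifP => // _; exact: proj0.
have fp0 i : 0 < tr i f by apply: (tr_gt0 htr gen1).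
have tx i : tr i x = 2^-1 * tr i f by rewrite (rtZ (htr i)) (rtD (htr i)) td add0r.
have terr i : 0 <= tr i err <= L%:R^-1 * tr i f.
  apply/andP; split; first exact: (rt_ge0 (htr i)).
  have := rt_corner (htr i) pf (pos_sa pe) ferr; have := fp0 i.
  by have := ler_norm (tr i err); have := nrm_ge0 err; nra.
have tchi i : \sum_(j < 2 * L) tr i (chi j) = L%:R * tr i f - 2 * L%:R * tr i err.
  have -> : tr i err = 2^-1 * tr i f - (2 * L%:R)^-1 * \sum_(j < 2 * L) tr i (chi j).
    by rewrite (rtB (htr i)) tx [X in _ - X](rtZ (htr i)) (rt_sum (htr i)) natrM.
  by field.
have tZ' i : tr i Z = L%:R * tr i f + tr i f.
  by rewrite tZ big_ord_recr /= sumr_const card_ord mulr_natl.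
have hpack k i : \sum_(j < k.+1) tr i (p j) < tr i Z.
  rewrite tZ'.
  apply: (@le_lt_trans _ _ (\sum_(j < 2 * L) tr i (chi j))).
    apply: (@le_trans _ _ (\sum_(j < (k.+1 + 2 * L)) tr i (p j))).
      by rewrite big_split_ord /= lerDl sumr_ge0 // => j _; exact: (rt_proj_ge0 (htr i)).
    rewrite addnC big_split_ord /= [X in _ + X]big1 ?addr0.
      by rewrite le_eqVlt; apply/orP; left; apply/eqP/eq_bigr => j _; rewrite /p ltn_ord.
    by move=> j _; rewrite /p ltnNge leq_addr /= (rt0 (htr i)).
  have /andP[h1 h2] := terr i; rewrite tchi; have := fp0 i.
  by have := mulr_ge0 (ltW L0) h1; lra.
have [w [ww Zw wo]] := packing htr cmp pp pZ hpack.
have wchi j : (j < 2 * L)%N -> proj (chi j) /\ star (w j) * w j = chi j.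
  by move=> jL; split=> //; rewrite ww /p jL.
pose X := \sum_(j < 2 * L) w j * star (w j).
have [pX Xw tX qX] := @isom_sum (2 * L) chi w wchi (fun j k _ _ => wo j k).
rewrite -/X in pX Xw tX qX.
have ZX : Z * X = X by apply: qX => j _; exact: Zw.
pose U := Z - X; have pU : proj U := projB pX pZ ZX.
(* Roles of the L + 2 copies: the [chi j] are packed into the first L + 1, with sum Z, leaving U
   free; f is moved onto the first L of these, so that W is the one left over; S receives the
   error. *)
pose W := V L * star (V L); pose S := V L.+1 * star (V L.+1).
have pW : proj W := isom_range pf (VV L (ltnW (ltnSn _))).
have pS : proj S := isom_range pf (VV L.+1 (ltnSn _)).
have EW : E * W = W by rewrite /W mulrA EV.
have ES : E * S = S by rewrite /S mulrA EV.
have EU : E * U = U by rewrite /U mulrBr EZ -{1}ZX mulrA EZ ZX.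
pose Y := \sum_(j < L) V j * star (V j).
have ZYW : Z = Y + W by rewrite /Z big_ord_recr.
have tW i : tr i W = tr i f by apply: tr_range => //; apply: VV.
have tS i : tr i S = tr i f by apply: tr_range => //; apply: VV.
have tU i : tr i U <= 3 * tr i f.
  rewrite (rtB (htr i)) tX tchi tZ'.
  have /andP[h1 h2] := terr i.
  have : L%:R * tr i err <= tr i f.
    by have := ler_wpM2l (ltW L0) h2; rewrite mulrA mulfV // mul1r.
  by lra.
pose e1 := V L.+1 * (2%:C *: err) * star (V L.+1).
have pe2 : pos (2%:C *: err) by apply: posZ.
have fe2 : f * (2%:C *: err) = 2%:C *: err by rewrite -scalerAr ferr.
have ne2 : nrm (2%:C *: err) <= 2 / L%:R by rewrite nrmZ ger0_norm // ler_pM2l.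
have Li : L%:R^-1 <= 400^-1 :> R by rewrite lef_pV2 ?posrE.
have [pe1 ne1 ce1] := isom_push pf (VV L.+1 (ltnSn _)) pe2 fe2 ltac:(lra).
rewrite -/e1 in pe1 ne1 ce1.
(* Moving the pieces turns d into (X - Y)/L + e1, and X - Y = W - U. *)
pose u := (L%:R^-1)%:C *: W - (L%:R^-1)%:C *: U + e1.
have dE : d - u = \sum_(j < 2 * L) ((L%:R^-1)%:C *: (chi j - w j * star (w j)))
    - \sum_(j < L) ((L%:R^-1)%:C *: (f - V j * star (V j))) + (2%:C *: err - e1).
  rewrite -!scaler_sumr !sumrB -/X -/Y sumr_const card_ord -scaler_nat.
  have dx : d = 2%:C *: x - f by rewrite /x; nc.
  have xE : \sum_(j < 2 * L) chi j = (2 * L%:R)%:C *: (x - err).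
    rewrite /err opprB addrC subrK scalerA -rmorphM natrM mulfV ?scale1r //.
    by rewrite mulf_neq0 // pnatr_eq0.
  rewrite xE {1}dx /u /U ZYW -(rmorph_nat (real_complex R)).
  by move: (L%:R : R) Ln LnC => ell l0 l0C; nc.
have sq : (Num.sqrt L%:R^-1) ^+ 2 = L%:R^-1 :> R by rewrite sqr_sqrtr // invr_ge0 ltW.
have sq0 : 0 <= Num.sqrt L%:R^-1 :> R by rewrite sqrtr_ge0.
have sq1 : Num.sqrt L%:R^-1 <= 1 :> R by nra.
have piece v g : proj g -> g * f = g -> star v * v = g -> E * v = v ->
    csum 1 1 f E ((L%:R^-1)%:C *: (g - v * star v)).
  move=> pg gf vv Ev; have vg := isom_fix pg vv.
  have -> : (L%:R^-1)%:C *: (g - v * star v)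
    = star ((Num.sqrt L%:R^-1)%:C *: v) * ((Num.sqrt L%:R^-1)%:C *: v)
      - ((Num.sqrt L%:R^-1)%:C *: v) * star ((Num.sqrt L%:R^-1)%:C *: v).
    by rewrite star_realZ -vv -{1}sq expr2 rmorphM; nc.
  apply: csum1.
  - by rewrite -scalerAr Ev.
  - by rewrite -scalerAl -vg -mulrA gf.
  - by rewrite nrmZ ger0_norm //; have := isom_nrm pg vv; have := nrm_ge0 v; nra.
have chif j : chi j * f = chi j by apply: sa_fix_comm => //; exact: proj_sa.
have up : csum (fack_up L) 1 f E (d - u).
  rewrite dE; apply: csumD; last by apply: ce1; exact: EV.
  apply: csumB.
    rewrite -[X in csum X]muln1; apply: csum_sum => // j; apply: piece => //.
      exact: (wchi j (ltn_ord j)).2.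
    by rewrite -Zw mulrA EZ.
  rewrite -[X in csum X]muln1; apply: csum_sum => // j; apply: piece => //.
    by apply: VV; apply: leq_trans (ltn_ord j) _; rewrite -addn2 leq_addr.
  by apply: EV; apply: leq_trans (ltn_ord j) _; rewrite -addn2 leq_addr.
have squeeze S' z : proj S' -> E * S' = S' -> (forall i, tr i S' <= 3 * tr i f) -> pos z ->
    S' * z = z -> nrm z <= 2 / L%:R ->
    exists z', [/\ pos z', f' * z' = z', nrm z' <= 16 * (2 / L%:R) & csum (2 ^ 4) 1 E f' (z - z')].
  move=> pS' ES' tS' pz Sz nz.
  (* Three copies of f have trace below 12 times that of f', so four halvings suffice. *)
  have h16 i : tr i S' < 2 ^+ 4 * tr i f'.
    by have := tS' i; have := hf i; have := fp0 i; lra.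
  have nz1 : nrm z <= 1 ^+ 2 by rewrite expr1n; lra.
  have [z' [pz' fz' nz' cz']] := compress_csum htr rr cmp gen1 small pS' pf' h16 pz Sz ler01 nz1.
  exists z'; split=> //.
    by apply: le_trans nz' _; rewrite ler_pM2l // (ltr_nat R 0 16).
  by apply: csum_sub cz'; rewrite // proj_idem.
have Lip : 0 <= L%:R^-1 :> R by rewrite invr_ge0 ltW.
have nL g : proj g -> nrm ((L%:R^-1)%:C *: g) <= 2 / L%:R.
  by move=> pg; rewrite nrmZ ger0_norm //; have := proj_nrm pg; nra.
have [w1 [pw1 fw1 nw1 cw1]] := squeeze W ((L%:R^-1)%:C *: W) pW EW
  (fun i => ltac:(by rewrite tW; have := fp0 i; lra)) (posZ Lip (proj_pos pW))
  ltac:(by rewrite -scalerAr proj_idem) (nL W pW).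
have [w2 [pw2 fw2 nw2 cw2]] := squeeze U ((L%:R^-1)%:C *: U) pU EU tU
  (posZ Lip (proj_pos pU)) ltac:(by rewrite -scalerAr proj_idem) (nL U pU).
have Se1 : S * e1 = e1.
  rewrite /S /e1 !mulrA -(mulrA (V L.+1) (star _)) VV // (isom_fix pf) //.
  by apply: VV.
have [w3 [pw3 fw3 nw3 cw3]] := squeeze S e1 pS ES
  (fun i => ltac:(by rewrite tS; have := fp0 i; lra)) pe1 Se1 (le_trans ne1 ne2).
exists u, (w1 - w2 + w3); split=> //.
- rewrite (_ : u - _ = ((L%:R^-1)%:C *: W - w1) - ((L%:R^-1)%:C *: U - w2) + (e1 - w3)); last first.
    by rewrite /u; nc.
  by apply: csumD => //; apply: csumB.
- by rewrite starD starB !pos_sa.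
- by rewrite mulrDr mulrBr fw1 fw2 fw3.
have := nrmD (w1 - w2) w3; have := nrmB w1 w2.
lra.
Qed.

End Fack.

(** * Iteration of the reduction, and traceless elements of a corner *)

Section FackSeries.
Context {R : realType} {A : cstarAlgType R}.
Implicit Types (a b e g p q r v x y z : A) (c : R).
Notation proj := (projection A).
Local Notation pcp := (@positive_combination_of_projections R A).
Variables (n : nat) (tr : 'I_n -> A -> R).
Hypothesis htr : forall i, rtrace (tr i).
Hypothesis rr : rr0 (A := A).
Hypothesis cmp : forall p q, proj p -> proj q -> (forall i, tr i p < tr i q) -> subeq p q.
Hypothesis gen1 : forall g, proj g -> g <> 0 ->
  exists (m : nat) (x y : nat -> A), 1 = \sum_(j < m) x j * g * y j.
Hypothesis small : forall c, 0 < c -> exists g, [/\ proj g, g <> 0 & forall i, tr i g <= c].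

(** In stage k the residue, of norm at most 4^-k and supported on [f k], is moved up into [E k] and
    down into [f k.+1] by self-commutators of elements of size at most 2^-k. Both families of
    supports are orthogonal, so [csum_series] merges all stages. *)
Lemma fack_series L q q' g (f w : nat -> A) (d : A) : (400 <= L)%N ->
  proj q -> proj q' -> proj g ->
  (forall k, [/\ proj (f k), f k <> 0, q' * f k = f k & g * f k = f k]) ->
  (forall k l, k != l -> f k * f l = 0) -> (forall k i, tr i (f k) < 4 * tr i (f k.+1)) ->
  (forall j, (j < L.+2)%N -> star (w j) * w j = g /\ q * w j = w j) ->
  (forall j k, (j < L.+2)%N -> (k < L.+2)%N -> j != k -> star (w j) * w k = 0) ->
  star d = d -> f 0%N * d = d -> (forall i, tr i d = 0) -> nrm d <= 1 ->
  exists s t, [/\ d = s + t, csum (fack_up L) 2 q' q s & csum fack_down 2 q q' t].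
Proof.
move=> hL pq pq' pg hf fo hf4 hw wo sd fd td dn.
pose V k l := w l * f k; pose E k := \sum_(j < L.+2) V k j * star (V k j).
have pf k : proj (f k) by case: (hf k).
have fi k : f k * f k = f k := proj_idem (pf k).
have VV k j l : (j < L.+2)%N -> star (V k j) * V l j = f k * f l.
  move=> jL; have [_ _ _ gf] := hf l.
  by rewrite /V starM (proj_sa (pf k)) -mulrA (mulrA (star (w j))) (hw j jL).1 gf.
have Vo k l i j : (i < L.+2)%N -> (j < L.+2)%N -> i != j -> star (V k i) * V l j = 0.
  by move=> iL jL ij; rewrite /V starM -mulrA (mulrA (star (w i))) wo // mul0r mulr0.
have pE k : [/\ proj (E k), q * E k = E k & forall l, k != l -> E k * E l = 0].
  have [p1 p2 _ p3] := @isom_sum _ _ _ _ htr L.+2 (fun=> f k) (V k)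
    (fun j jL => conj (pf k) (etrans (VV k j k jL) (fi k))) (Vo k k).
  split=> //; first by apply: p3 => j jL; rewrite /V mulrA (hw j jL).2.
  move=> l kl; rewrite /E mulr_suml big1 // => i _; rewrite mulr_sumr big1 // => j _.
  rewrite -mulrA (mulrA (star _)).
  have [ij|ij] := eqVneq i j; last by rewrite Vo // mul0r mulr0.
  by rewrite ij VV // fo // mul0r mulr0.
(* The norm bound is a square because scaling the commutators by t scales the element by t^2. *)
pose inv k x := [/\ star x = x, f k * x = x, forall i, tr i x = 0 & nrm x <= (2^-1 ^+ k) ^+ 2].
(* Stated for all pairs, with a dummy value where the invariant fails, so that [choice] applies. *)
have step (kx : nat * A) : exists ud : A * A, inv kx.1 kx.2 ->
    [/\ csum (fack_up L) (1 * 2^-1 ^+ kx.1) (f kx.1) (E kx.1) (kx.2 - ud.1),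
        csum fack_down (1 * 2^-1 ^+ kx.1) (E kx.1) (f kx.1.+1) (ud.1 - ud.2)
      & inv kx.1.+1 ud.2].
  case: kx => k x /=; have [[sx fx tx nx]|ninv] := pselect (inv k x); last first.
    by exists (0, 0) => h; case: ninv.
  pose c : R := 2^-1 ^+ k; have c0 : 0 < c by rewrite exprn_gt0 // invr_gt0.
  pose y := ((c ^+ 2)^-1)%:C *: x.
  have c2 : 0 < c ^+ 2 by rewrite exprn_gt0.
  have [_ f0 _ _] := hf k.
  have [||||||u [y' [h1 h2 sy fy ny]]] := @fack_step _ _ _ _ htr rr cmp gen1 small L (f k) (f k.+1) (V k) y hL (pf k) f0 (pf k.+1) _ _ (hf4 k).
  - by move=> j jL; rewrite VV.
  - exact: Vo.
  - by rewrite star_realZ sx.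
  - by rewrite -scalerAr fx.
  - by move=> i; rewrite (rtZ (htr i)) tx mulr0.
  - by apply: nrmZV; rewrite // mulr1.
  have cy z : (c ^+ 2)%:C *: (y - z) = x - (c ^+ 2)%:C *: z.
    by rewrite scalerBr scalerA -rmorphM mulfV ?gt_eqF // scale1r.
  exists ((c ^+ 2)%:C *: u, (c ^+ 2)%:C *: y') => _ /=.
  have k1 : csum (fack_up L) (1 * c) (f k) (E k) (x - (c ^+ 2)%:C *: u).
    by rewrite -cy mulrC; apply: csumZ => //; exact: ltW.
  have k2 : csum fack_down (1 * c) (E k) (f k.+1) ((c ^+ 2)%:C *: u - (c ^+ 2)%:C *: y').
    by rewrite -scalerBr mulrC; apply: csumZ => //; exact: ltW.
  split=> //; split.
  - by rewrite star_realZ sy.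
  - by rewrite -scalerAr fy.
  - move=> i; have t1 := rt_csum (htr i) k1; have t2 := rt_csum (htr i) k2.
    by move: t1 t2; rewrite !(rtB (htr i)) tx; lra.
  - rewrite nrmZ gtr0_norm // (_ : (2^-1 ^+ k.+1) ^+ 2 = c ^+ 2 * 4^-1).
      by rewrite ler_pM2l.
    by rewrite [_ ^+ k.+1]exprS -/c; field.
have [S hS] := choice step.
pose D := fix D k := if k is k'.+1 then (S (k', D k')).2 else d.
have hD k : inv k (D k).
  elim: k => [|k ih]; first by split; rewrite ?expr0 ?expr1n.
  by have [] := hS (k, D k) ih.
have h1 k := let: And3 h _ _ := hS (k, D k) (hD k) in h.
have h2 k := let: And3 _ h _ := hS (k, D k) (hD k) in h.
have [s [cs ts]] := @csum_series _ _ (fack_up L) 1 q' q f E (fun k => D k - (S (k, D k)).1)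
  ler01 (fun k => conj (pf k) (let: And3 h _ _ := pE k in h))
  (fun k l kl => conj (fo k l kl) (let: And3 _ _ h := pE k in h l kl))
  (fun k => conj (let: And4 _ _ h _ := hf k in h) (let: And3 _ h _ := pE k in h)) pq' h1.
have [t [ct tt]] := @csum_series _ _ fack_down 1 q q' E (fun k => f k.+1) (fun k => (S (k, D k)).1 - D k.+1)
  ler01 (fun k => conj (let: And3 h _ _ := pE k in h) (pf k.+1))
  (fun k l kl => conj (let: And3 _ _ h := pE k in h l kl) (fo k.+1 l.+1 ltac:(by rewrite eqSS)))
  (fun k => conj (let: And3 _ h _ := pE k in h) (let: And4 _ _ h _ := hf k.+1 in h)) pq h2.
exists s, t; rewrite mulr1 in cs ct; split=> //.
have tD : tends D 0.
  have hb k : nrm (D k) <= 1 * 2^-1 ^+ k.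
    have [_ _ _ nD] := hD k; apply: le_trans nD _; rewrite mul1r expr2.
    have k0 : 0 <= (2^-1 : R) ^+ k by rewrite exprn_ge0 // invr_ge0.
    have k1 : (2^-1 : R) ^+ k <= 1 by rewrite exprn_ile1 ?invr_ge0 // invf_le1 ?ler1n.
    by nra.
  have [X [hX _]] := geometric_cvg ler01 hb.
  have := tendsB (tends_shift 1 hX) hX; rewrite subrr; apply: tends_eq => m.
  by rewrite addn1 big_ord_recr /= [X in X - _]addrC addrK.
apply: (tends_uniq _ (tendsD ts tt)).
have := tendsB (tends_cst d) tD; rewrite subr0; apply: tends_eq => m.
rewrite -big_split /=; elim: m => [|m ih]; first by rewrite big_ord0 subrr.
by rewrite big_ord_recr /= -ih; nc.
Qed.

(** By [ssum_proj], p is an orthogonal sum of pieces subequivalent to a small projection; any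
    nonzero piece serves. *)
Lemma small_sub p c : proj p -> p <> 0 -> 0 < c ->
  exists g, [/\ proj g, g <> 0, p * g = g & forall i, tr i g <= c].
Proof.
move=> pp p0 c0; have [g [pg g0 gc]] := small c0.
have := ssum_proj rr gen1 pg g0 pp; move: p0 => /[swap]; elim=> [//|q r sq ih pq pr rq rg qr0].
have qr : q * r = 0 by rewrite -(proj_sa pq) -(proj_sa pr) -starM rq star0.
have [r0|r0] := pselect (r = 0).
  have [|g' [h1 h2 h3 h4]] := ih; first by move: qr0; rewrite r0 addr0.
  by exists g'; split=> //; rewrite r0 addr0.
exists r; split=> //; first by rewrite mulrDl qr add0r proj_idem.
by move=> i; apply: le_trans (gc i); apply: (tr_subeq htr).
Qed.

Lemma ex_pow_bound (a b : 'I_n -> R) : (forall i, 0 < b i) -> exists k, forall i, a i < 2 ^+ k * b i.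
Proof.
move=> b0.
have c0 i : 0 < b i / (`|a i| + 1) by apply: divr_gt0 => //; have := normr_ge0 (a i); lra.
have [e e0 he] := ex_lower_bound c0.
have [k hk] : exists k, e^-1 < 2 ^+ k.
  exists (Num.truncn e^-1).+1; apply: lt_trans (truncnS_gt _) _.
  by rewrite -natrX ltr_nat ltn_expl.
exists k => i; have := he i; rewrite ltr_pdivlMr; last by have := normr_ge0 (a i); lra.
have := ler_norm (a i); have : 1 < 2 ^+ k * e by rewrite -ltr_pdivrMr // div1r.
move: (2 ^+ k) => K hK ha h1.
have K0 : 0 < K by have := b0 i; nra.
have := normr_ge0 (a i) => na.
have : K * (e * (`|a i| + 1)) < K * b i by rewrite ltr_pM2l.
have : (`|a i| + 1) < K * e * (`|a i| + 1) by rewrite ltr_pMl; lra.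
by lra.
Qed.

Variable i0 : 'I_n.

Lemma half_proj p : proj p -> p <> 0 -> exists p', [/\ proj p', p * p' = p', p' <> 0, p - p' <> 0 &
  forall i, 2 / 5 * tr i p < tr i p' < 3 / 5 * tr i p].
Proof.
move=> pp p0; have tp i := tr_gt0 htr gen1 i pp p0.
(* An imbalance below one fifth of the trace leaves between 2/5 and 3/5 of it on either side. *)
have t0 i : 0 < 1 / 5 * tr i p by have := tp i; lra.
have [e e0 he] := ex_lower_bound t0.
have [p' [pp' h1 h2]] := halving htr rr gen1 small pp e0.
have bd i : 2 / 5 * tr i p < tr i p' < 3 / 5 * tr i p.
  have := h2 i; have := he i; rewrite (rtB (htr i)) ltr_norml => h3 /andP[h4 h5].
  by apply/andP; split; lra.
exists p'; split=> // h.
  by have := bd i0; rewrite h (rt0 (htr i0)) => /andP[]; have := tp i0; lra.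
have := congr1 (tr i0) h; rewrite (rtB (htr i0)) (rt0 (htr i0)).
by have /andP[] := bd i0; have := tp i0; lra.
Qed.

(** The projection g under r - q is so small that K orthogonal copies of it fit into q; the [f k]
    are the successive differences of a chain obtained from g by repeated halving. *)
Lemma fack_geometry K r : proj r -> r <> 0 -> exists q g (f w : nat -> A),
  [/\ [/\ proj q, r * q = q, q <> 0, r - q <> 0 & proj g],
    forall k, [/\ proj (f k), f k <> 0, (r - q) * f k = f k & g * f k = f k],
    forall k l, k != l -> f k * f l = 0,
    forall k i, tr i (f k) < 4 * tr i (f k.+1)
  & (forall j, (j < K)%N -> star (w j) * w j = g /\ q * w j = w j) /\
    (forall j k, (j < K)%N -> (k < K)%N -> j != k -> star (w j) * w k = 0)].
Proof.
move=> pr r0; have [q [pq rq q0 q'0 _]] := half_proj pr r0.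
have pq' := projB pq pr rq.
have [e e0 he] := ex_lower_bound (fun i => tr_gt0 htr gen1 i pq q0).
have K0 : 0 < K%:R + 1 :> R by rewrite ltr_wpDl // ler0n.
have [g [pg g0 q'g gc]] := small_sub pq' q'0 (divr_gt0 e0 K0).
pose p j := if (j < K)%N then g else 0.
have pp j : proj (p j) by rewrite /p; case: ifP => // _; exact: proj0.
have hp k i : \sum_(j < k.+1) tr i (p j) < tr i q.
  apply: le_lt_trans (he i).
  apply: (@le_trans _ _ (\sum_(j < (k.+1 + K)) tr i (p j))).
    by rewrite big_split_ord /= lerDl sumr_ge0 // => j _; exact: (rt_proj_ge0 (htr i)).
  rewrite addnC big_split_ord /= [X in _ + X]big1 ?addr0; last first.
    by move=> j _; rewrite /p ltnNge leq_addr /= (rt0 (htr i)).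
  rewrite (eq_bigr (fun=> tr i g)); last by move=> j _; rewrite /p ltn_ord.
  rewrite sumr_const card_ord -mulr_natl.
  have := ler_wpM2l (ltW K0) (gc i); rewrite [X in _ <= X]mulrC divfK ?gt_eqF //.
  by have := rt_proj_ge0 (htr i) pg; lra.
have [w [ww qw wo]] := packing htr cmp pp pq hp.
have hH (x : A) : exists y, proj x -> x <> 0 -> [/\ proj y, x * y = y, y <> 0, x - y <> 0 &
    forall i, 2 / 5 * tr i x < tr i y < 3 / 5 * tr i x].
  have [[px x0]|nx] := pselect (proj x /\ x <> 0).
    by have [y hy] := half_proj px x0; exists y.
  by exists 0 => px x0; case: nx.
have [H hHP] := choice hH.
pose G k := iter k H g.
have hG k : proj (G k) /\ G k <> 0.
  elim: k => [//|k [ih1 ih2]]; have [h1 _ h2 _ _] := hHP _ ih1 ih2.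
  by split; rewrite /G iterS.
have GS k : [/\ proj (G k.+1), G k * G k.+1 = G k.+1, G k.+1 <> 0, G k - G k.+1 <> 0 &
    forall i, 2 / 5 * tr i (G k) < tr i (G k.+1) < 3 / 5 * tr i (G k)].
  by rewrite /G iterS; apply: hHP; case: (hG k).
have Gle k d : G k * G (k + d)%N = G (k + d)%N.
  elim: d => [|d ih]; first by rewrite addn0 proj_idem //; case: (hG k).
  by rewrite addnS; have [_ <- _ _ _] := GS (k + d)%N; rewrite mulrA ih.
pose f k := G k - G k.+1.
have pf k : proj (f k) by have [h1 h2 _ _ _] := GS k; apply: projB => //; case: (hG k).
have gG k : g * G k = G k by have := Gle 0%N k; rewrite add0n.
have flt k l : (k < l)%N -> f k * f l = 0.
  move=> kl; have Gf : G k.+1 * f l = f l.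
    rewrite /f mulrBr -(subnKC kl) -addnS !Gle //.
  rewrite -Gf mulrA mulrBl; have [h1 h2 _ _ _] := GS k.
  by rewrite h2 proj_idem // subrr mul0r.
exists q, g, f, w; split=> //.
- move=> k; split=> //; first by case: (GS k).
    by rewrite /f mulrBr -(gG k) -(gG k.+1) !mulrA q'g.
  by rewrite /f mulrBr !gG.
- move=> k l; rewrite neq_ltn => /orP[/flt //|/flt h].
  by rewrite -(proj_sa (pf k)) -(proj_sa (pf l)) -starM h star0.
(* The trace of [f k] is below 3/5 of that of [G k], and the trace of [f k.+1] is above (2/5)^2 of
   it; 4 * 4/25 = 16/25 exceeds 3/5. *)
- move=> k i; rewrite /f !(rtB (htr i)).
  have [_ _ _ _ /(_ i) /andP[h1 h2]] := GS k; have [_ _ _ _ /(_ i) /andP[h3 h4]] := GS k.+1.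
  by lra.
split=> [j jK|j k _ _]; last exact: wo.
by rewrite ww qw /p jK.
Qed.

(** [compress_csum] is applied to the positive elements z + m p and m p. *)
Lemma compress_sa k p f z m : proj p -> proj f -> (forall i, tr i p < 2 ^+ k * tr i f) ->
  star z = z -> p * z = z -> 1 <= m -> nrm z <= m ->
  exists z', [/\ star z' = z', f * z' = z', nrm z' <= (2 ^ k)%:R * (3 * m)
    & csum (2 ^ k + 2 ^ k) (2 * m) p f (z - z')].
Proof.
move=> pp pf h sz pz m1 zm; have zp := sa_fix_comm pp sz pz; have pi := proj_idem pp.
have m0 : 0 <= m by lra. have m2 : 0 <= 2 * m by lra.
pose z1 := z + m%:C *: p; pose z2 := m%:C *: p.
have p1 : pos z1.
  have := proj_conj pp (ge_nrm_add_pos sz zm); congr pos.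
  by rewrite mulrDr pz mulrDl zp -scalerAr mulr1 -scalerAl pi addrC.
have p2 : pos z2 by apply: posZ => //; exact: proj_pos.
have n2 : nrm z2 <= m by rewrite nrmZ ger0_norm //; have := proj_nrm pp; nra.
have n1 : nrm z1 <= 2 * m by have := nrmD z z2; rewrite -/z1; lra.
have [w1 [pw1 fw1 nw1 cw1]] := compress_csum htr rr cmp gen1 small pp pf h p1
  ltac:(by rewrite mulrDr pz -scalerAr pi) m2 ltac:(by nra).
have [w2 [pw2 fw2 nw2 cw2]] := compress_csum htr rr cmp gen1 small pp pf h p2
  ltac:(by rewrite -scalerAr pi) m2 ltac:(by nra).
exists (w1 - w2); split.
- by rewrite starB !pos_sa.
- by rewrite mulrBr fw1 fw2.
- have k0 : 0 <= (2 ^ k)%:R :> R by rewrite ler0n.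
  have := nrmB w1 w2; have := ler_wpM2l k0 n1; have := ler_wpM2l k0 n2; lra.
rewrite (_ : z - _ = (z1 - w1) - (z2 - w2)); first exact: csumB.
by rewrite /z1 /z2; nc.
Qed.

(** Split b along q and r - q. [pcp_offdiag] handles the off-diagonal part. The corner of r - q is
    compressed into q, and the result together with q b q into [f 0], where [fack_series] applies
    because compression preserves traces. Each stage costs a multiple of r. *)
Lemma interior_traceless r : proj r -> r <> 0 -> exists V : R, forall b, star b = b ->
  r * b = b -> (forall i, tr i b = 0) -> nrm b <= 1 -> pcp (b + V%:C *: r).
Proof.
(* [L] is kept abstract, lest the unary numeral be computed with. *)
move=> pr r0; have [L hL] : exists L, (400 <= L)%N by exists 400%N.
have [q [g [f [w [[pq rq q0 q'0 pg] hf fo f4 [hw wo]]]]]] := fack_geometry L.+2 pr r0.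
have pq' := projB pq pr rq; set q' := r - q in q'0 pq' hf.
have [pf f00 q'f _] := hf 0%N.
have qr := proj_le_comm pq pr rq.
have q'q : q' * q = 0 by rewrite mulrBl rq proj_idem // subrr.
have qq' : q * q' = 0 by rewrite mulrBr qr proj_idem // subrr.
have rq' : r * q' = q' by rewrite mulrBr rq proj_idem.
have qD : q' + q = r by rewrite subrK.
have [k1 hk1] := ex_pow_bound (fun i => tr i q') (fun i => tr_gt0 htr gen1 i pq q0).
have [k2 hk2] := ex_pow_bound (fun i => tr i q) (fun i => tr_gt0 htr gen1 i pf f00).
pose m2 : R := 1 + (2 ^ k1)%:R * (3 * 1); pose m3 : R := (2 ^ k2)%:R * (3 * m2).
have p1 : 1 <= (2 ^ k1)%:R :> R by rewrite (ler_nat R 1) expn_gt0.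
have p2 : 1 <= (2 ^ k2)%:R :> R by rewrite (ler_nat R 1) expn_gt0.
have hm2 : 1 <= m2 by rewrite /m2; lra.
have hm3 : 1 <= m3 by rewrite /m3; nra.
pose V1 := (2 ^ k1 + 2 ^ k1)%:R * (2 * 1) ^+ 2 : R.
pose V2 := (2 ^ k2 + 2 ^ k2)%:R * (2 * m2) ^+ 2 : R.
pose V3 := (fack_up L)%:R * 2 ^+ 2 : R; pose V4 := fack_down%:R * 2 ^+ 2 : R.
(* The 1 pays for the off-diagonal part, [V1] and [V2] for the two compressions, [V3] and [V4] for
   the two series; [m3] undoes the normalization of d. *)
exists (1 + V1 + V2 + m3 * (V3 + V4)) => b sb rb tb nb.
have br := sa_fix_comm pr sb rb.
pose y := q * b * q'.
have sq := proj_sa pq; have sq' := proj_sa pq'.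
have h1 : pcp (r + (y + star y)).
  have i2 : 0 <= 2^-1 :> R by rewrite invr_ge0.
  have qy : q * y = y by rewrite /y !mulrA proj_idem.
  have yq : y * q = 0 by rewrite /y -mulrA q'q mulr0.
  have yr : y * r = y by rewrite /y -mulrA (proj_le_comm pq' pr rq').
  have yn : nrm y <= 1.
    have := nrmM (q * b) q'; have := nrmM q b; have := proj_nrm pq; have := proj_nrm pq'.
    have := nrm_ge0 q; have := nrm_ge0 q'; have := nrm_ge0 b; have := nrm_ge0 (q * b).
    by rewrite -/y; nra.
  have := @pcp_offdiag _ _ r q ((2^-1)%:C *: y) pr pq rq.
  rewrite -scalerAr qy -!scalerAl yq yr scaler0 nrmZ ger0_norm //.
  move=> /(_ erefl erefl erefl ltac:(lra)); congr pcp.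
  by rewrite star_realZ; nc.
have cn p x : proj p -> nrm (p * x * p) <= nrm x.
  move=> pp; have := nrmM (p * x) p; have := nrmM p x; have := proj_nrm pp.
  by have := nrm_ge0 p; have := nrm_ge0 x; have := nrm_ge0 (p * x); nra.
have csa p x : proj p -> star x = x -> star (p * x * p) = p * x * p.
  by move=> pp sx; rewrite !starM (proj_sa pp) sx mulrA.
have cfix p x : proj p -> p * (p * x * p) = p * x * p by move=> pp; rewrite !mulrA proj_idem.
pose b1 := q' * b * q'.
have [b1' [sb1 fb1 nb1 cb1]] := compress_sa pq' pq hk1 (csa q' b pq' sb) (cfix q' b pq') (lexx _)
  (le_trans (cn _ _ pq') nb).
pose b2 := q * b * q + b1'.
have sb2 : star b2 = b2 by rewrite starD csa // sb1.
have qb2 : q * b2 = b2 by rewrite mulrDr cfix // fb1.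
have nb2 : nrm b2 <= m2 by have := nrmD (q * b * q) b1'; have := cn q b pq; rewrite -/b2 /m2; lra.
have [d [sd fd nd cd]] := compress_sa pq pf hk2 sb2 qb2 hm2 nb2.
have td i : tr i d = 0.
  have t1 := rt_csum (htr i) cb1; have t2 := rt_csum (htr i) cd.
  have ty : tr i y = 0 by rewrite (rtC (htr i)) mulrA q'q mul0r (rt0 (htr i)).
  have bE : b = q * b * q + q' * b * q' + (y + star y).
    rewrite -{1}rb -{1}br -qD /y !starM sq sq' sb; nc.
  have := tb i; rewrite bE !(rtD (htr i)) (rt_star (htr i)) ty.
  by move: t1 t2; rewrite /b2 !(rtB (htr i)) !(rtD (htr i)); lra.
have m30 : 0 < m3 by lra.
have [s [t [dE cs ct]]] := @fack_series L q q' g f w ((m3^-1)%:C *: d) hL pq pq' pg hf fo f4 hw wo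
  ltac:(by rewrite star_realZ sd) ltac:(by rewrite -scalerAr fd)
  (fun i => ltac:(by rewrite (rtZ (htr i)) td mulr0))
  ltac:(by apply: nrmZV; rewrite // mulr1).
have c1 := csum_pcp (c := 2 * 1) ltac:(lra) pq' pq q'q cb1.
have fq : csum (2 ^ k2 + 2 ^ k2) (2 * m2) q q' (b2 - d).
  by apply: csum_sub cd => //; rewrite proj_idem.
have c2 := csum_pcp (c := 2 * m2) ltac:(lra) pq pq' qq' fq.
have c3 := csum_pcp (c := 2) ltac:(lra) pq' pq q'q cs.
have c4 := csum_pcp (c := 2) ltac:(lra) pq pq' qq' ct.
have := pcpD (pcpD (pcpD h1 c1) c2) (pcpZ (ltW m30) (pcpD c3 c4)).
congr pcp; rewrite -/V1 -/V2 -/V3 -/V4 (addrC q) qD.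
have dm : d = m3%:C *: (s + t).
  by rewrite -dE scalerA -rmorphM mulfV ?gt_eqF // scale1r.
have bE : b = q * b * q + q' * b * q' + (y + star y).
  by rewrite -{1}rb -{1}br -qD /y !starM sq sq' sb; nc.
rewrite [in RHS]bE /b2 dm; nc.
Qed.

End FackSeries.

(** * Elements bounded below in a corner *)

Section Interior.
Context {R : realType} {A : cstarAlgType R}.
Implicit Types (a b d e f g p q r v w x y z : A) (c : R).
Notation proj := (projection A).
Local Notation pcp := (@positive_combination_of_projections R A).
Variables (n : nat) (tr : 'I_n -> A -> R).
Hypothesis htr : forall i, rtrace (tr i).
Hypothesis rr : rr0 (A := A).

Lemma half_shift p d : proj p -> star d = d -> p * d = d -> nrm d <= 1 ->
  [/\ pos ((2^-1)%:C *: (d + p)), pos (1 - (2^-1)%:C *: (d + p))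
    & p * ((2^-1)%:C *: (d + p)) = (2^-1)%:C *: (d + p)].
Proof.
move=> pp sd pd dn; have pi := proj_idem pp; have dp := sa_fix_comm pp sd pd.
have i2 : 0 <= 2^-1 :> R by rewrite invr_ge0.
split.
- apply: posZ => //; have := proj_conj pp (ge_nrm_add_pos sd dn); congr pos.
  by rewrite scale1r mulrDr mulr1 pd mulrDl pi dp addrC.
- have := posD (proj_compl_pos pp) (posZ i2 (proj_conj pp (ge_nrm_sub_pos sd dn))); congr pos.
  by rewrite scale1r mulrBr mulr1 pd mulrBl pi dp; nc.
- by rewrite -scalerAr mulrDr pd pi.
Qed.

Lemma le0_invn (s t : R) : (forall N : nat, (0 < N)%N -> t <= s / N%:R) -> t <= 0.
Proof.
move=> h; rewrite leNgt; apply/negP => t0.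
have [N hN] : exists N : nat, s / t < N.+1%:R by exists (Num.truncn (s / t)); exact: truncnS_gt.
have := h N.+1 isT; rewrite ler_pdivlMr ?ltr0n //.
by move: hN; rewrite ltr_pdivrMr // mulrC => h1 h2; lra.
Qed.

(** By [proj_approx], b = 2 x - r where x is within 2/N of a combination of subprojections of r, for
    every N. *)
Lemma trace_comb_vanish r b (k : 'I_n -> R) : proj r -> star b = b -> r * b = b -> nrm b <= 1 ->
  (forall p, proj p -> r * p = p -> \sum_i k i * tr i p = 0) -> \sum_i k i * tr i b = 0.
Proof.
move=> pr sb rb nb hk; have [px px1 rx] := half_shift pr sb rb nb.
set x := _ *: _ in px px1 rx.
pose phi y := \sum_i k i * tr i y.
have phiB y z : phi (y - z) = phi y - phi z.
  by rewrite /phi -sumrB; apply: eq_bigr => i _; rewrite (rtB (htr i)) mulrBr.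
have phiZ (c : R) y : phi (c%:C *: y) = c * phi y.
  by rewrite /phi mulr_sumr; apply: eq_bigr => i _; rewrite (rtZ (htr i)) mulrCA.
pose s := \sum_i `|k i|.
have phin y : star y = y -> `|phi y| <= s * nrm y.
  move=> sy; apply: le_trans (ler_norm_sum _ _ _) _; rewrite /s mulr_suml; apply: ler_sum => i _.
  by rewrite normrM ler_wpM2l // (rt_norm (htr i)).
have x0 : phi x = 0.
  apply/eqP; rewrite -normr_le0; apply: (@le0_invn (s * 2)) => N N0.
  have [chi [pchi fchi pe pe']] := proj_approx rr N0 px px1.
  set err := x - _ in pe pe'.
  have chi0 : phi (\sum_(j < N) chi j) = 0.
    rewrite /phi; under eq_bigr => i _ do rewrite (rt_sum (htr i)) mulr_sumr.
    by rewrite exchange_big big1 // => j _; apply: hk => //; exact: fchi.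
  have -> : phi x = phi err by rewrite [phi err]phiB (phiZ N%:R^-1) chi0 mulr0 subr0.
  apply: le_trans (phin _ (pos_sa pe)) _; rewrite -mulrA ler_wpM2l ?sumr_ge0 //.
  exact: pos_le_nrm.
have -> : b = 2%:C *: x - r by rewrite /x; nc.
by rewrite -/(phi _) phiB phiZ x0 mulr0 sub0r /phi hk ?oppr0 // proj_idem.
Qed.

(** Take subprojections whose trace matrix has maximal rank: a further row cannot leave the row
    space. The linear relations given by the cokernel thus hold for subprojections, and pass to b by
    [trace_comb_vanish]. A fixed pseudo-inverse yields coefficients bounded uniformly in b. *)
Lemma trace_span r : proj r -> exists (m : nat) (p : 'I_m -> A) (c : R),
  [/\ 0 <= c, forall j, proj (p j) /\ r * p j = p j
    & forall b, star b = b -> r * b = b -> nrm b <= 1 -> exists k : 'I_m -> R,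
      (forall j, `|k j| <= c) /\ forall i, tr i b = \sum_j k j * tr i (p j)].
Proof.
move=> pr; pose u x : 'rV[R]_n := \row_i tr i x.
pose good m (p : 'I_m -> A) := forall j, proj (p j) /\ r * p j = p j.
pose M m (p : 'I_m -> A) : 'M[R]_(m, n) := \matrix_(j, i) tr i (p j).
pose P k := `[< exists (m : nat) (p : 'I_m -> A), good m p /\ \rank (M m p) = k >].
have exP : exists k, P k.
  exists (\rank (M 0%N (fun=> 0))); apply/asboolP; exists 0%N, (fun=> 0); split=> //.
  by case.
have ubP k : P k -> (k <= n)%N by move=> /asboolP[m [p [_ <-]]]; exact: rank_leq_col.
case: (ex_maxnP exP ubP) => k /asboolP[m [p [gp rk]]] kmax.
pose Mp := M m p.
have sub x : proj x -> r * x = x -> (u x <= Mp)%MS.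
  move=> px rx; pose p' (i : 'I_(m + 1)) := match fintype.split i with inl j => p j | inr _ => x end.
  have gp' : good _ p' by move=> j; rewrite /p'; case: (fintype.split j).
  have ME : M _ p' = col_mx Mp (u x).
    apply/matrixP => j i; rewrite !mxE /p'; case: (fintype.split j) => l; rewrite !mxE //.
  have le : (\rank (col_mx Mp (u x)) <= \rank Mp)%N.
    by rewrite rk kmax //; apply/asboolP; exists (m + 1)%N, p'; rewrite ME.
  have Ms : (Mp <= col_mx Mp (u x))%MS by have := submx_refl (col_mx Mp (u x)); rewrite col_mx_sub => /andP[].
  have := mxrank_leqif_sup Ms => -[le' eq'].
  have : (col_mx Mp (u x) <= Mp)%MS by rewrite -eq' eqn_leq le' le.
  by rewrite col_mx_sub => /andP[].
have subb b : star b = b -> r * b = b -> nrm b <= 1 -> (u b <= Mp)%MS.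
  move=> sb rb nb; rewrite submxE; apply/eqP/matrixP => i j; rewrite !mxE.
  transitivity (\sum_l cokermx Mp l j * tr l b); first by apply: eq_bigr => l _; rewrite [u b _ _]mxE mulrC.
  apply: (trace_comb_vanish pr) => // x px rx.
  have := sub x px rx; rewrite submxE => /eqP/matrixP/(_ ord0 j); rewrite !mxE => h.
  by apply: etrans h; apply: eq_bigr => l _; rewrite [u x _ _]mxE mulrC.
exists m, p, (\sum_j \sum_i `|pinvmx Mp i j|); split=> //.
  by apply: sumr_ge0 => j _; apply: sumr_ge0.
move=> b sb rb nb; pose kk := u b *m pinvmx Mp.
exists (fun j => kk ord0 j); split.
  move=> j; rewrite mxE; apply: le_trans (ler_norm_sum _ _ _) _.
  rewrite (bigD1 j) //= ler_wpDr ?sumr_ge0 // => [l _|]; first exact: sumr_ge0.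
  apply: ler_sum => i _; rewrite mxE normrM ler_piMl //.
  by apply: le_trans (rt_norm (htr i) sb) nb.
move=> i; have := mulmxKpV (subb b sb rb nb) => /matrixP/(_ ord0 i).
by rewrite !mxE => <-; apply: eq_bigr => j _; rewrite [M _ _ _ _]mxE.
Qed.

Hypothesis cmp : forall p q, proj p -> proj q -> (forall i, tr i p < tr i q) -> subeq p q.
Hypothesis gen1 : forall g, proj g -> g <> 0 ->
  exists (m : nat) (x y : nat -> A), 1 = \sum_(j < m) x j * g * y j.
Hypothesis small : forall c, 0 < c -> exists g, [/\ proj g, g <> 0 & forall i, tr i g <= c].
Variable i0 : 'I_n.

(** Subtracting a combination s of the [p j] with the traces of b leaves a traceless element.
    Negative coefficients in s are absorbed by k p + c r = (k + c) p + c (r - p). *)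
Lemma pcp_interior r : proj r -> r <> 0 -> exists V : R, forall b, star b = b ->
  r * b = b -> nrm b <= 1 -> pcp (b + V%:C *: r).
Proof.
move=> pr r0; have [V hV] := interior_traceless htr rr cmp gen1 small i0 pr r0.
have [m [p [c [c0 hp hc]]]] := trace_span pr.
pose t : R := 1 + m%:R * c; have t0 : 0 < t.
  have h : 0 <= m%:R * c by apply: mulr_ge0 => //; rewrite ler0n.
  by rewrite /t; lra.
exists (t * V + m%:R * c) => b sb rb nb; have [k [kc kt]] := hc b sb rb nb.
pose s := \sum_j (k j)%:C *: p j.
have ss : star s = s.
  by rewrite star_sum; apply: eq_bigr => j _; rewrite star_realZ proj_sa //; case: (hp j).
have rs : r * s = s.
  by rewrite mulr_sumr; apply: eq_bigr => j _; rewrite -scalerAr; have [_ ->] := hp j.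
have ns : nrm s <= m%:R * c.
  apply: le_trans (nrm_sum _ _ _) _; rewrite (_ : _ * c = \sum_(j < m) c); last first.
    by rewrite sumr_const card_ord mulr_natl.
  apply: ler_sum => j _; rewrite nrmZ; have [pj _] := hp j; have := proj_nrm pj.
  by have := kc j; have := normr_ge0 (k j); have := nrm_ge0 (p j); nra.
pose b' := (t^-1)%:C *: (b - s).
have h1 : pcp (b' + V%:C *: r).
  apply: hV.
  - by rewrite star_realZ starB sb ss.
  - by rewrite -scalerAr mulrBr rb rs.
  - move=> i; rewrite (rtZ (htr i)) (rtB (htr i)) kt (rt_sum (htr i)).
    rewrite [X in _ - X](eq_bigr (fun j => k j * tr i (p j))) ?subrr ?mulr0 // => j _.
    exact: (rtZ (htr i)).
  - by apply: nrmZV; rewrite // mulr1; have := nrmB b s; rewrite /t; lra.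
have h2 : pcp (s + (m%:R * c)%:C *: r).
  rewrite (_ : _ + _ = \sum_j ((k j + c)%:C *: p j + c%:C *: (r - p j))).
    apply: pcp_sum => j _; have [pj rj] := hp j; apply: pcpD; apply: pcpZ => //.
    - by have := kc j; rewrite ler_norml => /andP[]; lra.
    - exact: pcp_proj.
    - by apply: pcp_proj; apply: projB.
  rewrite rmorphM rmorph_nat -scalerA scaler_nat -[m in _ *+ m]card_ord -sumr_const -big_split /=.
  by apply: eq_bigr => j _; nc.
have := pcpD (pcpZ (ltW t0) h1) h2; congr pcp.
have bE : t%:C *: b' = b - s by rewrite scalerA -rmorphM mulfV ?gt_eqF // scale1r.
by rewrite scalerDr bE; nc.
Qed.

(** Write b = m x + c r with 0 <= x <= 1. A mean of projections replaces x up to an error, for which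
    c r pays once V' m |err| <= c; this dictates the choice of N. *)
Lemma pcp_bounded_below r b c : proj r -> star b = b -> r * b = b -> 0 < c ->
  pos (b - c%:C *: r) -> pcp b.
Proof.
move=> pr sb rb c0 hb; have [r0|r0] := pselect (r = 0).
  by rewrite -rb r0 mul0r; exact: pcp0.
have [V hV] := pcp_interior pr r0; have pi := proj_idem pr.
pose V' := `|V| + 1; have V'0 : 0 < V' by have := normr_ge0 V; rewrite /V'; lra.
pose x0 := b - c%:C *: r; pose m := nrm x0 + 1.
have m0 : 0 < m by have := nrm_ge0 x0; rewrite /m; lra.
have mi : 0 <= m^-1 by rewrite invr_ge0 ltW.
pose x := (m^-1)%:C *: x0.
have px : pos x by apply: posZ.
have px1 : pos (1 - x).
  have nx : nrm x <= 1 by apply: nrmZV; rewrite // mulr1 /m; lra.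
  by have := ge_nrm_sub_pos (pos_sa px) nx; rewrite scale1r.
have rx : r * x = x by rewrite /x -scalerAr mulrBr rb -scalerAr pi.
have [N hN] : exists N : nat, 2 * m * V' / c < N.+1%:R.
  by exists (Num.truncn (2 * m * V' / c)); exact: truncnS_gt.
have N0 : 0 < N.+1%:R :> R by rewrite ltr0n.
have [chi [pchi fchi pe pe']] := proj_approx rr (ltn0Sn N) px px1.
set err := x - _ in pe pe'.
have rerr : r * err = err.
  rewrite mulrBr rx -scalerAr mulr_sumr; congr (_ - _ *: _); apply: eq_bigr => j _; exact: fchi.
have Vm0 : 0 < V' * m / c by rewrite divr_gt0 // mulr_gt0.
have h1 : pcp ((V' * m / c)%:C *: err + V%:C *: r).
  apply: hV.
  - by rewrite star_realZ pos_sa.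
  - by rewrite -scalerAr rerr.
  - rewrite nrmZ gtr0_norm //; apply: (@le_trans _ _ (V' * m / c * (2 / N.+1%:R))).
      by rewrite ler_pM2l //; exact: pos_le_nrm.
    rewrite mulrA ler_pdivrMr // mul1r; apply: ltW; apply: le_lt_trans hN.
    by rewrite le_eqVlt; apply/orP; left; apply/eqP; field; rewrite gt_eqF.
have h2 : pcp ((V' - V)%:C *: r).
  by apply: pcpZ; [have := ler_norm V; rewrite /V'; lra | exact: pcp_proj].
have cV : 0 <= c / V' by rewrite divr_ge0 // ltW.
have h3 : pcp ((m / N.+1%:R)%:C *: \sum_(j < N.+1) chi j).
  apply: pcpZ; first by rewrite divr_ge0 // ltW.
  by apply: pcp_sum => j _; exact: pcp_proj.
have := pcpD h3 (pcpZ cV (pcpD h1 h2)); congr pcp.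
have bE : b = m%:C *: x + c%:C *: r by rewrite /x scalerA -rmorphM mulfV ?gt_eqF // scale1r subrK.
have V'n : V' != 0 by rewrite gt_eqF.
have cn : c != 0 by rewrite gt_eqF.
have xE : x = (N.+1%:R^-1)%:C *: \sum_(j < N.+1) chi j + err by rewrite /err addrC subrK.
have key (S e : A) (u v w k l : R) :
    (k * l)%:C *: S + u%:C *: (w%:C *: e + V%:C *: r + (v - V)%:C *: r) =
    (k * l)%:C *: S + (u * w)%:C *: e + (u * v)%:C *: r by nc.
rewrite [RHS]bE xE key divfK // (_ : c / V' * (V' * m / c) = m); last by field; rewrite V'n cn.
have dist (S e : A) (k l : R) : (k * l)%:C *: S + k%:C *: e + c%:C *: r =
  k%:C *: (l%:C *: S + e) + c%:C *: r by nc.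
exact: dist.
Qed.

End Interior.

(** * Arbitrary positive elements *)

Section Positive.
Context {R : realType} {A : cstarAlgType R}.
Implicit Types (a b d e f g p q r v w x y z : A) (c : R).
Notation proj := (projection A).
Local Notation pcp := (@positive_combination_of_projections R A).

Lemma bounded_mono_stable (f : nat -> R) (B c : R) k0 : (forall k, f k <= f k.+1) ->
  (forall k, f k <= B) -> 0 < c -> exists l, (k0 <= l)%N /\ forall k, f k - f l < c.
Proof.
move=> fS fB c0; have fm : {homo f : i j / (i <= j)%N >-> i <= j}.
  by apply: homo_leq => //; exact: le_trans.
have hs : has_sup (range f).
  by split; [exists (f 0), 0 | exists B => _ [k _ <-]].
have [_ [l _ <-] hl] := sup_adherent c0 hs.
exists (maxn k0 l); split; first exact: leq_maxl.
move=> k; have h1 : f k <= sup (range f) by apply: sup_upper_bound => //; exists k.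
by have := fm l _ (leq_maxr k0 l); lra.
Qed.

Lemma proj_chain (u : nat -> A) : (forall k, proj (u k)) -> (forall k, u k.+1 * u k = u k) ->
  forall k l, (k <= l)%N -> u l * u k = u k.
Proof.
move=> pu hu k l /subnKC <-; elim: (l - k)%N => [|j ih]; first by rewrite addn0 proj_idem.
by rewrite addnS -{1}ih mulrA hu ih.
Qed.

(** Every third projection of [level_proj], so that 2^(3k) = 8^k. The lower bound 2^-(3k+2) =
    2/8^(k+1) attached to [u k] is twice the bound on [a] off [u k.+1]; [pcp_diffuse] lives on this
    factor 2. *)
Lemma level_chain a : rr0 (A := A) -> pos a -> exists u : nat -> A,
  [/\ forall k, proj (u k), forall k, u k.+1 * u k = u k,
      forall k, nrm ((1 - u k) * a * (1 - u k)) <= (8 ^+ k)^-1,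
      forall k, (1 - u k.+1) * sqa a * u k = 0
    & forall k, pos (sqa a * u k.+1 * sqa a - (2 / 8 ^+ k.+1)%:C *: u k) /\
       pos (u k * a * u k - (2 / 8 ^+ k.+1)%:C *: u k)].
Proof.
move=> rr pa; have [r [pr rS rn rh rp]] := level_proj pa rr.
have e8 k : (2 : R) ^+ (3 * k) = 8 ^+ k by rewrite exprM; congr (_ ^+ _); ring.
have c8 k : ((2 : R) ^+ (3 * k).+2)^-1 = 2 / 8 ^+ k.+1.
  rewrite !exprS e8; have : (8 : R) ^+ k != 0 by rewrite expf_neq0 // pnatr_eq0.
  by move=> h; field.
exists (fun k => r (3 * k)%N); split=> k; rewrite ?mulnS ?addSn ?add0n //.
- by have := rn (3 * k)%N; rewrite e8.
- by have := rp (3 * k)%N; rewrite c8.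
Qed.

Variables (n : nat) (tr : 'I_n -> A -> R).
Hypothesis htr : forall i, rtrace (tr i).
Hypothesis rr : rr0 (A := A).

Let Tr x := \sum_i tr i x.

Lemma pcp_gap c : 0 < c -> (forall p, proj p -> p <> 0 -> c <= \sum_i tr i p) ->
  forall a, pos a -> pcp a.
Proof.
move=> c0 gap.
have TrB x y : Tr (x - y) = Tr x - Tr y.
  by rewrite /Tr -sumrB; apply: eq_bigr => i _; rewrite (rtB (htr i)).
have Trp p : proj p -> 0 <= Tr p by move=> pp; apply: sumr_ge0 => i _; exact: rt_proj_ge0.
suff main N : forall e a, proj e -> pos a -> e * a = a -> Tr e < N%:R * c -> pcp a.
  move=> a pa; apply: (main (Num.truncn (Tr 1 / c)).+1 1) => //; rewrite ?mul1r //.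
    exact: proj1.
  by rewrite -ltr_pdivrMr // truncnS_gt.
elim: N => [|N ih] e a pe pa ea; first by rewrite mul0r => /(le_lt_trans (Trp e pe)); rewrite ltxx.
move=> le; have [a0|a0] := eqVneq (nrm a) 0; first by rewrite (nrm_eq0 a0); exact: pcp0.
pose l := nrm a; have l0 : 0 < l by rewrite lt_def a0 nrm_ge0.
have sa := pos_sa pa; pose b := l%:C%:A - a; have pb : pos b := nrm_sub_pos sa.
have [u [pu uS un _ up]] := level_chain rr pb.
have um k : Tr (u k) <= Tr (u k.+1).
  by rewrite -subr_ge0 -TrB; apply/Trp/projB.
have ub k : Tr (u k) <= Tr 1.
  by rewrite -subr_ge0 -TrB; apply/Trp/projC.
have [J [_ hJ]] := bounded_mono_stable 0%N um ub c0.
(* The difference is a projection whose traces add up to less than c, so it vanishes by [gap]. *)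
have uJ k : (J <= k)%N -> u k = u J.
  move=> Jk; apply/eqP; rewrite -subr_eq0; apply/negPn/negP => /eqP ne.
  have h := proj_chain pu uS Jk; have := gap _ (projB (pu J) (pu k) h) ne.
  by rewrite -/(Tr _) TrB leNgt hJ.
pose q := 1 - u J; have pq : proj q := projC (pu J); have qi := proj_idem pq.
have bq : b * q = 0.
  apply: pos_conj_eq0 => //; rewrite proj_sa //; apply: nrm_eq0; apply/eqP.
  rewrite -normr_le0 ger0_norm ?nrm_ge0 //; apply: (@le0_invn _ 1) => k k0.
  have := un (J + k)%N; rewrite uJ ?leq_addr // => /le_trans; apply.
  rewrite div1r lef_pV2 ?posrE ?ltr0n ?exprn_gt0 // -natrX ler_nat.
  by apply: leq_trans (leq_addl J k) (ltnW (ltn_expl _ _)).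
have aq : a * q = l%:C *: q.
  by move: bq; rewrite mulrBl -scalerAl mul1r => /subr0_eq.
have qa : q * a = l%:C *: q.
  transitivity (star (a * q)); first by rewrite starM sa (proj_sa pq).
  by rewrite aq star_realZ (proj_sa pq).
(* If [u J] = 1, then b = |a| - a is bounded below by some h > 0, and |a| <= |a| - h. *)
have q0 : q <> 0.
  move=> q0; have u1 : u J = 1 by apply/esym/subr0_eq.
  have [_] := up J; rewrite u1 mul1r mulr1; set h := 2 / _ => hp.
  have h0 : 0 < h by rewrite divr_gt0 // exprn_gt0.
  have : nrm a <= l - h by apply: pos_le_nrm => //; move: hp; congr pos; rewrite /b; nc.
  by rewrite -/l; lra.
have lC : l%:C != 0 :> R[i] by rewrite (fmorph_eq0 (real_complex R)) gt_eqF.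
have eq : e * q = q.
  by apply: (scalerI lC); rewrite scalerAr -aq mulrA ea aq.
have -> : a = l%:C *: q + (a - l%:C *: q) by rewrite addrC subrK.
apply: pcpD; first by apply: pcpZ; [exact: ltW | exact: pcp_proj].
apply: (ih (e - q)).
- exact: projB.
- have := proj_conj (projC pq) pa; congr pos.
  by rewrite mulrBl mul1r qa mulrBr mulr1 mulrBl aq -scalerAl qi subrr subr0.
- by rewrite mulrBl !mulrBr ea qa -!scalerAr eq qi; nc.
- by rewrite TrB; have := gap q pq q0; rewrite -/(Tr q); move: le; rewrite -natr1; lra.
Qed.

Hypothesis cmp : forall p q, proj p -> proj q -> (forall i, tr i p < tr i q) -> subeq p q.
Hypothesis gen1 : forall g, proj g -> g <> 0 ->
  exists (m : nat) (x y : nat -> A), 1 = \sum_(j < m) x j * g * y j.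
Variable i0 : 'I_n.

(** The slices s_k of 1 - u_(m+1) are carried orthogonally into u_m by v_k, and X is the series of
    the v_k a^(1/2). Orthogonality of the ranges computes X^* X, and X kills u_m because 1 - u_(m+1)
    kills a^(1/2) u_m. *)
Lemma pcp_tail a (u : nat -> A) m : pos a -> (forall k, proj (u k)) ->
  (forall k, u k.+1 * u k = u k) ->
  (forall k, nrm ((1 - u k) * a * (1 - u k)) <= (8 ^+ k)^-1) ->
  (1 - u m.+1) * sqa a * u m = 0 ->
  (forall i k, tr i (u k) - tr i (u m.+1) < tr i (u m)) ->
  exists X, [/\ u m * X = X, X * u m = 0 & star X * X = sqa a * (1 - u m.+1) * sqa a].
Proof.
move=> pa pu uS un uh ut; have uc := proj_chain pu uS.
have ss := sqa_sa pa; have s2 := sqa_sq pa.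
pose s k := u (m.+1 + k).+1 - u (m.+1 + k)%N.
have ps k : proj (s k) by apply: projB.
have sc k : s k * (1 - u (m.+1 + k)%N) = s k.
  by rewrite /s mulrBr mulr1 mulrBl uS proj_idem // subrr subr0.
have sm k : s k * (1 - u m.+1) = s k.
  by rewrite /s mulrBr mulr1 mulrBl !uc ?subrr ?subr0 // ?leq_addr // -addnS leq_addr.
have tel (F : A -> R) k : (forall x y, F (x - y) = F x - F y) ->
    \sum_(j < k) F (s j) = F (u (m.+1 + k)%N) - F (u m.+1).
  move=> FB; elim: k => [|k ih].
    by rewrite big_ord0 addn0 subrr.
  by rewrite big_ord_recr /= ih FB addnS; lra.
have [v [vv qv vo]] : exists v : nat -> A, [/\ forall k, star (v k) * v k = s k,
    forall k, u m * v k = v k & forall k l, k != l -> star (v k) * v l = 0].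
  apply: (packing htr cmp) => // k i.
  by rewrite (tel (tr i)) // => x y; exact: (rtB (htr i)).
have vs k : v k * s k = v k by apply: isom_fix.
(* The square is at most 8^-k <= 4^-k, which gives the ratio 1/2 of [geometric_cvg]. *)
have hn k : nrm ((1 - u k) * sqa a) <= 2^-1 ^+ k.
  rewrite -(@ler_pXn2r _ 2) ?nnegrE ?nrm_ge0 ?exprn_ge0 ?invr_ge0 //.
  rewrite -nrm_cstarr starM ss (proj_sa (projC (pu k))) mulrA -(mulrA (1 - u k) (sqa a) (sqa a)) s2.
  apply: le_trans (un k) _; rewrite -exprM mulnC exprM exprVn -exprVn.
  apply: lerXn2r; rewrite ?nnegrE ?invr_ge0 //.
    by rewrite exprn_ge0 // invr_ge0.
  by rewrite lef_pV2 ?posrE ?exprn_gt0 // expr2; lra.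
pose w k := v k * sqa a.
have wE k : w k = v k * s k * ((1 - u (m.+1 + k)%N) * sqa a).
  by rewrite mulrA -(mulrA (v k)) sc vs.
have wn k : nrm (w k) <= 1 * 2^-1 ^+ k.
  rewrite wE vs mul1r; apply: le_trans (nrmM _ _) _.
  have h1 := isom_nrm (ps k) (vv k); have h2 := hn (m.+1 + k)%N.
  have h3 : (2^-1 : R) ^+ (m.+1 + k) <= 2^-1 ^+ k.
    rewrite exprD ler_piMl ?exprn_ge0 ?invr_ge0 // exprn_ile1 ?invr_ge0 //.
    by rewrite invf_le1 // ler1n.
  by have := nrm_ge0 (v k); have := nrm_ge0 ((1 - u (m.+1 + k)%N) * sqa a); nra.
have [X [hX _]] := geometric_cvg ler01 wn.
exists X; split.
- apply: tends_fixl hX => k; rewrite mulr_sumr; apply: eq_bigr => j _.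
  by rewrite mulrA qv.
- have := tends_uniq (tendsMr (u m) hX) _; apply.
  apply: tends_eq (tends_cst 0) => k; rewrite mulr_suml big1 // => j _.
  by rewrite /w -(vs j) -(sm j) -!mulrA [_ * (sqa a * _)]mulrA uh !mulr0.
- have orth k l : k != l -> star (w k) * w l = 0.
    by move=> kl; rewrite /w starM ss mulrA -(mulrA (sqa a)) vo // mulr0 mul0r.
  apply: (tends_uniq (tends_orth_square orth hX)).
  apply: (@tends_eq _ _ (fun k => sqa a * (1 - u m.+1) * sqa a -
      sqa a * (1 - u (m.+1 + k)%N) * sqa a)).
    move=> k; elim: k => [|k ih]; first by rewrite big_ord0 addn0 subrr.
    have wE' : star (w k) * w k = sqa a * s k * sqa a.
      by rewrite /w starM ss mulrA -(mulrA (sqa a) (star (v k)) (v k)) vv.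
    by rewrite big_ord_recr /= -ih wE' addnS /s; nc.
  rewrite -[X in tends _ X]subr0; apply: tendsB; first exact: tends_cst.
  apply: (@tends_bound _ _ _ (fun k => (1 - u (m.+1 + k)%N) * sqa a) _ 0) => [k|].
    rewrite !subr0; have := hn (m.+1 + k)%N; set y := (1 - _) * sqa a => yn.
    have -> : sqa a * (1 - u (m.+1 + k)%N) * sqa a = star y * y.
      have pc := projC (pu (m.+1 + k)%N).
      by rewrite -[in LHS](proj_idem pc) /y starM ss (proj_sa pc) !mulrA.
    rewrite nrm_cstar expr2 ler_piMl ?nrm_ge0 //; apply: le_trans yn _.
    by rewrite exprn_ile1 ?invr_ge0 // invf_le1 // ler1n.
  move=> e e0; have [N hN] : exists N : nat, e^-1 < N.+1%:R.
    by exists (Num.truncn e^-1); exact: truncnS_gt.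
  exists N.+1 => k kN; rewrite subr0; apply: le_lt_trans (hn _) _.
  rewrite exprVn -[e]invrK ltf_pV2 ?posrE ?invr_gt0 ?exprn_gt0 //.
  apply: lt_trans hN _; rewrite -natrX ltr_nat; apply: leq_ltn_trans kN _.
  by apply: leq_ltn_trans (leq_addl m.+1 k) (ltn_expl _ _).
Qed.

Hypothesis small : forall c, 0 < c -> exists g, [/\ proj g, g <> 0 & forall i, tr i g <= c].

Lemma pcp_diffuse a : pos a -> pcp a.
Proof.
move=> pa; have [a0|a0] := eqVneq (nrm a) 0; first by rewrite (nrm_eq0 a0); exact: pcp0.
have ss := sqa_sa pa; have s2 := sqa_sq pa.
have [u [pu uS un uh up]] := level_chain rr pa.
have [k0 uk0] : exists k, u k <> 0.
  apply: contrapT => /forallNP h; case/negP: a0.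
  rewrite -normr_le0 ger0_norm ?nrm_ge0 //; apply: (@le0_invn _ 1) => k k0.
  have := un k; have /contrapT -> := h k; rewrite subr0 mul1r mulr1 => /le_trans; apply.
  rewrite div1r lef_pV2 ?posrE ?ltr0n ?exprn_gt0 // -natrX ler_nat.
  exact: ltnW (ltn_expl _ _).
have [e e0 he] := ex_lower_bound (fun i => tr_gt0 htr gen1 i (pu k0) uk0).
have uc := proj_chain pu uS.
have trm i k l : (k <= l)%N -> tr i (u k) <= tr i (u l).
  by move=> kl; apply: tr_sub => //; exact: uc.
(* From l on the sum of the traces grows by less than e, which is below every [tr i (u k0)]; so the
   tail fits into [u l]. *)
have [l [k0l hl]] : exists l, (k0 <= l)%N /\ forall k, Tr (u k) - Tr (u l) < e.
  apply: (@bounded_mono_stable _ (Tr 1)) => // k; apply: ler_sum => i _; first exact: trm.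
  by apply: tr_sub => //; [exact: proj1 | rewrite mul1r].
have ut i k : tr i (u k) - tr i (u l.+1) < tr i (u l).
  have h0 : tr i (u k0) <= tr i (u l) := trm _ _ _ k0l.
  have [kl|lk] := leqP k l.+1; first by have := trm i _ _ kl; have := he i; lra.
  have h1 : tr i (u k) - tr i (u l) <= Tr (u k) - Tr (u l).
    rewrite /Tr -sumrB (bigD1 i) //= ler_wpDr // sumr_ge0 // => j _.
    by rewrite subr_ge0 trm // ltnW // ltnW.
  by have := hl k; have := he i; have := trm i _ _ (leqnSn l); lra.
have [X [qX Xq XX]] := pcp_tail pa pu uS un (uh l) ut.
set q := u l in qX Xq; set p := u l.+1 in XX; have pq : proj q := pu l.
have pp : proj p := pu _; have pi := proj_idem pp.
(* Here t bounds |X|^2, so the exchange costs t q, while a^(1/2) p a^(1/2) >= 2 t q. *)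
pose t : R := (8 ^+ l.+1)^-1; have t0 : 0 < t by rewrite invr_gt0 exprn_gt0.
pose h : R := 2 / 8 ^+ l.+2.
have h0 : 0 < h by rewrite divr_gt0 // exprn_gt0.
have h1 : h <= 1.
  rewrite /h ler_pdivrMr ?exprn_gt0 // mul1r exprS.
  have : 1 <= (8 : R) ^+ l.+1 by rewrite exprn_ege1 // ler1n.
  lra.
have [hq _] := up l; rewrite -/q -/p -/t in hq; have [_ hp] := up l.+1; rewrite -/p -/h in hp.
have hh : 0 < h <= 1 by rewrite h0.
have [d [pr rhp [pd nd] _ _]] := range_proj pp pa hh hp.
set r := _ * sqa a in pr rhp.
have hr : pos (sqa a * p * sqa a - h%:C *: r).
  have := ge_nrm_sub_pos (pos_sa pd) nd => /(posZ (ltW h0)).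
  move=> /(proj_conj pp)/(pos_conj (sqa a)); rewrite ss; congr pos.
  have hC : h%:C != 0 :> R[i] by rewrite (fmorph_eq0 (real_complex R)) gt_eqF.
  rewrite scalerBr scalerA -rmorphM mulfV ?gt_eqF // scale1r.
  by rewrite mulrBr mulr1 mulrBl pi /r; nc.
have rph : r * (sqa a * p * sqa a) = sqa a * p * sqa a by rewrite !mulrA rhp.
have rq : r * q = q.
  apply/compl_fix/(@dominated_null _ _ _ (sqa a * p * sqa a) _ ((2 * t)^-1)).
  - exact: proj_pos.
  - have t2 : 0 < (2 * t)^-1 by rewrite invr_gt0 mulr_gt0.
    have := posZ (ltW t2) hq; congr pos.
    by rewrite scalerBr scalerA -rmorphM mulVf ?scale1r // gt_eqF // mulr_gt0.
  - by rewrite fix_compl.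
have rX : r * X = X by rewrite -qX mulrA rq.
have tX : pcp (star X * X - X * star X + t%:C *: q).
  pose s := Num.sqrt t; have sE : s ^+ 2 = t := sqr_sqrtr (ltW t0).
  have s0 : 0 < s by rewrite sqrtr_gt0.
  have nX : nrm X <= s.
    rewrite -(@ler_pXn2r _ 2) ?nnegrE ?nrm_ge0 ?(ltW s0) // sE -nrm_cstar XX.
    have := un l.+1; rewrite -/p -/t; apply: le_trans.
    have pc := projC pp; have := nrm_conj_sqa pa pc => <-; rewrite -nrm_cstarr.
    by rewrite starM ss (proj_sa pc) mulrA -(mulrA (sqa a) (1 - p) (1 - p)) (proj_idem pc).
  have := @pcp_move _ _ q ((s^-1)%:C *: X) pq.
  rewrite -scalerAr qX -scalerAl Xq scaler0 => /(_ erefl erefl).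
  have sn : nrm ((s^-1)%:C *: X) <= 1 by apply: nrmZV; rewrite // mulr1.
  move=> /(_ sn)/(pcpZ (ltW t0)); congr pcp.
  have sC : s%:C != 0 :> R[i] by rewrite (fmorph_eq0 (real_complex R)) gt_eqF.
  by rewrite star_realZ -sE; nc.
have -> : a = star X * X - X * star X + t%:C *: q +
    (sqa a * p * sqa a + X * star X - t%:C *: q).
  by rewrite XX -{1}s2; nc.
apply: pcpD => //; apply: (pcp_bounded_below htr rr cmp gen1 small i0 pr (c := h / 2)).
- by rewrite starB starD star_realZ !starM starK ss (proj_sa pp) (proj_sa pq) mulrA.
- by rewrite mulrBr mulrDr rph mulrA rX -scalerAr rq.
- by lra.
(* One half of a^(1/2) p a^(1/2) pays for t q; the other half is at least (h/2) r. *)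
- have i2 : 0 <= 2^-1 :> R by rewrite invr_ge0.
  have key (Y Z y z : A) (v w : R) : (2^-1)%:C *: (Y - v%:C *: y) +
      (2^-1)%:C *: (Y - (2 * w)%:C *: z) + Z = Y + Z - w%:C *: z - (v / 2)%:C *: y by nc.
  by have := posD (posD (posZ i2 hr) (posZ i2 hq)) (pos_starr X); congr pos; exact: key.
Qed.

End Positive.

Lemma positive_pcp (R : realType) (A : cstarAlgType R) (n : nat) (tr : 'I_n -> A -> R) :
  (forall i, rtrace (tr i)) -> rr0 (A := A) ->
  (forall p q, projection A p -> projection A q -> (forall i, tr i p < tr i q) -> subeq p q) ->
  (forall g, projection A g -> g <> 0 ->
    exists (m : nat) (x y : nat -> A), 1 = \sum_(j < m) x j * g * y j) ->
  'I_n -> forall a : A, pos a -> positive_combination_of_projections a.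
Proof.
move=> htr rr cmp gen1 i0.
have [small|] := pselect (forall c : R, 0 < c ->
    exists g, [/\ projection A g, g <> 0 & forall i, tr i g <= c]).
  exact: (pcp_diffuse htr rr cmp gen1 i0 small).
(* If smallness fails at c, every nonzero projection has some trace above c, so the sum of its
   traces exceeds c. *)
move=> /existsNP[c /not_implyP[c0 hc]]; apply: (pcp_gap htr rr c0) => p pp p0.
rewrite leNgt; apply/negP => lt; case: hc; exists p; split=> // i.
apply: ltW; apply: le_lt_trans lt; rewrite (bigD1 i) //= ler_wpDr // sumr_ge0 // => j _.
exact: rt_proj_ge0.
Qed.

(** * Extreme traces *)

Section Compactness.
Import numFieldNormedType.Exports.
Local Open Scope classical_set_scope.
Context {R : realType} {A : cstarAlgType R}.
Implicit Types (a b d e f g p q r v w x y z : A) (c : R) (t s : {ptws A -> R}).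

Lemma continuous_subr (T : topologicalType) (f g : T -> R) :
  continuous f -> continuous g -> continuous (fun u => f u - g u).
Proof. by move=> cf cg u; exact: continuousB (cf u) (cg u). Qed.

Lemma continuous_addr (T : topologicalType) (f g : T -> R) :
  continuous f -> continuous g -> continuous (fun u => f u + g u).
Proof. by move=> cf cg u; exact: continuousD (cf u) (cg u). Qed.

Lemma continuous_mulr (T : topologicalType) c (f : T -> R) :
  continuous f -> continuous (fun u => c * f u).
Proof. by move=> cf u; apply: cvgM; [exact: cvg_cst | exact: cf]. Qed.

Lemma eval_continuous x : continuous (fun t : {ptws A -> R} => t x).
Proof. exact: (@proj_continuous A (fun=> R) x). Qed.

Lemma closure_closed (S : set {ptws A -> R}) t (phi : {ptws A -> R} -> R) (C : set R) :
  closed C -> continuous phi -> closure S t -> (forall s, S s -> C (phi s)) -> C (phi t).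
Proof.
move=> cC cp St SC; have cl : closed (phi @^-1` C) by move/continuous_closedP: cp; apply.
by apply: cl; apply: closure_subset St.
Qed.

Lemma rt_bound t x : rtrace t -> `|t x| <= nrm x.
Proof.
move=> ht; pose h := (2^-1)%:C *: (x + star x).
have sh : star h = h by rewrite star_realZ starD starK addrC.
have -> : t x = t h by rewrite (rtZ ht) (rtD ht) (rt_star ht); field.
apply: le_trans (rt_norm ht sh) _; apply: nrmZV => //.
by have := nrmD x (star x); rewrite nrm_star; lra.
Qed.

Let S0 : set {ptws A -> R} := [set t | rtrace t].

Lemma rtrace_closed : closed S0.
Proof.
move=> t St; pose ev := eval_continuous.
have eq0 (phi : {ptws A -> R} -> R) : continuous phi -> (forall s, rtrace s -> phi s = 0) -> phi t = 0.
  by move=> cp h; apply: (closure_closed (@closed_eq R 0) cp St) => s /h.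
have ge0 x : pos x -> 0 <= t x.
  by move=> px; apply: (closure_closed (@closed_ge R 0) (ev x) St) => s /rt_ge0; apply.
have cB := @continuous_subr {ptws A -> R}.
have cD := @continuous_addr {ptws A -> R}.
have cZ := @continuous_mulr {ptws A -> R}.
have eq (f g : {ptws A -> R} -> R) : continuous f -> continuous g ->
    (forall s, rtrace s -> f s = g s) -> f t = g t.
  move=> cf cg h; apply/eqP; rewrite -subr_eq0; apply/eqP.
  by apply: (eq0 _ (cB f g cf cg)) => s /h ->; rewrite subrr.
split=> //.
- by move=> x y; apply: (eq _ _ (ev _) (cD _ _ (ev x) (ev y))) => s /rtD.
- by move=> c x; apply: (eq _ _ (ev _) (cZ c _ (ev x))) => s /rtZ.
- by move=> x y; apply: (eq _ _ (ev _) (ev _)) => s /rtC.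
- by apply: (closure_closed (@closed_eq R 1) (ev 1) St) => s /rt1.
- by move=> x; apply: (eq _ _ (ev _) (ev _)) => s /rt_star.
Qed.

(** The Banach-Alaoglu argument: a closed subset of the product of the intervals [-|x|, |x|], under
    pointwise convergence. *)
Lemma rtrace_compact : compact S0.
Proof.
apply: (@subclosed_compact _ _ [set t : {ptws A -> R} | forall x, `[- nrm x, nrm x] (t x)]).
- exact: rtrace_closed.
- by apply: (@tychonoff A (fun=> R) (fun x => `[- nrm x, nrm x])) => x; exact: segment_compact.
- by move=> t ht x /=; rewrite in_itv /= -ler_norml rt_bound.
Qed.

(* Lexicographic maximization of [d 0], [d 1], ... over the traces: the intersection of
   these faces is a single extreme trace when [d] is dense. *)
Let face (d : nat -> A) := fix face k : set {ptws A -> R} :=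
  if k is k'.+1 then [set t | face k' t /\ forall s, face k' s -> s (d k') <= t (d k')] else S0.

Let face_closed (d : nat -> A) k : closed (face d k).
Proof.
elim: k => [|k ih]; first exact: rtrace_closed.
move=> t St; split; first by apply: ih; apply: closure_subset St => s [].
move=> s fs; apply: (closure_closed (@closed_ge R (s (d k))) (@eval_continuous (d k)) St).
by move=> s' [_ /(_ s fs)].
Qed.

Let face_le (d : nat -> A) k : face d k `<=` S0.
Proof. by elim: k => // k ih t [/ih]. Qed.

Let face_neq0 (d : nat -> A) k : S0 !=set0 -> face d k !=set0.
Proof.
move=> h0; elim: k => // k ih.
have ck : compact (face d k) := subclosed_compact (face_closed (k := k)) rtrace_compact (face_le (k := k)).
have [t ft tm] := compact_EVT_max ih ck (continuous_subspaceT (@eval_continuous (d k))).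
by exists t; split=> [|s fs]; [exact: set_mem | apply: tm; exact: mem_set].
Qed.

(** Extremality is expressed along the sequence [d]; [rtrace_dense_eq] turns it into equality of
    traces once [d] runs through a dense set. *)
Lemma lex_max_rtrace (d : nat -> A) : (exists t, S0 t) -> exists t,
  [/\ rtrace t, forall s, rtrace s -> s (d 0%N) <= t (d 0%N)
    & forall (y z : A -> R) c, rtrace y -> rtrace z -> 0 < c < 1 ->
      (forall x, t x = c * y x + (1 - c) * z x) -> forall k, y (d k) = t (d k) /\ z (d k) = t (d k)].
Proof.
move=> h0; have fS k l : (k <= l)%N -> face d l `<=` face d k.
  by move=> /subnKC <-; elim: (l - k)%N => [|j ih]; rewrite ?addn0 // addnS => t [/ih].
pose F := filter_from setT (face d).
have FF : ProperFilter F.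
  apply: filter_from_proper => [|k _]; last exact: face_neq0.
  apply: filter_fromT_filter; first by exists 0%N.
  move=> i j; exists (maxn i j) => t ft.
  by split; apply: fS ft; rewrite ?leq_maxl ?leq_maxr.
have FS0 : F S0 by exists 0%N.
have [t [St ct]] := rtrace_compact FF FS0.
have ft k : face d k t.
  by apply: face_closed => B tB; apply: ct => //; exists k.
exists t; split=> //; first by have [_] := ft 1%N.
move=> y z c hy hz /andP[c0 c1] tE.
(* A proper convex combination of two values that reaches the maximum forces both values to be
   maximal, so y and z stay in every face. *)
have fyz k : face d k y /\ face d k z.
  elim: k => [|k [fy fz]] //; have [ftk tm] := ft k.+1.
  have ym := tm y fy; have zm := tm z fz; have e := tE (d k).
  have [ye ze] : y (d k) = t (d k) /\ z (d k) = t (d k) by split; nra.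
  by split; (split=> // s fs; rewrite ?ye ?ze; exact: tm).
move=> k; have [fy fz] := fyz k; have [_ tm] := ft k.+1.
by have := tm y fy; have := tm z fz; have := tE (d k); split; nra.
Qed.

Lemma rtrace_dense_eq (D : set A) (y z : A -> R) : dense D -> rtrace y -> rtrace z ->
  (forall x, D x -> y x = z x) -> y = z.
Proof.
move=> dD hy hz yz; apply/funext => x; apply/eqP; rewrite -subr_eq0 -normr_le0.
apply/ler_addgt0Pr => e e0; rewrite add0r.
have e2 : 0 < (e / 2)%:C :> R[i] by rewrite ltcR; lra.
have [x' [bx Dx]] := dD _ (ex_intro _ x (nbhsx_ballx x _ e2)) (@open_interior _ _).
have := interior_subset bx; rewrite -ball_normE /= nrmE ltcR => xx.
have -> : y x - z x = y (x - x') - z (x - x').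
  by rewrite (rtB hy) (rtB hz) (yz x' Dx); ring.
have := ler_normB (y (x - x')) (z (x - x')).
by have := rt_bound (x - x') hy; have := rt_bound (x - x') hz; lra.
Qed.

Lemma countable_range (D : set A) : countable D -> exists d : nat -> A, D `<=` range d.
Proof.
move=> /countable_injP[f fi]; exists (fun k => xget 0 [set x | D x /\ f x = k]).
move=> x Dx; exists (f x) => //.
have [Dy fy] : [set x' | D x' /\ f x' = f x] (xget 0 [set x' | D x' /\ f x' = f x]).
  exact: (@xgetPex _ 0 [set x' | D x' /\ f x' = f x] (ex_intro _ x (conj Dx erefl))).
by apply: fi => //; exact: mem_set.
Qed.

End Compactness.

(** * Tracial states, their real parts, and fullness of projections *)

Section TracialStates.
Context {R : realType} {A : cstarAlgType R}.
Implicit Types (a b d e f g p q r v w x y z : A) (c : R).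
Notation proj := (projection A).

Section RealPart.
Variable tau : A -> R[i].
Hypothesis ht : tracial_state A tau.

Lemma tsD x y : tau (x + y) = tau x + tau y.
Proof. by have [tl _ _ _] := ht; have := tl 1 x y; rewrite scale1r mul1r. Qed.

Lemma tsZ (k : R[i]) x : tau (k *: x) = k * tau x.
Proof.
have [tl _ _ _] := ht; have := tl 0 (0 : A) 0; rewrite scale0r add0r mul0r add0r => t0.
have t00 : tau 0 = 0.
  by have := tsD 0 0; rewrite addr0 => /eqP; rewrite -subr_eq0 opprD addNKr oppr_eq0 => /eqP.
by have := tl k x 0; rewrite !addr0 t00 addr0.
Qed.

Lemma ts_pos x : pos x -> 0 <= tau x.
Proof. by have [_ tp _ _] := ht; move=> /positive_elementE; exact: tp. Qed.

Lemma ts1 : tau 1 = 1. Proof. by have [_ _] := ht. Qed.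

Lemma ts_real_alg c : tau c%:C%:A = c%:C.
Proof. by rewrite tsZ ts1 mulr1. Qed.

Lemma ts_sa x : star x = x -> tau x = (complex.Re (tau x))%:C.
Proof.
move=> sx; have := ts_pos (ge_nrm_add_pos sx (lexx _)); rewrite tsD ts_real_alg.
case: (tau x) => u v; rewrite lecE /= => /andP[/eqP].
by rewrite add0r => ->.
Qed.

Lemma re_rtrace : rtrace (fun x => complex.Re (tau x)).
Proof.
have [_ _ _ tc] := ht; split.
- by move=> x y; rewrite tsD; case: (tau x) => ? ?; case: (tau y).
- by move=> c x; rewrite tsZ; case: (tau x) => u v /=; rewrite mul0r subr0.
- by move=> x y; rewrite tc.
- by move=> x /ts_pos; case: (tau x) => u v; rewrite lecE => /andP[].
- by rewrite ts1.
- move=> x; have [h [k [sh sk ->]]] := cartesian x.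
  rewrite starD starZi sh sk -scaleNr !tsD !tsZ (ts_sa sh) (ts_sa sk) /=; ring.
Qed.

Lemma ts_cplx x : tau x = complex.Re (tau x) +i* - complex.Re (tau ('i%C *: x)).
Proof. by rewrite tsZ; case: (tau x) => u v /=; congr (_ +i* _); ring. Qed.

End RealPart.

(** A complex linear functional is recovered from its real part. Invariance under [star] makes t
    vanish at i x for self-adjoint x, whence positivity and the value at 1. *)
Lemma cplx_tracial (t : A -> R) : rtrace t ->
  tracial_state A (fun x => t x +i* - t ('i%C *: x)).
Proof.
move=> ht; have ii x : 'i%C *: ('i%C *: x) = - x by rewrite scalerA -expr2 sqr_i scaleN1r.
have cE (k : R[i]) x : k *: x = (complex.Re k)%:C *: x + (complex.Im k)%:C *: ('i%C *: x).
  rewrite scalerA -scalerDl; congr (_ *: _); case: k => u v /=.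
  by apply/eqP; rewrite eq_complex /=; apply/andP; split; apply/eqP; ring.
split.
- move=> k x y; rewrite scalerDr !(rtD ht) scalerA mulrC -scalerA !(cE k) !(rtD ht) !(rtZ ht).
  rewrite ii (rtN ht); case: k => u v.
  by apply/eqP; rewrite eq_complex /=; apply/andP; split; apply/eqP; ring.
- move=> x /positive_elementE px; rewrite lecE /= (rt_ge0 ht) // andbT oppr_eq0; apply/eqP.
  have := rt_star ht ('i%C *: x); rewrite starZi (pos_sa px) (rtN ht); lra.
- rewrite (rt1 ht); apply/eqP; rewrite eq_complex /= eqxx oppr_eq0 /=; apply/eqP.
  have := rt_star ht ('i%C *: 1); rewrite starZi star1 (rtN ht); lra.
- move=> x y; have h : t ('i%C *: (x * y)) = t ('i%C *: (y * x)).
    by rewrite scalerAl (rtC ht) scalerAr.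
  by rewrite (rtC ht) h.
Qed.

Lemma extreme_max b : separable_space A -> (tracial_state A !=set0)%classic ->
  exists tau, extreme_points (tracial_state A) tau /\
    forall tau', tracial_state A tau' -> complex.Re (tau' b) <= complex.Re (tau b).
Proof.
move=> [D cD dD] [tau0 h0]; have [d Dd] := countable_range cD.
(* Putting b first makes the lexicographic maximum a maximum at b; the dense sequence follows. *)
pose d' k := if k is k'.+1 then d k' else b.
have [t [ht tm tx]] := lex_max_rtrace d' (ex_intro _ _ (re_rtrace h0)).
exists (fun x => t x +i* - t ('i%C *: x)); split; last first.
  by move=> tau' h'; exact: (tm _ (re_rtrace h')).
split; first exact: cplx_tracial.
move=> y z k hy hz /andP[k0 k1] e.
have kE : k = (complex.Re k)%:C.
  by move: k0; rewrite ltcE; case: (k) => u v /= /andP[/eqP -> _].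
rewrite kE -[0]/(0%:C) -[1]/(1%:C) !ltcR in k0 k1; set c := complex.Re k in kE k0 k1.
have [ry rz] := (re_rtrace hy, re_rtrace hz).
have te x : t x = c * complex.Re (y x) + (1 - c) * complex.Re (z x).
  have := congr1 (fun F : A -> R[i] => complex.Re (F x)) e; rewrite /= kE.
  rewrite [X in complex.Re X](_ : _ = c%:C * y x + (1 - c%:C) * z x) //.
  by case: (y x) => ? ?; case: (z x) => ? ? /=; move=> ->; ring.
have c01 : 0 < c < 1 by rewrite k0.
have yzd := tx _ _ c ry rz c01 te.
have ext (w : A -> R[i]) : tracial_state A w -> (forall j, complex.Re (w (d' j)) = t (d' j)) ->
    w = (fun x => t x +i* - t ('i%C *: x)).
  move=> hw wd; have <- : (fun x => complex.Re (w x)) = t.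
    by apply: (rtrace_dense_eq dD (re_rtrace hw) ht) => x /Dd[j _ <-]; exact: (wd j.+1).
  by apply/funext => x; exact: ts_cplx.
by split; apply: ext => // j; case: (yzd j).
Qed.

Lemma extreme_rtraces : separable_space A -> strict_comparison A ->
  finite_set (extreme_points (tracial_state A)) ->
  exists (n : nat) (tr : 'I_n.+1 -> A -> R), (forall i, rtrace (tr i)) /\
    forall p q, proj p -> proj q -> (forall i, tr i p < tr i q) -> subeq p q.
Proof.
move=> sep [T0 comp] /finite_seqP[s sE].
(* Maximizing at 0 merely produces some extreme trace, so the list is nonempty. *)
have [tau1 [ex1 _]] := extreme_max 0 sep T0.
have : tau1 \in s by move: ex1; rewrite sE.
case: s sE => // tau s sE _; exists (size s), (fun i x => complex.Re (nth tau (tau :: s) i x)).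
split=> [i|p q pp pq lt].
  have : (extreme_points (tracial_state A) (nth tau (tau :: s) i))%classic by rewrite sE /= mem_nth.
  by case=> /re_rtrace.
apply: mvn_lt_subeq => //; apply: comp => // tau' h'.
have [tau2 [ex2 max2]] := extreme_max (p - q) sep T0.
have [i iE] : exists i : 'I_(size s).+1, nth tau (tau :: s) i = tau2.
  have t2 : tau2 \in tau :: s by move: ex2; rewrite sE.
  have i2 : (index tau2 (tau :: s) < (size s).+1)%N by rewrite index_mem.
  by exists (Ordinal i2); rewrite nth_index.
have := lt i; rewrite iE; have := max2 _ h'; have [h2 _] := ex2.
rewrite (rtB (re_rtrace h')) (rtB (re_rtrace h2)) (ts_sa h' (proj_sa pp)) (ts_sa h' (proj_sa pq)).
by rewrite ltcR /=; lra.
Qed.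

(** By simplicity the closure of the algebraic ideal J generated by g is everything. An element of J
    at distance less than 1 from the unit is invertible, so 1 itself lies in J. *)
Lemma simple_generated : simple_cstar A -> forall g, proj g -> g <> 0 ->
  exists (m : nat) (x y : nat -> A), 1 = \sum_(j < m) x j * g * y j.
Proof.
move=> simp g pg g0.
pose J x := exists (m : nat) (u v : nat -> A), x = \sum_(j < m) u j * g * v j.
have JD x y : J x -> J y -> J (x + y).
  move=> [m [u [v ->]]] [m' [u' [v' ->]]].
  exists (m + m')%N, (fun j => if (j < m)%N then u j else u' (j - m)%N),
    (fun j => if (j < m)%N then v j else v' (j - m)%N).
  rewrite big_split_ord /=; congr (_ + _); apply: eq_bigr => j _; first by rewrite ltn_ord.
  by rewrite ltnNge leq_addr /= addKn.
have Jl z x : J x -> J (z * x).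
  move=> [m [u [v ->]]]; exists m, (fun j => z * u j), v.
  by rewrite mulr_sumr; apply: eq_bigr => j _; rewrite !mulrA.
have Jr z x : J x -> J (x * z).
  move=> [m [u [v ->]]]; exists m, u, (fun j => v j * z).
  by rewrite mulr_suml; apply: eq_bigr => j _; rewrite !mulrA.
have J0 : J 0 by exists 0%N, (fun=> 0), (fun=> 0); rewrite big_ord0.
pose I : set A := [set x | forall e : R, 0 < e -> exists2 y, J y & nrm (x - y) < e]%classic.
have JI x : J x -> I x by move=> Jx e e0; exists x; rewrite ?subrr ?nrm0.
have idI : two_sided_ideal I.
  have bd (z : A) (e : R) : 0 < e -> exists2 e' : R, 0 < e' & forall w, nrm w < e' -> nrm z * nrm w < e.
    move=> e0; have z0 := nrm_ge0 z; exists (e / (nrm z + 1)); first by apply: divr_gt0; lra.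
    move=> w; rewrite ltr_pdivlMr; last by lra.
    by have := nrm_ge0 w; nra.
  split; first exact: JI.
  - move=> x y Ix Iy e e0; have e2 : 0 < e / 2 by lra.
    have [x' Jx hx] := Ix _ e2; have [y' Jy hy] := Iy _ e2; exists (x' + y'); first exact: JD.
    by have := nrmD (x - x') (y - y'); rewrite opprD addrACA; lra.
  - move=> z x Ix e e0; have [e' e'0 he] := bd z e e0; have [y Jy hy] := Ix _ e'0.
    exists (z * y); first exact: Jl.
    by rewrite -mulrBr; apply: le_lt_trans (nrmM _ _) _; exact: he.
  - move=> z x Ix e e0; have [e' e'0 he] := bd z e e0; have [y Jy hy] := Ix _ e'0.
    exists (y * z); first exact: Jr.
    by rewrite -mulrBl; apply: le_lt_trans (nrmM _ _) _; rewrite mulrC; exact: he.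
have clI : closed I.
  move=> x cx e e0; have e2 : 0 < (e / 2)%:C :> R[i] by rewrite ltcR; lra.
  have [y [Iy xy]] := cx _ (nbhsx_ballx x _ e2).
  move: xy; rewrite -ball_normE /= nrmE ltcR => xy.
  have e3 : 0 < e / 2 by lra.
  have [z Jz yz] := Iy _ e3; exists z => //.
  by have := nrmD (x - y) (y - z); rewrite addrA subrK; lra.
have Ig : I g.
  by apply: JI; exists 1%N, (fun=> 1), (fun=> 1); rewrite big_ord1 mul1r mulr1.
have [I0|IT] := simp I idI clI.
  by move: Ig; rewrite I0 => /g0.
have [y Jy hy] : exists2 y, J y & nrm (1 - y) < 1.
  have I1 : I 1 by rewrite IT.
  exact: I1 ltr01.
have uy : y \is a GRing.unit by have := unit_1B hy; rewrite opprB addrC subrK.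
by have := Jr y^-1 y Jy; rewrite mulrV.
Qed.

End TracialStates.

Theorem corollary6p5 (R : realType) (A : cstarAlgType R)
  (Asimple : simple_cstar A)
  (Aseparable : separable_space A)
  (Arr0 : real_rank_zero A)
  (Asr1 : stable_rank_one A)
  (Acomparison : strict_comparison A)
  (Aextremal : finite_set (extreme_points (tracial_state A)))
  (a : A) (a_ge0 : positive_element A a) :
  positive_combination_of_projections a.
Proof.
have [n [tr [htr cmp]]] := extreme_rtraces Aseparable Acomparison Aextremal.
apply: (positive_pcp htr (real_rank_zeroE Arr0) cmp (simple_generated Asimple) ord0).
exact/positive_elementE.
Qed.
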